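(* Let $A$ be a bounded linear operator on a complex separable infinite-dimensional Banach space $Z$. Suppose that there exists an eigenvectorfield $E\in L^2(\mathbb{T};Z)$ for $A$ such that (i) whenever $B$ is a Borel subset of $\mathbb{T}$ of full Lebesgue measure, $\overline{\mathrm{span}}\,[E(\lambda);\ \lambda\in B]=Z$; (ii) there exist a non-zero functional $z_0^*\in Z^*$ and a trigonometric polynomial $p$ such that $\langle z_0^*,E(\lambda)\rangle=p(\lambda)$ almost everywhere on $\mathbb{T}$; (iii) if we set $\widehat{E}(n)=\int_{\mathbb{T}}\lambda^{-n}E(\lambda)\,d\lambda$ for every $n\in\mathbb{Z}$, then the series $\sum_{n\in\mathbb{Z}}\widehat{E}(n)$ is unconditionally convergent in $Z$. Then $A$ is universal for invertible ergodic systems. If moreover $\widehat{E}(-r)=0$ for some integer $r\in\mathbb{Z}$ (so that $\widehat{E}(-n)=0$ for every $n\ge r$), then $A$ is universal for ergodic systems.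
   Context: $\mathbb{T}=\{\lambda\in\mathbb{C}:|\lambda|=1\}$ and $d\lambda$ is the normalized Lebesgue measure on $\mathbb{T}$. An eigenvectorfield $E\in L^2(\mathbb{T};Z)$ for $A$ is a (strongly) measurable map $E:\mathbb{T}\to Z$ with $\int_{\mathbb{T}}\|E(\lambda)\|^2d\lambda<+\infty$ and $AE(\lambda)=\lambda E(\lambda)$ for almost every $\lambda\in\mathbb{T}$. A trigonometric polynomial is a finite linear combination of the functions $\lambda\mapsto\lambda^n$, $n\in\mathbb{Z}$. A dynamical system $(X,\mathcal{B},\mu;T)$ consists of a probability space $(X,\mathcal{B},\mu)$ and a $\mu$-preserving measurable transformation $T$ of $X$; it is invertible if $T$ is invertible (with measurable inverse, mod $\mu$). A standard Lebesgue probability space is a probability space isomorphic (mod null sets) to $[0,1]$ with Lebesgue measure. Isomorphism of dynamical systems means measure-theoretic isomorphism (mod null sets). $\mathcal{B}_Z$ denotes the Borel $\sigma$-field of $Z$; a Borel probability measure $\nu$ on $Z$ has full support if $\nu(U)>0$ for every non-empty open $U\subseteq Z$. A bounded operator $A$ on $Z$ is universal for ergodic systems (resp. universal for invertible ergodic systems) if for every ergodic (resp. invertible ergodic) dynamical system $(X,\mathcal{B},\mu;T)$ on a standard Lebesgue probability space there exists an $A$-invariant Borel probability measure $\nu$ on $Z$ with full support such that the dynamical systems $(X,\mathcal{B},\mu;T)$ and $(Z,\mathcal{B}_Z,\nu;A)$ are isomorphic. *)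

(* Defs.v *)
From HB Require Import structures.
From mathcomp Require Import all_boot all_order all_algebra.
From mathcomp Require Import complex.
From mathcomp Require Import all_classical all_reals all_analysis.

Set Implicit Arguments.
Unset Strict Implicit.
Unset Printing Implicit Defensive.

Import Order.TTheory GRing.Theory Num.Theory.
Import numFieldNormedType.Exports.

Local Open Scope classical_set_scope.
Local Open Scope ring_scope.
Local Open Scope complex_scope.

Notation borel T := (g_sigma_algebraType (@open T)).

(* [R[i]] itself carries no topology in the library; its regular module
   [R[i]^o] does. *)
Notation Cborel R := (borel (complex R)^o).

Section BochnerIntegral.
Context {d : measure_display} {T : measurableType d} {R : realType}.
Context {Z : normedModType R[i]}.
Variable mu : probability T R.
Implicit Types (s f : T -> Z) (v z : Z).

(* The norm of [Z] takes its values in [R[i]], on the nonnegative real axis. *)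
Definition rnorm z : R := complex.Re `|z|.

Definition simple_fun s :=
  finite_set (range s) /\ forall z, measurable (s @^-1` [set z]).

Definition simple_integral s : Z :=
  \sum_(z \in range s) (fine (mu (s @^-1` [set z])))%:C *: z.

Definition strongly_measurable f := exists s_ : nat -> T -> Z,
  (forall n, simple_fun (s_ n)) /\
  \forall x \ae mu, s_ n x @[n --> \oo] --> f x.

Definition is_bochner_integral f v := exists s_ : nat -> T -> Z,
  [/\ forall n, simple_fun (s_ n),
      \forall x \ae mu, s_ n x @[n --> \oo] --> f x,
      (\int[mu]_x (rnorm (f x - s_ n x))%:E)%E @[n --> \oo] --> 0%E &
      simple_integral (s_ n) @[n --> \oo] --> v].

(* Defaults to 0 when [f] is not Bochner integrable. *)
Definition bochner_integral f : Z := xget 0 [set v | is_bochner_integral f v].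

End BochnerIntegral.

(* Elements of the unit circle are represented as complex numbers: its
   normalized Lebesgue measure is a Borel measure on the plane, concentrated on
   the circle, namely the law of exp (2 i pi t) for t uniform on [0, 1]. *)
Section Circle.
Context {R : realType}.

Definition circle : set R[i] := [set l | `|l| = 1].

Definition circle_param (t : measurableTypeR R) : Cborel R :=
  cos (2 * pi * t) +i* sin (2 * pi * t).

Lemma continuous_circle_param : continuous (circle_param : R -> R[i]^o).
Proof.
have cf (f : R -> R) : continuous f -> continuous (fun t => f (2 * pi * t)).
  move=> cf t; apply: (@continuous_comp _ _ _ (fun t => 2 * pi * t) f).
    by apply: cvgM; [exact: cvg_cst | exact: cvg_id].
  exact: cf.
move=> t; apply/cvgrPdist_lt => e; rewrite ltcE/= => /andP[/eqP Ime Ree].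
have e2 : 0 < complex.Re e / 2 by rewrite divr_gt0.
have /cvgrPdist_lt/(_ _ e2) hc := cf _ (@continuous_cos R) t.
have /cvgrPdist_lt/(_ _ e2) hs := cf _ (@continuous_sin R) t.
near=> u.
have lec : `|cos (2 * pi * t) - cos (2 * pi * u)| < complex.Re e / 2.
  by near: u.
have les : `|sin (2 * pi * t) - sin (2 * pi * u)| < complex.Re e / 2.
  by near: u.
rewrite /circle_param.
set a := cos _ - cos _ in lec; set b := sin _ - sin _ in les.
rewrite [X in `|X|](_ : _ = (a +i* 0) + (0 +i* b) :> R[i]); last first.
  by simpc.
apply: le_lt_trans (ler_normD _ _) _; rewrite !normc_def/=.
rewrite !expr0n/= addr0 add0r !sqrtr_sqr ltcE/= Ime addr0 eqxx/=.
by rewrite [ltRHS]splitr ltrD.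
Unshelve. all: by end_near. Qed.

Let measurable_circle_param : measurable_fun setT circle_param.
Proof.
apply: (@measurability _ _ _ (Cborel R) setT circle_param (@open R[i]^o)) => //.
move=> _ [B oB <-]; rewrite setTI.
apply: measurable_realfun.open_measurable.
by move/continuousP: continuous_circle_param; exact.
Qed.

HB.instance Definition _ :=
  isMeasurableFun.Build _ _ _ _ circle_param measurable_circle_param.

Definition circle_measure : probability (Cborel R) R :=
  distribution (uniform_prob (@ltr01 R)) circle_param.

Definition trigonometric_polynomial (p : R[i] -> R[i]) :=
  exists c : seq (int * R[i]),
    forall l, circle l -> p l = \sum_(k <- c) k.2 * l ^ k.1.

End Circle.

Section BanachSpaces.
Context {R : realType} {Z : normedModType R[i]}.

Definition separable := exists2 D : set Z, countable D & dense D.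

Definition linear_span (S : set Z) : set Z :=
  [set z | exists c : seq (R[i] * Z),
    (forall k, k \in c -> S k.2) /\ z = \sum_(k <- c) k.1 *: k.2].

Definition infinite_dimensional :=
  ~ exists S : set Z, finite_set S /\ linear_span S = setT.

Definition unconditionally_convergent (x : int -> Z) :=
  forall s : nat -> int, bijective s -> cvgn (series (x \o s)).

Definition L2_eigenvectorfield (A : Z -> Z) (E : R[i] -> Z) :=
  [/\ strongly_measurable circle_measure (E : Cborel R -> Z),
      (\int[circle_measure]_l (rnorm (E l) ^+ 2)%:E < +oo)%E &
      \forall l \ae circle_measure, A (E l) = (l : R[i]) *: E l].

Definition fourier_coef (E : R[i] -> Z) (n : int) : Z :=
  bochner_integral circle_measure
    (fun l : Cborel R => (l : R[i]) ^ (- n) *: E l).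

End BanachSpaces.
Arguments separable {R} Z.
Arguments infinite_dimensional {R} Z.

(* Isomorphisms are taken between the completed measure spaces: maps need only
   be measurable for the completed sigma-algebra.  This makes it irrelevant
   whether [0, 1] carries its Borel or its Lebesgue sigma-algebra, and whether
   or not the sigma-algebra of a standard space is complete. *)
Section Isomorphism.
Context {R : realType}.

Definition measure_preserving_mod0 {d d' : measure_display}
    {X : measurableType d} {Y : measurableType d'}
    (mu : probability X R) (nu : probability Y R) (f : X -> Y) :=
  forall B : set Y, measurable B -> exists A N : set X,
    [/\ measurable A, mu.-negligible N, f @^-1` B = A `|` N & mu A = nu B].

Definition isomorphism_mod0 {d d' : measure_display}
    {X : measurableType d} {Y : measurableType d'}
    (mu : probability X R) (nu : probability Y R) (f : X -> Y) (g : Y -> X) :=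
  [/\ measure_preserving_mod0 mu nu f,
      measure_preserving_mod0 nu mu g,
      \forall x \ae mu, g (f x) = x &
      \forall y \ae nu, f (g y) = y].

Definition isomorphic_systems {d d' : measure_display}
    {X : measurableType d} {Y : measurableType d'}
    (mu : probability X R) (T : X -> X) (nu : probability Y R) (S : Y -> Y) :=
  exists (f : X -> Y) (g : Y -> X),
    isomorphism_mod0 mu nu f g /\ \forall x \ae mu, f (T x) = S (f x).

Definition standard_lebesgue {d : measure_display} {X : measurableType d}
    (mu : probability X R) :=
  exists (f : X -> measurableTypeR R) (g : measurableTypeR R -> X),
    isomorphism_mod0 mu (uniform_prob (@ltr01 R)) f g.

End Isomorphism.

Section Systems.
Context {R : realType} {d : measure_display} {X : measurableType d}.
Variables (mu : probability X R) (T : X -> X).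

Definition invariant_measure :=
  forall B : set X, measurable B -> mu (T @^-1` B) = mu B.

Definition dynamical_system := measurable_fun setT T /\ invariant_measure.

Definition ergodic := forall B : set X,
  measurable B -> T @^-1` B = B -> mu B = 0%E \/ mu B = 1%E.

Definition invertible_mod0 := exists S : X -> X, isomorphism_mod0 mu mu T S.

End Systems.

Section Universality.
Context {R : realType} {Z : normedModType R[i]}.
Variable A : Z -> Z.

Definition full_support (nu : probability (borel Z) R) :=
  forall U : set Z, open U -> U !=set0 -> (0 < nu U)%E.

Definition has_model {d : measure_display} {X : measurableType d}
    (mu : probability X R) (T : X -> X) :=
  exists nu : probability (borel Z) R,
    [/\ invariant_measure nu A, full_support nu &
        isomorphic_systems mu T nu A].

Definition universal_ergodic :=
  forall (d : measure_display) (X : measurableType d)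
    (mu : probability X R) (T : X -> X),
  standard_lebesgue mu -> dynamical_system mu T -> ergodic mu T ->
  has_model mu T.

Definition universal_invertible_ergodic :=
  forall (d : measure_display) (X : measurableType d)
    (mu : probability X R) (T : X -> X),
  standard_lebesgue mu -> dynamical_system mu T -> ergodic mu T ->
  invertible_mod0 mu T -> has_model mu T.

End Universality.

(* Main.v *)
Require Import Defs.
From HB Require Import structures.
From mathcomp Require Import all_boot all_order all_algebra.
From mathcomp Require Import complex.
From mathcomp Require Import all_classical all_reals all_analysis.
From mathcomp Require Import measurable_realfun.
From mathcomp Require Import zify ring lra.

Set Implicit Arguments.
Unset Strict Implicit.
Unset Printing Implicit Defensive.

Import Order.TTheory GRing.Theory Num.Theory.
Import numFieldNormedType.Exports.

Local Open Scope classical_set_scope.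
Local Open Scope ring_scope.
Local Open Scope complex_scope.

(* Let [c n] be the Fourier coefficients of [E]. Then [A (c n) = c (n - 1)], the
   [c n] have dense span, and [z0 (c n)] is nonzero for finitely many [n], and for
   at least one. Given an ergodic system [T] and a finite-valued [f], put
   [Phi_f y = \sum_n f (T^n y) c n]; the series converges by unconditionality and
   [A \o Phi_f = Phi_f \o T]. If [T] is not invertible, a shift of the indices
   makes [c n = 0] for [n < 0], so only nonnegative powers of [T] occur.

   The model is the law of a limit [Phi] of maps [Phi_f], found by a Baire
   category argument for convergence in probability. Two kinds of requirements
   are open and dense. To charge a given ball, overwrite [f] along short orbits of
   a small set so that [Phi_f] approximates the centre of the ball. To make a
   given Borel set [B] readable off [Phi_f], perturb [f] so that its values on [B]
   and off [B] are disjoint, and insert rare long blocks of a marker symbol of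
   large real part. The numbers [z0 (A^k (Phi_f y))] are the values of a linear
   recurrence, with coefficients [z0 (c n)], on the [f]-name of [y]. If two names
   give the same values up to a marker block, their difference solves the
   homogeneous recurrence with values in a finite set; by the pigeonhole principle
   it is periodic, with period at most the length of a block, and it vanishes
   since its real part is nonpositive on one block of markers and nonnegative on
   the other. Finiteness yields a margin, so this survives small perturbations.
   Applied to a countable separating family of sets [B], this makes [Phi] an
   isomorphism onto its law.

   Density of the span of the [c n]: the functions by which one may multiply [E]
   without leaving the closed span contain the trigonometric polynomials, hence by
   a Weierstrass argument the indicators of discs, hence all Borel indicators. So
   [E] takes almost all its values in the closed span. *)

(** The limit [Phi] is in general no longer a sum over an orbit, so whatever is wanted of it must be
    secured on the approximants with a margin; only the relation with [T] is closed and passes to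
    the limit by itself. This is why injectivity is replaced by reading off one set at a time,
    outside a set of small measure: on the unit interval a sequence of sets is enough. Overwriting
    [f] is cheap because the tails of the series are small uniformly over bounded coefficients:
    changing [f] on a set of small measure matters only where the orbit meets that set within a
    fixed window of times. The functional sees a name only from the least index [a] with [z0 (c a)]
    nonzero onwards. For invertible systems the indices are shifted so that [a = 0]. Otherwise the
    vanishing of the [c n] with [n < 0] imposes the shift, and the letters at times below [a] escape
    [z0]. They are recovered from [c 0 != 0]: if two names last disagree below [a] at time [m], the
    [m]-th power of [A] moves this disagreement to the term of [c 0], with nothing before it and
    agreement for a long time after it. *)

(** * The real-valued norm *)

Section RealNorm.
Context {R : realType} {Z : normedModType R[i]}.
Implicit Types (x y z : Z).

Lemma rnormE x : `|x| = (rnorm x)%:C.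
Proof. by rewrite /rnorm RRe_real// ger0_real. Qed.

Lemma rnorm_ge0 x : 0 <= rnorm x.
Proof. by rewrite -ler0c -rnormE. Qed.

Lemma rnorm0 : rnorm (0 : Z) = 0.
Proof. by apply: complexI; rewrite -rnormE normr0. Qed.

Lemma rnorm_eq0 x : rnorm x = 0 -> x = 0.
Proof. by move=> x0; apply/eqP; rewrite -normr_eq0 rnormE x0. Qed.

Lemma rnormN x : rnorm (- x) = rnorm x.
Proof. by rewrite /rnorm normrN. Qed.

Lemma rnormD x y : rnorm (x + y) <= rnorm x + rnorm y.
Proof. by rewrite -lecR rmorphD /= -!rnormE ler_normD. Qed.

Lemma rnormB x y : rnorm (x - y) = rnorm (y - x).
Proof. by rewrite -rnormN opprB. Qed.

Lemma rnorm_triangle x y z : rnorm (x - z) <= rnorm (x - y) + rnorm (y - z).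
Proof. by apply: le_trans (rnormD _ _); rewrite addrA subrK. Qed.

Lemma rnormB_le x y : rnorm x - rnorm y <= rnorm (x - y).
Proof. by rewrite lerBlDr -[x in leLHS](subrK y) rnormD. Qed.

Lemma rnormZ (a : R[i]) x : rnorm (a *: x) = rnorm (a : R[i]^o) * rnorm x.
Proof. by apply: complexI; rewrite rmorphM /= -!rnormE normrZ. Qed.

Lemma rnorm_sum I (s : seq I) (P : pred I) (F : I -> Z) :
  rnorm (\sum_(i <- s | P i) F i) <= \sum_(i <- s | P i) rnorm (F i).
Proof.
elim/big_rec2: _ => [|i y1 y2 _ le12]; first by rewrite rnorm0.
by rewrite (le_trans (rnormD _ _))// lerD2l.
Qed.

Lemma rcvgP {T} {F : set_system T} {FF : Filter F} (f : T -> Z) (l : Z) :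
  f @ F --> l <-> forall e : R, 0 < e -> \forall t \near F, rnorm (l - f t) < e.
Proof.
split=> [/cvgrPdist_lt fl e e0|fl].
  have := fl e%:C; rewrite ltcR => /(_ e0); apply: filterS => t.
  by rewrite rnormE ltcR.
apply/cvgrPdist_lt => e; rewrite ltcE/= => /andP[/eqP Ime Ree].
move: (fl _ Ree); apply: filterS => t.
by rewrite rnormE ltcE /= Ime eqxx.
Qed.

Lemma cvg_rnorm {T} {F : set_system T} {FF : Filter F} (f : T -> Z) (l : Z) :
  f @ F --> l -> rnorm (f t) @[t --> F] --> rnorm l.
Proof.
move=> /rcvgP fl; apply/cvgrPdist_lt => e /fl; apply: filterS => t.
apply: le_lt_trans; rewrite ler_norml rnormB_le andbT lerNl opprB.
by rewrite rnormB rnormB_le.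
Qed.

Lemma openP_rnorm (U : set Z) :
  open U <-> forall z, U z -> exists2 e : R, 0 < e & forall y, rnorm (z - y) < e -> U y.
Proof.
rewrite openE; split=> [oU z /oU|oU z /oU[e e0 zU]].
  rewrite /interior -nbhs_ballE => -[e/= e0 eU].
  have : 0 < e by [].
  rewrite ltcE/= => /andP[/eqP Ime Ree].
  exists (complex.Re e) => // y zy; apply: eU; rewrite -ball_normE/=.
  by rewrite rnormE ltcE/= Ime eqxx.
rewrite /interior -nbhs_ballE; exists e%:C => /=; first by rewrite ltcR.
by move=> y; rewrite -ball_normE/= rnormE ltcR; exact: zU.
Qed.

Lemma open_rball (z : Z) (r : R) : open [set y | rnorm (z - y) < r].
Proof.
apply/openP_rnorm => y /= yr; exists (r - rnorm (z - y)); first by rewrite subr_gt0.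
move=> w yw; apply: le_lt_trans (rnorm_triangle z y w) _.
by rewrite addrC -ltrBrDr.
Qed.

Lemma closureP_rnorm (S : set Z) z :
  closure S z <-> forall e : R, 0 < e -> exists2 y, S y & rnorm (z - y) < e.
Proof.
split=> [Sz e e0|Sz B].
  have [|y [Sy zy]] := Sz [set y | rnorm (z - y) < e].
    apply: open_nbhs_nbhs; split; first exact: open_rball.
    by rewrite /= subrr rnorm0.
  by exists y.
rewrite -nbhs_ballE => -[e/= e0 eB].
have : 0 < e by [].
rewrite ltcE/= => /andP[/eqP Ime Ree].
have [y Sy zy] := Sz _ Ree; exists y; split => //; apply: eB.
by rewrite -ball_normE/= rnormE ltcE/= Ime eqxx.
Qed.

Definition dense_sequence (q : nat -> Z) :=
  forall (z : Z) (e : R), 0 < e -> exists i, rnorm (z - q i) < e.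

(** Inner parallel sets: for [s = 1/(m+1)] they exhaust an open [U], and a point of one of them
    stays in [U] under perturbations of size at most [s]. The strict inequality [s < r] makes them
    open. *)
Lemma open_parallel (U : set Z) (s : R) :
  open [set z | exists2 r : R, s < r & forall w, rnorm (z - w) < r -> U w].
Proof.
apply/openP_rnorm => z [r sr zU]; exists ((r - s) / 2); first by rewrite divr_gt0// subr_gt0.
move=> w zw; exists ((r + s) / 2); first by lra.
move=> x wx; apply: zU; apply: le_lt_trans (rnorm_triangle z w x) _.
by move: zw wx; lra.
Qed.

End RealNorm.

Lemma rnorm_complex {R : realType} (a : R) : rnorm (a%:C : R[i]^o) = `|a|.
Proof. by rewrite /rnorm normc_def/= expr0n/= addr0 sqrtr_sqr. Qed.

Lemma normr_Re {R : realType} (z : R[i]) : `|complex.Re z| <= rnorm (z : R[i]^o).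
Proof. by rewrite /rnorm normc_def/= -sqrtr_sqr ler_wsqrtr// lerDl sqr_ge0. Qed.

Lemma normr_Im {R : realType} (z : R[i]) : `|complex.Im z| <= rnorm (z : R[i]^o).
Proof. by rewrite /rnorm normc_def/= -sqrtr_sqr ler_wsqrtr// lerDr sqr_ge0. Qed.

Lemma rcauchy_cvg {R : realType} {Z : completeNormedModType R[i]} (u : nat -> Z) :
  (forall e : R, 0 < e -> exists N, forall n, (N <= n)%N -> rnorm (u N - u n) <= e) ->
  cvgn u.
Proof.
move=> uc; apply: cauchy_cvg; apply: cauchy_exP => e e0.
have : 0 < e by [].
rewrite ltcE/= => /andP[/eqP Ime Ree].
have [|N Nu] := uc (complex.Re e / 2); first by rewrite divr_gt0.
exists (u N); rewrite /fmap/=; exists N => // n /= Nn.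
rewrite -ball_normE/= rnormE ltcE/= Ime eqxx/=.
by apply: le_lt_trans (Nu n Nn) _; rewrite ltr_pdivrMr// mulr_natr mulr2n ltrDl.
Qed.

Lemma rnorm_bounded {R : realType} {Z W : normedModType R[i]} (A : {linear Z -> W}) :
  continuous A -> exists2 K : R, 0 < K & forall z, rnorm (A z) <= K * rnorm z.
Proof.
move=> cA.
have : bounded_near A (nbhs (0 : Z)) by apply/linear_bounded_continuous.
move=> /linear_boundedP /pinfty_ex_gt0[M].
rewrite ltcE/= => /andP[/eqP ImM ReM] AM.
exists (complex.Re M) => // z; have := AM z.
have -> : M = (complex.Re M)%:C by case: M ImM {ReM AM} => a b /= ->.
by rewrite !rnormE -rmorphM /= lecR.
Qed.

(** * Unconditional convergence *)

Definition window (N : nat) : seq int :=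
  locked [seq Posz i - Posz N | i <- iota 0 N.*2.+1].

Lemma mem_window N (n : int) : (n \in window N) = (`|n| <= N)%N.
Proof.
rewrite /window -lock; apply/mapP/idP => [[i ]|nN].
  by rewrite mem_iota => /andP[_ iN] ->; lia.
exists (`|(n + Posz N)%R|)%N; last by lia.
by rewrite mem_iota; apply/andP; split => //; lia.
Qed.

Lemma uniq_window N : uniq (window N).
Proof. by rewrite /window -lock map_inj_uniq ?iota_uniq// => i j; lia. Qed.

Section Rearrangement.
Context {R : realType} {Z : completeNormedModType R[i]} (c : int -> Z).

Definition unconditionally_cauchy := forall e : R, 0 < e ->
  exists N : nat, forall F : seq int, uniq F ->
    (forall n, n \in F -> (N < `|n|)%N) -> rnorm (\sum_(n <- F) c n) <= e.

(* If the tails are not uniformly small over finite sets, an enumeration of the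
   integers in which large finite blocks keep occurring gives a divergent
   rearrangement. *)
Lemma unconditionally_convergent_cauchy :
  unconditionally_convergent c -> unconditionally_cauchy.
Proof.
move=> uc e e0; apply: contrapT => /forallNP hF.
have {hF}[F hF] : {F : nat -> seq int & forall N, [/\ uniq (F N),
    (forall n, n \in F N -> (N < `|n|)%N) & e < rnorm (\sum_(n <- F N) c n)]}.
  apply: (@choice _ _ (fun N F => [/\ uniq F,
    (forall n, n \in F -> (N < `|n|)%N) & e < rnorm (\sum_(n <- F) c n)])) => N.
  have /existsNP[F /not_implyP[uF /not_implyP[FN /negP]]] := hF N.
  by rewrite -ltNge => eF; exists F.
pose bd (l : seq int) := (\max_(n <- l) `|n|)%N.
have bdP l n : n \in l -> (`|n| <= bd l)%N.
  by move=> nl; exact: (@leq_bigmax_seq _ l xpredT (fun n : int => `|n|%N)).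

(* Stage [k] appends a block with large sum, whose indices exceed in absolute value everything
   listed so far, and then the missing integers of [[-k, k]]. The blocks spoil the Cauchy property,
   the windows make the list exhaust the integers. *)
pose ext k l := (l ++ F (bd l)) ++ [seq n <- window k | n \notin l ++ F (bd l)].
pose L := fix L k := if k is k'.+1 then ext k' (L k') else [::].
have L_S k : L k.+1 = ext k (L k) by [].
have uL k : uniq (L k).
  elim: k => // k ih; rewrite L_S /ext cat_uniq filter_uniq ?uniq_window// andbT.
  apply/andP; split; last first.
    by apply/hasPn => n; rewrite mem_filter => /andP[].
  have [uF FN _] := hF (bd (L k)).
  rewrite cat_uniq ih uF andbT /=; apply/hasPn => n /FN nb.
  by apply/negP => /bdP; rewrite leqNgt nb.
have F_size N : (0 < size (F N))%N.
  have [_ _] := hF N; case: (F N) => //; rewrite big_nil rnorm0.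
  by move=> /(lt_trans e0); rewrite ltxx.
have sL k : (k <= size (L k))%N.
  elim: k => // k ih; rewrite L_S /ext !size_cat.
  have := F_size (bd (L k)); lia.
have pL j k : (j <= k)%N -> exists l, L k = L j ++ l.
  elim: k => [|k ih]; first by rewrite leqn0 => /eqP ->; exists [::].
  rewrite leq_eqVlt => /predU1P[->|/ih[l Ll]]; first by exists [::]; rewrite cats0.
  by rewrite L_S /ext Ll -!catA; eexists.
have nthL j k i : (i < size (L j))%N -> (i < size (L k))%N ->
    nth 0 (L j) i = nth 0 (L k) i.
  wlog jk : j k / (j <= k)%N.
    by move=> H; case/orP: (leq_total j k) => /H h ? ?; [|symmetry]; exact: h.
  by move=> ij _; have [l ->] := pL _ _ jk; rewrite nth_cat ij.
(* [L i.+1] has more than [i] entries and the lists extend each other, so every longer list gives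
   the same value. *)
pose s i := nth 0 (L i.+1) i.
have sE i k : (i < size (L k))%N -> s i = nth 0 (L k) i by move=> ik; exact: nthL.
have inj_s : injective s.
  move=> i j; pose m := (maxn i j).+1.
  have im : (i < size (L m))%N by apply: leq_trans (sL m); rewrite ltnS leq_maxl.
  have jm : (j < size (L m))%N by apply: leq_trans (sL m); rewrite ltnS leq_maxr.
  by rewrite (sE _ m)// (sE _ m)// => /eqP; rewrite nth_uniq// => /eqP.
have memL (n : int) : n \in L `|n|%N.+1.
  rewrite L_S /ext mem_cat mem_filter mem_window leqnn andbT.
  exact: orbN.
pose g (n : int) := index n (L `|n|%N.+1).
have gK : cancel g s.
  move=> n; rewrite /g (sE _ `|n|%N.+1) ?index_mem ?memL// nth_index// memL.
have bs : bijective s by exists g => // i; apply: inj_s; rewrite gK.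
have /cvg_ex[l /rcvgP sl] := uc s bs.
have [|N _ Nl] := sl (e / 2); first by rewrite divr_gt0.
pose m := size (L N); pose M := size (L N ++ F (bd (L N))).
have mM : (m <= M)%N by rewrite /M size_cat leq_addr.
have MN : (M <= size (L N.+1))%N by rewrite L_S /ext size_cat leq_addr.
have serE q k : (q <= size (L k))%N ->
    series (c \o s) q = \sum_(n <- take q (L k)) c n.
  move=> qk; rewrite (big_nth 0) size_take_min (minn_idPl qk) /series/=.
  rewrite !big_nat; apply: eq_bigr => i /andP[_ iq].
  by rewrite nth_take// -sE// (leq_trans iq).
have := Nl m (sL N); have := Nl M (leq_trans (sL N) mM).
rewrite (serE M N.+1)// (serE m N)// take_size.
rewrite L_S /ext take_cat ltnn subnn take0 cats0 big_cat/=.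
set u := \sum_(_ <- L N) _; set v := \sum_(_ <- _) _ => h1 h2.
have [_ _] := hF (bd (L N)); rewrite -/v ltNge => /negP; apply.
have -> : v = (l - u) - (l - (u + v)) by rewrite opprB addrC addrA subrK addrC addKr.
apply: le_trans (rnormD _ _) _; rewrite rnormN.
by apply: ltW; rewrite [ltRHS]splitr ltrD.
Qed.

End Rearrangement.

(** * Bounded multipliers *)

Section Multipliers.
Context {R : realType} {Z : normedModType R[i]} (c : int -> Z).

(** The norm is convex in each coefficient, so over the cube of coefficients it is largest at a
    vertex, that is, at the sum over a subsequence. The term [z] carries the coefficients already
    treated in the induction. *)
Lemma convex_multiplier_bound (F : seq int) (a : int -> R) (e : R) (z : Z) :
  (forall n, 0 <= a n <= 1) ->
  (forall G, subseq G F -> rnorm (z + \sum_(n <- G) c n) <= e) ->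
  rnorm (z + \sum_(n <- F) (a n)%:C *: c n) <= e.
Proof.
move=> a01; elim: F z => [|m F ih] z hG.
  by rewrite big_nil; have := hG [::]; rewrite big_nil; apply.
rewrite big_cons; set S := \sum_(_ <- F) _.
have h1 : rnorm (z + S) <= e.
  by apply: ih => G GF; apply: hG; apply: subseq_trans GF (subseq_cons _ _).
have h2 : rnorm (z + c m + S) <= e.
  apply: ih => G GF; have := hG (m :: G); rewrite big_cons addrA; apply.
  by rewrite /= eqxx.
have -> : z + ((a m)%:C *: c m + S) =
    (1 - a m)%:C *: (z + S) + (a m)%:C *: (z + c m + S).
  rewrite (addrAC z (c m)) [in RHS](scalerDr _ (z + S)) rmorphB /= rmorph1.
  by rewrite scalerBl scale1r [RHS]addrA subrK [in LHS](addrC _ S) addrA.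
have /andP[a0 a1] := a01 m.
apply: le_trans (rnormD _ _) _; rewrite !rnormZ !rnorm_complex.
rewrite !ger0_norm ?subr_ge0//.
have -> : e = (1 - a m) * e + a m * e by ring.
by apply: lerD; apply: ler_wpM2l; rewrite ?subr_ge0.
Qed.

(** A real sequence bounded by [M] is [M (2 t - 1)] with [0 <= t <= 1]; convexity gives
    [2 M e + M e]. Real and imaginary parts together give the factor 6. *)
Lemma multiplier_bound (F : seq int) (b : int -> R[i]) (M e : R) : 0 < M ->
  (forall n, rnorm (b n : R[i]^o) <= M) ->
  (forall G, subseq G F -> rnorm (\sum_(n <- G) c n) <= e) ->
  rnorm (\sum_(n <- F) b n *: c n) <= 6 * M * e.
Proof.
move=> M0 bM hG.
have real_bound (a : int -> R) : (forall n, `|a n| <= M) ->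
    rnorm (\sum_(n <- F) (a n)%:C *: c n) <= 3 * M * e.
  move=> aM; pose t n := (a n / M + 1) / 2.
  have aE : \sum_(n <- F) (a n)%:C *: c n =
      (2 * M)%:C *: (0 + \sum_(n <- F) (t n)%:C *: c n) - M%:C *: \sum_(n <- F) c n.
    rewrite add0r !scaler_sumr -sumrB; apply: eq_bigr => n _.
    rewrite scalerA -scalerBl -rmorphM -rmorphB; congr (_%:C *: _).
    by rewrite /t; field; rewrite gt_eqF.
  rewrite aE; apply: le_trans (rnormD _ _) _.
  rewrite rnormN !rnormZ !rnorm_complex !gtr0_norm ?mulr_gt0//.
  have -> : 3 * M * e = 2 * M * e + M * e by ring.
  apply: lerD; apply: ler_wpM2l; rewrite ?mulr_ge0 ?(ltW M0)//; last exact: hG.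
  apply: convex_multiplier_bound => [n|G /hG]; last by rewrite add0r.
  have := aM n; rewrite ler_norml => /andP[h1 h2].
  have h3 : -1 <= a n / M by rewrite ler_pdivlMr// mulN1r.
  have h4 : a n / M <= 1 by rewrite ler_pdivrMr// mul1r.
  by rewrite /t; apply/andP; split; lra.
have bE n : b n = (complex.Re (b n))%:C + 'i%C * (complex.Im (b n))%:C.
  exact: complexE.
have -> : \sum_(n <- F) b n *: c n = \sum_(n <- F) (complex.Re (b n))%:C *: c n +
    'i%C *: \sum_(n <- F) (complex.Im (b n))%:C *: c n.
  rewrite scaler_sumr -big_split/=; apply: eq_bigr => n _.
  by rewrite {1}bE scalerDl scalerA.
have ReM n : `|complex.Re (b n)| <= M by exact: le_trans (normr_Re _) (bM n).
have ImM n : `|complex.Im (b n)| <= M by exact: le_trans (normr_Im _) (bM n).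
apply: le_trans (rnormD _ _) _; rewrite rnormZ.
have -> : rnorm ('i%C : R[i]^o) = 1.
  by rewrite /rnorm normc_def/= expr0n/= add0r expr1n sqrtr1.
have -> : 6 * M * e = 3 * M * e + 3 * M * e by ring.
by rewrite mul1r lerD// real_bound.
Qed.

End Multipliers.

(** * Two-sided sums with bounded coefficients *)

Section BilateralSum.
Context {R : realType} {Z : completeNormedModType R[i]} (c : int -> Z).
Implicit Types (b : int -> R[i]) (M e : R) (N : nat).

Definition bounded_by M b := forall n, rnorm (b n : R[i]^o) <= M.

Definition window_sum N b := \sum_(n <- window N) b n *: c n.

Definition bilateral_sum b : Z := lim (window_sum N b @[N --> \oo]).

(** The closed linear span of the [c n]: as [b] has finite support, [bilateral_sum b] is a finite
    linear combination. *)
Definition closed_span (z : Z) := forall e : R, 0 < e -> exists (b : int -> R[i]) (N : nat),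
  (forall n, (N < `|n|)%N -> b n = 0) /\ rnorm (z - bilateral_sum b) < e.

Lemma bounded_byW M M' b : M <= M' -> bounded_by M b -> bounded_by M' b.
Proof. by move=> MM' bM n; apply: le_trans (bM n) MM'. Qed.

Lemma bounded_byD M M' b b' : bounded_by M b -> bounded_by M' b' ->
  bounded_by (M + M') (fun n => b n + b' n).
Proof. by move=> h h' n; apply: le_trans (rnormD _ _) (lerD (h n) (h' n)). Qed.

Lemma bounded_byN M b : bounded_by M b -> bounded_by M (fun n => - b n).
Proof. by move=> h n; rewrite rnormN. Qed.

Definition val_bound (J : finType) (val : J -> R[i]) : R := \sum_j rnorm (val j : R[i]^o).

Lemma bounded_by_val (J : finType) (val : J -> R[i]) (b : int -> J) :
  bounded_by (val_bound val) (fun n => val (b n)).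
Proof.
move=> n; rewrite /val_bound (bigD1 (b n))//= lerDl sumr_ge0// => j _; exact: rnorm_ge0.
Qed.

Lemma finite_bounded (b : int -> R[i]) N : (forall n, (N < `|n|)%N -> b n = 0) ->
  exists M, bounded_by M b.
Proof.
move=> bN; exists (\sum_(n <- window N) rnorm (b n : R[i]^o)) => n.
have [nN|nN] := leqP `|n| N; last by rewrite bN// rnorm0 sumr_ge0// => k _; exact: rnorm_ge0.
rewrite (big_rem n) ?mem_window//= lerDl sumr_ge0// => k _; exact: rnorm_ge0.
Qed.

Hypothesis uc : unconditionally_cauchy c.

Lemma finite_tail M e : 0 < e -> exists N, forall (F : seq int) b,
  uniq F -> (forall n, n \in F -> (N < `|n|)%N) -> bounded_by M b ->
  rnorm (\sum_(n <- F) b n *: c n) <= e.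
Proof.
move=> e0; pose M' := `|M| + 1.
have M'0 : 0 < M' by rewrite ltr_wpDl.
have MM' : M <= M' by rewrite (le_trans (ler_norm M))// lerDl.
have [|N NF] := uc (_ : 0 < e / (6 * M')); first by rewrite divr_gt0// mulr_gt0.
exists N => F b uF FN bM.
have -> : e = 6 * M' * (e / (6 * M')) by rewrite mulrC divfK// mulf_neq0// gt_eqF.
apply: multiplier_bound => //; first exact: (bounded_byW MM').
move=> G GF; apply: NF; first exact: subseq_uniq GF uF.
by move=> n /(mem_subseq GF) /FN.
Qed.

Lemma window_sum_fin (F : seq int) b N : uniq F ->
  (forall n, n \in F -> (`|n| <= N)%N) -> (forall n, n \notin F -> b n = 0) ->
  window_sum N b = \sum_(n <- F) b n *: c n.
Proof.
move=> uF FN bF; rewrite /window_sum (bigID (mem F))/= addrC big1 ?add0r; last first.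
  by move=> n /bF ->; rewrite scale0r.
rewrite -big_filter; apply: perm_big; apply: uniq_perm => //.
  by rewrite filter_uniq ?uniq_window.
move=> n; rewrite mem_filter mem_window; case: (boolP (n \in F)) => //= nF.
exact: FN.
Qed.

Lemma cvg_window_sum M b : bounded_by M b ->
  window_sum N b @[N --> \oo] --> bilateral_sum b.
Proof.
move=> bM; apply: rcauchy_cvg => e e0.
have [N NF] := finite_tail M e0; exists N => n Nn.
have -> : window_sum n b = window_sum N b +
    \sum_(k <- [seq k <- window n | (N < `|k|)%N]) b k *: c k.
  rewrite /window_sum (bigID (fun k : int => (`|k| <= N)%N))/=.
  rewrite [in RHS]big_filter; congr (_ + _); last by apply: eq_bigl => k; rewrite ltnNge.
  rewrite -[LHS]big_filter; apply: perm_big; apply: uniq_perm.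
  - by rewrite filter_uniq ?uniq_window.
  - by rewrite uniq_window.
  - by move=> k; rewrite mem_filter !mem_window; lia.
rewrite opprD addNKr rnormN; apply: NF => //.
  by rewrite filter_uniq ?uniq_window.
by move=> k; rewrite mem_filter => /andP[].
Qed.

Lemma bilateral_sum_fin (F : seq int) b : uniq F ->
  (forall n, n \notin F -> b n = 0) -> bilateral_sum b = \sum_(n <- F) b n *: c n.
Proof.
move=> uF bF; apply: norm_cvg_lim; apply/rcvgP => e e0.
exists (\max_(n <- F) `|n|)%N => // N /= FN.
rewrite (window_sum_fin uF)// ?subrr ?rnorm0// => n nF.
by apply: leq_trans FN; exact: (@leq_bigmax_seq _ F xpredT (fun n : int => `|n|%N)).
Qed.

Lemma bilateral_sum_tail M e : 0 < e -> exists N, forall b, bounded_by M b ->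
  (forall n, (`|n| <= N)%N -> b n = 0) -> rnorm (bilateral_sum b) <= e.
Proof.
move=> e0; have [N NF] := finite_tail M e0; exists N => b bM b0.
apply: (cvgr_to_le (cvg_rnorm (cvg_window_sum bM))).
apply: nearW => m /=.
rewrite /window_sum (bigID (fun k : int => (`|k| <= N)%N))/= big1 ?add0r; last first.
  by move=> n /b0 ->; rewrite scale0r.
rewrite -big_filter; apply: NF => //; first by rewrite filter_uniq ?uniq_window.
by move=> k; rewrite mem_filter -ltnNge => /andP[].
Qed.

Lemma bilateral_sumD M M' b b' : bounded_by M b -> bounded_by M' b' ->
  bilateral_sum (fun n => b n + b' n) = bilateral_sum b + bilateral_sum b'.
Proof.
move=> bM bM'; apply: norm_cvg_lim.
have -> : window_sum^~ (fun n => b n + b' n) =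
    (fun N => window_sum N b + window_sum N b').
  apply/funext => N; rewrite /window_sum -big_split/=; apply: eq_bigr => n _.
  by rewrite scalerDl.
by apply: cvgD; exact: cvg_window_sum.
Qed.

Lemma bilateral_sumZ M b (a : R[i]) : bounded_by M b ->
  bilateral_sum (fun n => a * b n) = a *: bilateral_sum b.
Proof.
move=> bM; apply: norm_cvg_lim.
have -> : window_sum^~ (fun n => a * b n) = (fun N => a *: window_sum N b).
  apply/funext => N; rewrite /window_sum scaler_sumr; apply: eq_bigr => n _.
  by rewrite scalerA.
by apply: cvgZr; exact: cvg_window_sum.
Qed.

Lemma bilateral_sumB M M' b b' : bounded_by M b -> bounded_by M' b' ->
  bilateral_sum (fun n => b n - b' n) = bilateral_sum b - bilateral_sum b'.
Proof.
move=> bM bM'; rewrite (bilateral_sumD bM (bounded_byN bM')); congr (_ + _).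
rewrite -scaleN1r -(bilateral_sumZ _ bM'); congr bilateral_sum.
by apply/funext => n; rewrite mulN1r.
Qed.

Lemma bilateral_sum_bound : exists2 K : R, 0 < K &
  forall b, bounded_by 1 b -> rnorm (bilateral_sum b) <= K.
Proof.
have [N NF] := bilateral_sum_tail 1 (@ltr01 R).
pose S := \sum_(n <- window N) rnorm (c n).
exists (S + 1); first by rewrite ltr_wpDl// sumr_ge0// => n _; exact: rnorm_ge0.
move=> b b1; pose b1' n := if (`|n| <= N)%N then b n else 0.
pose b2' n := if (`|n| <= N)%N then 0 else b n.
have h1 : bounded_by 1 b1' by move=> n; rewrite /b1'; case: ifP; rewrite ?rnorm0.
have h2 : bounded_by 1 b2' by move=> n; rewrite /b2'; case: ifP; rewrite ?rnorm0.
have -> : b = fun n => b1' n + b2' n.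
  by apply/funext => n; rewrite /b1' /b2'; case: ifP; rewrite ?addr0 ?add0r.
rewrite (bilateral_sumD h1 h2); apply: le_trans (rnormD _ _) _; apply: lerD.
  rewrite (bilateral_sum_fin (uniq_window N)); last first.
    by move=> n; rewrite mem_window /b1' => /negbTE ->.
  apply: le_trans (rnorm_sum _ _ _) _; apply: ler_sum => n _.
  by rewrite rnormZ ler_piMl// rnorm_ge0.
by apply: NF => // n nN; rewrite /b2' nN.
Qed.

Lemma bilateral_sum_shift (A : {linear Z -> Z}) M b : continuous A ->
  (forall n, A (c n) = c (n - 1)) -> bounded_by M b ->
  A (bilateral_sum b) = bilateral_sum (fun n => b (n + 1)).
Proof.
move=> /rnorm_bounded[K K0 AK] Ac bM.
have M0 : 0 <= M by apply: le_trans (bM 0); exact: rnorm_ge0.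
apply/eqP; rewrite -subr_eq0; apply/eqP; apply: rnorm_eq0; apply/eqP.
rewrite eq_le rnorm_ge0 andbT; apply/ler_addgt0Pr => e e0; rewrite add0r.
have [|N NF] := bilateral_sum_tail M (_ : 0 < e / (K + 1)).
  by rewrite divr_gt0// addr_gt0.
(* The cut is at [N.+1] because the remainder is also used shifted by one, and must then still
   vanish on [[-N, N]]. *)
pose b1 n := if (`|n| <= N.+1)%N then b n else 0.
pose b2 n := if (`|n| <= N.+1)%N then 0 else b n.
have h1 : bounded_by M b1 by move=> n; rewrite /b1; case: ifP; rewrite ?rnorm0.
have h2 : bounded_by M b2 by move=> n; rewrite /b2; case: ifP; rewrite ?rnorm0.
have bE : b = fun n => b1 n + b2 n.
  by apply/funext => n; rewrite /b1 /b2; case: ifP; rewrite ?addr0 ?add0r.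
have -> : bilateral_sum b = bilateral_sum b1 + bilateral_sum b2.
  by rewrite -(bilateral_sumD h1 h2) -bE.
have h1' : bounded_by M (fun n => b1 (n + 1)) by move=> n; exact: h1.
have h2' : bounded_by M (fun n => b2 (n + 1)) by move=> n; exact: h2.
have -> : bilateral_sum (fun n => b (n + 1)) =
    bilateral_sum (fun n => b1 (n + 1)) + bilateral_sum (fun n => b2 (n + 1)).
  by rewrite -(bilateral_sumD h1' h2') bE.
have -> : bilateral_sum (fun n => b1 (n + 1)) = A (bilateral_sum b1).
  rewrite (bilateral_sum_fin (b := b1) (uniq_window N.+1)); last first.
    by move=> n; rewrite mem_window /b1 => /negbTE ->.
  pose F := [seq n - 1 | n <- window N.+1].
  rewrite (@bilateral_sum_fin F); last 2 first.
  - by rewrite map_inj_uniq ?uniq_window// => x y /addIr.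
  - move=> n nF; rewrite /b1; case: ifPn => // nN; case/negP: nF.
    by apply/mapP; exists (n + 1); rewrite ?addrK// mem_window.
  rewrite big_map linear_sum; apply: eq_bigr => n _.
  by rewrite linearZ/= Ac subrK.
rewrite linearD opprD addrACA subrr add0r.
have -> : e = K * (e / (K + 1)) + e / (K + 1) by field; rewrite gt_eqF// addr_gt0.
apply: le_trans (rnormD _ _) _; rewrite rnormN; apply: lerD.
  apply: le_trans (AK _) _; rewrite ler_pM2l//; apply: NF => // n nN.
  by rewrite /b2 leqW.
by apply: NF => // n nN; rewrite /b2; case: ifPn => //; lia.
Qed.

Lemma bilateral_sum_functional (z0 : {linear Z -> R[i]^o}) (F : seq int) M b :
  continuous z0 -> uniq F -> (forall n, n \notin F -> z0 (c n) = 0) -> bounded_by M b ->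
  z0 (bilateral_sum b) = \sum_(n <- F) b n * z0 (c n).
Proof.
move=> cz uF zF bM.
have h : z0 (window_sum N b) @[N --> \oo] --> z0 (bilateral_sum b).
  by apply: continuous_cvg; [exact: cz|exact: cvg_window_sum bM].
rewrite -(norm_cvg_lim h); apply: norm_cvg_lim; apply/rcvgP => e e0.
exists (\max_(n <- F) `|n|)%N => // N /= FN.
have -> : z0 (window_sum N b) = \sum_(n <- F) b n * z0 (c n); last first.
  by rewrite subrr rnorm0.
rewrite /window_sum linear_sum/= (bigID (mem F))/= addrC big1 ?add0r; last first.
  by move=> n /zF nF; rewrite linearZ/= nF scaler0.
rewrite -big_filter; under eq_bigr do rewrite linearZ/=.
apply: perm_big; apply: uniq_perm => //; first by rewrite filter_uniq ?uniq_window.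
move=> n; rewrite mem_filter mem_window; case: (boolP (n \in F)) => //= nF.
by apply: leq_trans FN; exact: (@leq_bigmax_seq _ F xpredT (fun n : int => `|n|%N)).
Qed.

End BilateralSum.

(** * Linear recurrences with finitely many values *)

(** The source of the margins: over finitely many letters, nonzero values are bounded away from
    0. *)
Lemma finite_gap {R : realType} (T : finType) (g : T -> R[i]) :
  exists2 e : R, 0 < e & forall t, g t != 0 -> e <= rnorm (g t : R[i]^o).
Proof.
exists (\big[Num.min/1]_(t | g t != 0) rnorm (g t : R[i]^o)).
  apply: lt_bigmin => // t gt0; rewrite lt_def rnorm_ge0 andbT.
  by apply: contra gt0 => /eqP /rnorm_eq0 ->.
by move=> t gt0; apply: bigmin_le_cond.
Qed.

Section Recurrence.
Context {F : fieldType} (d : nat) (q : nat -> F).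
Hypothesis q0 : q 0 != 0.

(** As [q 0 != 0], a term is determined by the [d] terms after it. Hence the agreement of two
    windows of length [d] spreads to the left. *)
Lemma recurrence_backward (w : nat -> F) (K i i' t j : nat) :
  (forall k, (k <= K)%N -> \sum_(l < d.+1) q l * w (k + l)%N = 0) ->
  (i < i')%N -> (i' <= K.+1)%N ->
  (forall l, (l < d)%N -> w (i + l)%N = w (i' + l)%N) ->
  (t <= i)%N -> (j < d + t)%N -> w (i - t + j)%N = w (i' - t + j)%N.
Proof.
move=> rec ii' i'K eqd; elim: t j => [|t ih] j ti jt.
  by rewrite !subn0; apply: eqd; rewrite addn0 in jt.
have ih' l : (l < d)%N -> w (i - t + l)%N = w (i' - t + l)%N.
  by move=> ld; apply: ih; [exact: ltnW | exact: ltn_addr].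
case: j jt => [_|j jt]; last first.
  have -> : (i - t.+1 + j.+1 = i - t + j)%N by lia.
  have -> : (i' - t.+1 + j.+1 = i' - t + j)%N by lia.
  by apply: ih; lia.
rewrite !addn0; apply: (mulfI q0).
have h m : (m <= K)%N -> q 0 * w m = - \sum_(l < d) q l.+1 * w (m.+1 + l)%N.
  move=> mK; apply/eqP; rewrite -addr_eq0; apply/eqP; rewrite -[RHS](rec m mK).
  rewrite [RHS]big_ord_recl /= addn0; congr (_ + _).
  by apply: eq_bigr => l _; congr (_ * w _); rewrite /bump /=; lia.
rewrite !h; [|lia|lia]; congr (- _); apply: eq_bigr => l _.
have -> : ((i - t.+1).+1 = i - t)%N by lia.
have -> : ((i' - t.+1).+1 = i' - t)%N by lia.
by rewrite ih'.
Qed.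

(** Pigeonhole among the windows of length [d] that start at [L, ..., L + N]: two of them coincide,
    and the agreement spreads to the left. The windows start beyond [L] so that all of [[0, L)] is
    reached. *)
Lemma recurrence_periodic (S : finType) (phi : S -> F) (s : nat -> S) (L : nat) :
  (forall k, (k <= L + #|{ffun 'I_d -> S}|)%N ->
     \sum_(l < d.+1) q l * phi (s (k + l)%N) = 0) ->
  exists2 r : nat, (0 < r <= #|{ffun 'I_d -> S}|)%N &
    forall k, (k < L)%N -> phi (s k) = phi (s (k + r)%N).
Proof.
set N := #|_| => rec; pose st (i : 'I_N.+1) : {ffun 'I_d -> S} := [ffun l : 'I_d => s (L + i + l)%N].
have /injectivePn[i [j ij stij]] : ~~ injectiveb st.
  by apply/negP => /injectiveP /leq_card; rewrite card_ord -/N ltnn.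
wlog {ij} ij : i j stij / (i < j)%N.
  move=> H; case: (ltngtP i j) => [/H|/H|/val_inj ij']; [exact|by apply|].
  by rewrite ij' eqxx in ij.
exists (j - i)%N; first by rewrite subn_gt0 ij /=; have := ltn_ord j; lia.
move=> k kL.
have := @recurrence_backward (phi \o s) (L + N) (L + i) (L + j) (L + i - k) 0 rec.
have -> : (L + i - (L + i - k) + 0 = k)%N by lia.
have -> : (L + j - (L + i - k) + 0 = k + (j - i))%N by lia.
apply; [lia|by have := ltn_ord j; lia| |lia|lia].
move=> l ld; have /ffunP/(_ (Ordinal ld)) := stij.
by rewrite !ffunE /= => ->.
Qed.

End Recurrence.

(** Steps of length [r <= P] cannot jump over a block of length [P]: from any [k] below [L], moving
    up or down by [r] reaches the block. *)
Lemma periodic_block (T : Type) (w : nat -> T) (r P s L : nat) :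
  (0 < r <= P)%N -> (s + P <= L)%N ->
  (forall k, (k < L)%N -> w k = w (k + r)%N) ->
  forall k, (k < L)%N -> exists2 l, (s <= l < s + P)%N & w l = w k.
Proof.
move=> /andP[r0 rP] sPL per.
have up n k : (s - k <= n)%N -> (k < s + P)%N -> exists2 l, (s <= l < s + P)%N & w l = w k.
  elim: n k => [|n ih] k kn ks; first by exists k => //; lia.
  case: (leqP s k) => sk; first by exists k => //; lia.
  have [||l ls wl] := ih (k + r)%N; [lia|lia|].
  by exists l => //; rewrite wl -per//; lia.
move=> k; elim/ltn_ind: k => k ih kL.
case: (ltnP k (s + P)) => ks; first by apply: (up s); lia.
have [||l ls wl] := ih (k - r)%N; [lia|lia|].
by exists l => //; rewrite wl per ?subnK//; lia.
Qed.

(** * Recovering names from sums *)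

Section Determination.
Context {R : realType} {Z : completeNormedModType R[i]} (c : int -> Z).
Hypothesis uc : unconditionally_cauchy c.
Context (A : {linear Z -> Z}) (z0 : {linear Z -> R[i]^o}).
Hypotheses (cA : continuous A) (cz : continuous z0).
Hypothesis Ac : forall n, A (c n) = c (n - 1).
Context (a d : nat).
Hypothesis suppz : forall n : int, z0 (c n) != 0 -> Posz a <= n <= Posz (a + d).
Hypothesis z0a : z0 (c a) != 0.
Hypothesis bottom : a = 0%N \/ (forall n : int, n < 0 -> c n = 0) /\ c 0 != 0.
Context (J : finType) (val : J -> R[i]) (star : J).
Hypothesis starP : forall j, j != star -> complex.Re (val j) < complex.Re (val star).

Let M : R := val_bound val.

Let valM (b : int -> J) : bounded_by M (val \o b) := bounded_by_val val b.

Lemma bilateral_sum_iter B (b : int -> R[i]) k : bounded_by B b ->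
  iter k A (bilateral_sum c b) = bilateral_sum c (fun n => b (n + Posz k)).
Proof.
move=> bB; elim: k => [|k ih].
  by rewrite /=; congr bilateral_sum; apply/funext => n; rewrite addr0.
rewrite iterS ih (@bilateral_sum_shift _ _ _ uc _ B)//.
by congr bilateral_sum; apply/funext => n; congr b; lia.
Qed.

Definition has_block (P L : nat) (b : int -> J) := exists2 s : nat,
  (s + P <= L)%N & forall k, (s <= k < s + P)%N -> b (Posz (a + k)) = star.

(** By [obsE] this is [z0] at the [k]-th iterate of the sum. Only the indices from [a] to [a + d]
    contribute, whence a linear recurrence of order [d]. *)
Let obs (b : int -> J) k := \sum_(l < d.+1) z0 (c (a + l)%N) * val (b (Posz (a + (k + l)))).

Let obsE b k : z0 (iter k A (bilateral_sum c (val \o b))) = obs b k.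
Proof.
rewrite (bilateral_sum_iter _ (valM b)).
pose F := [seq Posz (a + l) | l <- iota 0 d.+1].
rewrite (@bilateral_sum_functional _ _ _ uc z0 F M)//.
- rewrite big_map /obs -val_enum_ord big_map big_enum /=; apply: eq_bigr => l _.
  rewrite mulrC; congr (_ * val (b _)); lia.
- by rewrite map_inj_uniq ?iota_uniq// => i j []; lia.
- move=> n; apply: contraNeq => /suppz /andP[an nad].
  by apply/mapP; exists (`|n| - a)%N; rewrite ?mem_iota; lia.
- by move=> n; exact: (valM b).
Qed.

(** The number of windows of length [d] in pairs of letters, which bounds the period in the
    pigeonhole argument. *)
Let Nst := #|{ffun 'I_d -> J * J}|.

Lemma block_agree L (b b' : int -> J) :
  has_block Nst.+1 L b -> has_block Nst.+1 L b' ->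
  (forall k, (k <= L + Nst)%N -> obs b k = obs b' k) ->
  forall k, (k < L)%N -> val (b (Posz (a + k))) = val (b' (Posz (a + k))).
Proof.
move=> [s sL bs] [s' s'L bs'] obsbb'.
pose phi (x : J * J) := val x.2 - val x.1.
pose w k := (b (Posz (a + k)), b' (Posz (a + k))).
have q0 : z0 (c (a + 0)%N) != 0 by rewrite addn0.
have [|r /andP[r0 rN] per] := @recurrence_periodic _ d (fun l => z0 (c (a + l)%N))
    q0 _ phi w L.
  move=> k kL; transitivity (obs b' k - obs b k); last by rewrite (obsbb' k kL) subrr.
  by rewrite /obs -sumrB; apply: eq_bigr => l _; rewrite /phi /= mulrBr.
have rP : (0 < r <= Nst.+1)%N by rewrite r0 leqW.
have star_max j : complex.Re (val j) <= complex.Re (val star).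
  by have [->//|/starP/ltW] := eqVneq j star.
have Rew k : (k < L)%N -> complex.Re (phi (w k)) = 0.
  move=> kL; apply/eqP; rewrite eq_le; apply/andP; split.
    have [l ls <-] := periodic_block rP sL per kL.
    by rewrite /phi/= bs// raddfB /= subr_le0.
  have [l ls <-] := periodic_block rP s'L per kL.
  by rewrite /phi/= bs'// raddfB /= subr_ge0.
(* At a marker of [b] the real parts are equal, and the strict maximality of the marker forces [b']
   to show it too. So the difference vanishes there, and by periodicity at [k]. *)
move=> k kL; apply/esym/eqP; rewrite -subr_eq0.
have [l ls wl] := periodic_block rP sL per kL.
have -> : val (b' (Posz (a + k))) - val (b (Posz (a + k))) = phi (w l) by rewrite wl.
have lL : (l < L)%N by apply: leq_trans sL; case/andP: ls.
have := Rew l lL; rewrite /phi /= bs// raddfB /= => /eqP; rewrite subr_eq0 => /eqP ReE.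
have [->|/starP] := eqVneq (b' (Posz (a + l))) star; first by rewrite subrr.
by rewrite ReE ltxx.
Qed.

(** [P] and [L0] come before [L], and [eta] after it, because [L] is later enlarged until most
    points have a marker block within reach. If [z0] distinguishes some iterate, the difference is
    one of finitely many nonzero values, and [eta1] is their gap divided by a norm bound. Otherwise
    the names agree on [[a, a + L)], so that [a] is positive, and [eta2] comes from the term of
    [c 0]. *)
Lemma determination : exists P L0 : nat, forall L, (L0 <= L)%N ->
  exists2 eta : R, 0 < eta & forall b b' : int -> J,
    has_block P L b -> has_block P L b' -> val (b 0) != val (b' 0) ->
    eta <= rnorm (bilateral_sum c (val \o b) - bilateral_sum c (val \o b')).
Proof.
have [KA0 KA00 AKA0] := rnorm_bounded cA.
have [kz kz0 zkz] := rnorm_bounded cz.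
pose KA := Num.max 1 KA0.
have KA1 : 1 <= KA by rewrite /KA le_max lexx.
have KA_gt0 : 0 < KA by apply: lt_le_trans KA1.
have AKA z : rnorm (A z) <= KA * rnorm z.
  by apply: le_trans (AKA0 z) _; rewrite ler_wpM2r ?rnorm_ge0// /KA le_max lexx orbT.
have AkKA k z : rnorm (iter k A z) <= KA ^+ k * rnorm z.
  elim: k => [|k ih] /=; first by rewrite expr0 mul1r.
  by apply: le_trans (AKA _) _; rewrite exprS -mulrA ler_pM2l.
have [mu mu0 muP] := finite_gap (fun x : {ffun 'I_d.+1 -> J * J} =>
  \sum_(l < d.+1) z0 (c (a + l)%N) * (val (x l).1 - val (x l).2)).
have [gap gap0 gapP] := finite_gap (fun x : J * J => val x.1 - val x.2).
(* Half of the least norm that a nonzero difference of values can give to the term of [c 0]; the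
   tail may use up the other half. *)
pose e0 := gap * rnorm (c 0) / 2.
have [N0 N0P] : exists N0, c 0 != 0 -> forall b, bounded_by (M + M) b ->
  (forall n, (`|n| <= N0)%N -> b n = 0) -> rnorm (bilateral_sum c b) <= e0.
  have [c0|c0] := eqVneq (c 0) 0; first by exists 0%N.
  have [|N0 N0P] := bilateral_sum_tail uc (M + M) (_ : 0 < e0); last by exists N0.
  rewrite divr_gt0// mulr_gt0// lt_def rnorm_ge0 andbT.
  by apply: contra c0 => /eqP /rnorm_eq0 ->.
exists Nst.+1, N0 => L N0L.
pose eta1 := mu / (kz * KA ^+ (L + Nst)).
(* If [c 0 = 0], then [bottom] gives [a = 0] and [eta1] decides alone; 1 is a placeholder. *)
pose eta2 := if c 0 == 0 then 1 else e0 / KA ^+ a.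
have eta1_gt0 : 0 < eta1 by rewrite divr_gt0// mulr_gt0// exprn_gt0.
have eta2_gt0 : 0 < eta2.
  rewrite /eta2; case: ifPn => // c0; rewrite divr_gt0 ?exprn_gt0// divr_gt0//.
  rewrite mulr_gt0// lt_def rnorm_ge0 andbT.
  by apply: contra c0 => /eqP /rnorm_eq0 ->.
exists (Num.min eta1 eta2) => [|b b' gb gb' bb']; first by rewrite lt_min eta1_gt0.
set D := _ - _.
have [[k kL obsk]|] := pselect (exists2 k, (k <= L + Nst)%N & obs b k != obs b' k).
  rewrite ge_min; apply/orP; left.
  rewrite ler_pdivrMr ?mulr_gt0 ?exprn_gt0//.
  have AkD : z0 (iter k A D) = obs b k - obs b' k.
    have -> : iter k A D = iter k A (bilateral_sum c (val \o b)) -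
        iter k A (bilateral_sum c (val \o b')).
      by rewrite /D; elim: (k) => //= k' ->; rewrite linearB.
    by rewrite linearB/= !obsE.
  have : mu <= rnorm (z0 (iter k A D)).
    rewrite AkD /obs -sumrB.
    pose x := [ffun l : 'I_d.+1 => (b (Posz (a + (k + l))), b' (Posz (a + (k + l))))].
    have xE : \sum_(l < d.+1) z0 (c (a + l)%N) * (val (x l).1 - val (x l).2) =
        obs b k - obs b' k.
      by rewrite /obs -sumrB; apply: eq_bigr => l _; rewrite ffunE /= mulrBr.
    by have := muP x; rewrite xE subr_eq0 /obs -sumrB; exact.
  move=> /le_trans; apply; apply: le_trans (zkz _) _.
  rewrite [leRHS]mulrC -mulrA ler_pM2l//; apply: le_trans (AkKA _ _) _.
  by rewrite ler_wpM2r ?rnorm_ge0// ler_weXn2l.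
move=> /forall2NP hobs.
have agree := @block_agree L b b' gb gb'.
have {}agree k : (k < L)%N -> val (b (Posz (a + k))) = val (b' (Posz (a + k))).
  apply: agree => l lL; apply/eqP; have := hobs l; rewrite lL.
  by case=> // /negP; rewrite negbK.
have a_neq0 : a <> 0%N.
  move=> a0; have [s sL _] := gb; have := agree 0%N; rewrite a0 addn0 => agree0.
  by move: bb'; rewrite agree0 ?eqxx// (leq_trans _ sL)// addnS.
have [//|[cneg c0]] := bottom.
(* The last disagreement below [a]: [iter m A] brings it to index 0, what stands before it meets
   zero coefficients, and after it the names agree up to time [a + L]. *)
have [m [ma bm mmax]] : exists m, [/\ (m < a)%N, val (b (Posz m)) != val (b' (Posz m)) &
    forall n, (m < n < a)%N -> val (b (Posz n)) = val (b' (Posz n))].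
  pose Q m := (m < a)%N && (val (b (Posz m)) != val (b' (Posz m))).
  have exQ : exists m, Q m by exists 0%N; rewrite /Q bb' andbT lt0n; apply/eqP.
  have ubQ m : Q m -> (m <= a)%N by move=> /andP[/ltnW].
  case: (ex_maxnP exQ ubQ) => m /andP[ma bm] mmax; exists m; split => // n /andP[mn na].
  apply/eqP; apply: contraLR mn => bn; rewrite -leqNgt; apply: mmax.
  by rewrite /Q na.
rewrite ge_min; apply/orP; right; rewrite /eta2 (negbTE c0).
rewrite ler_pdivrMr ?exprn_gt0//.
pose e n := val (b n) - val (b' n).
have eM : bounded_by (M + M) e := bounded_byD (valM b) (bounded_byN (valM b')).
have De : D = bilateral_sum c e by rewrite /D -(bilateral_sumB uc (valM b) (valM b')).
have AmD : iter m A D = bilateral_sum c (fun n => e (n + Posz m)).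
  by rewrite De (bilateral_sum_iter _ eM).
pose e1 (n : int) := if n == 0 then e (Posz m) else 0.
pose e2 (n : int) := if n <= 0 then 0 else e (n + Posz m).
have M0 : 0 <= M + M by apply: le_trans (eM 0); exact: rnorm_ge0.
have e1M : bounded_by (M + M) e1 by move=> n; rewrite /e1; case: ifP; rewrite ?rnorm0.
have e2M : bounded_by (M + M) e2 by move=> n; rewrite /e2; case: ifP; rewrite ?rnorm0.
have AmD' : iter m A D = e (Posz m) *: c 0 + bilateral_sum c e2.
  have -> : e (Posz m) *: c 0 = bilateral_sum c e1.
    rewrite (@bilateral_sum_fin _ _ _ [:: 0])//; last first.
      by move=> n; rewrite inE /e1 => /negbTE ->.
    by rewrite big_seq1 /e1 eqxx.
  have E : window_sum c ^~ (fun n => e (n + Posz m)) = window_sum c ^~ (fun n => e1 n + e2 n).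
    apply/funext => N; apply: eq_bigr => n _; rewrite /e1 /e2.
    have [->|n0] := eqVneq n 0; first by rewrite add0r lexx addr0.
    case: ifPn => n0'; last by rewrite add0r.
    by rewrite cneg ?scaler0// lt_neqAle n0.
  by rewrite AmD -(bilateral_sumD uc e1M e2M) /bilateral_sum E.
have e2_small : rnorm (bilateral_sum c e2) <= e0.
  apply: (N0P c0 e2 e2M) => n nN; rewrite /e2; case: ifPn => //; rewrite -ltNge => n0.
  pose k := (`|n| + m)%N.
  have kn : n + Posz m = Posz k by rewrite PoszD gez0_abs// ltW.
  rewrite kn /e; apply/eqP; rewrite subr_eq0; apply/eqP.
  have [ka|ak] := ltnP k a.
    by apply: mmax; rewrite ka andbT -[X in (X < _)%N]add0n ltn_add2r absz_gt0 gt_eqF.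
  have := agree (k - a)%N; rewrite subnKC//; apply.
  by rewrite ltn_subLR// /k addnC -addSn leq_add// (leq_trans nN).
have em_big : 2 * e0 <= rnorm (e (Posz m) *: c 0).
  rewrite rnormZ /e0 mulrC divfK//; apply: ler_wpM2r; first exact: rnorm_ge0.
  by have := gapP (b (Posz m), b' (Posz m)); rewrite /= subr_eq0; exact.
have : e0 <= rnorm (iter m A D).
  rewrite AmD'; have := rnormB_le (e (Posz m) *: c 0) (- bilateral_sum c e2).
  rewrite opprK rnormN; apply: le_trans.
  by rewrite lerBrDr; apply: le_trans em_big; rewrite mulr_natl mulr2n lerD2l.
move=> /le_trans; apply; apply: le_trans (AkKA _ _) _.
by rewrite mulrC ler_wpM2l ?rnorm_ge0// ler_weXn2l// ltnW.
Qed.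

End Determination.

(** * Borel maps *)

Section BorelMaps.
Context {R : realType} {Z : normedModType R[i]} {d : measure_display} {Y : measurableType d}.
Implicit Types (f g : Y -> Z).

Definition borel_map f := forall U : set Z, open U -> measurable (f @^-1` U).

Lemma borel_mapP f : borel_map f -> measurable_fun setT (f : Y -> borel Z).
Proof.
move=> bf; apply: (@measurability _ _ _ (borel Z) setT f (@open Z)) => //.
by move=> _ [U oU <-]; rewrite setTI; exact: bf.
Qed.

(** As [U] is open, the limit lies in [U] exactly when the terms eventually lie in one inner
    parallel set [V m]. *)
Lemma borel_map_cvg (f_ : nat -> Y -> Z) f : (forall n, borel_map (f_ n)) ->
  (forall y, f_ n y @[n --> \oo] --> f y) -> borel_map f.
Proof.
move=> bf ff U oU.
pose V m := [set z : Z | exists2 r : R, m.+1%:R^-1 < r & forall w, rnorm (z - w) < r -> U w].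
have oV m : open (V m) by exact: open_parallel.
have -> : f @^-1` U = \bigcup_m \bigcup_N \bigcap_(n in [set n | (N <= n)%N]) (f_ n @^-1` V m).
  apply/seteqP; split=> [y Uy|y [m _ [N _ fyV]]].
    have [r r0 rU] := (openP_rnorm U).1 oU _ Uy.
    have [m mr] : exists m, m.+1%:R^-1 < r / 2.
      have [m _ /(_ m (leqnn m))] := near_infty_natSinv_lt (PosNum (divr_gt0 r0 (@ltr0Sn R 1))).
      by exists m.
    have [|N _ Ny] := (rcvgP (fun n => f_ n y) (f y)).1 (ff y) (r / 2).
      by rewrite divr_gt0.
    exists m => //; exists N => // n /= /Ny yn; exists (r / 2) => // w nw.
    apply: rU; apply: le_lt_trans (rnorm_triangle _ (f_ n y) _) _.
    by rewrite [ltRHS]splitr ltrD.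
  have [|N' _ Ny] := (rcvgP (fun n => f_ n y) (f y)).1 (ff y) m.+1%:R^-1.
    by rewrite invr_gt0.
  have [r mr] := fyV _ (leq_maxl N N'); apply.
  by rewrite rnormB; apply: lt_trans mr; apply: Ny; rewrite /= leq_maxr.
apply: bigcup_measurable => m _; apply: bigcup_measurable => N _.
by apply: bigcap_measurable => [|n _]; [exists N; rewrite /= | exact: bf].
Qed.

Lemma borel_map_if (B : set Y) f g : measurable B -> borel_map f -> borel_map g ->
  borel_map (fun y => if y \in B then f y else g y).
Proof.
move=> mB bf bg U oU.
have -> : (fun y => if y \in B then f y else g y) @^-1` U =
    (B `&` f @^-1` U) `|` (~` B `&` g @^-1` U).
  apply/seteqP; split=> [y /=|y [[By]|[By]]] /=.
  - by case: ifPn; rewrite ?inE ?notin_setE => By Uy; [left|right].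
  - by rewrite mem_set.
  - by rewrite memNset.
by apply: measurableU; apply: measurableI; [|exact: bf|exact: measurableC|exact: bg].
Qed.

Lemma borel_map_cst (z : Z) : borel_map (fun=> z).
Proof.
move=> U oU; have [zU|zU] := pselect (U z).
  by rewrite (_ : _ @^-1` _ = setT)//; apply/seteqP; split.
by rewrite (_ : _ @^-1` _ = set0)//; apply/seteqP; split.
Qed.

End BorelMaps.

(** * Generic limits in probability *)

Section GenericLimit.
Context {R : realType} {Z : completeNormedModType R[i]} {d : measure_display}
  {Y : measurableType d} (P : probability Y R).
Implicit Types (f g : Y -> Z) (e : R).

(** Distance at most [e] in the Ky Fan metric, which describes convergence in probability. *)
Definition nearby e f g := exists N : set Y,
  [/\ measurable N, (P N <= e%:E)%E & forall y, ~ N y -> rnorm (f y - g y) <= e].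

Definition open_requirement (O : set (Y -> Z)) := forall f, borel_map f -> O f ->
  exists2 e, 0 < e & forall g, borel_map g -> nearby e f g -> O g.

Lemma prob_bigcup_le (N : nat -> set Y) (e : nat -> R) (E : R) :
  (forall l, measurable (N l)) -> (forall l, (P (N l) <= (e l)%:E)%E) ->
  (forall n, \sum_(0 <= l < n) e l <= E) -> (P (\bigcup_l N l) <= E%:E)%E.
Proof.
move=> mN Ne eE; apply: le_trans (le_mu_bigcup P mN (bigcup_measurable (fun l _ => mN l))) _.
apply: lime_le; first exact: is_cvg_nneseries.
apply: nearW => n; apply: le_trans (_ : (\sum_(0 <= l < n) (e l)%:E <= _)%E).
  by apply: lee_sum => l _; exact: Ne.
by rewrite sumEFin lee_fin.
Qed.

Lemma nearbyW e e' f g : e <= e' -> nearby e f g -> nearby e' f g.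
Proof.
move=> ee' [N [mN Ne fg]]; exists N; split => // [|y /fg/le_trans]; last exact.
by rewrite (le_trans Ne)// lee_fin.
Qed.

Lemma nearby_trans e e' f g h : nearby e f g -> nearby e' g h -> nearby (e + e') f h.
Proof.
move=> [N [mN Ne fg]] [N' [mN' Ne' gh]]; exists (N `|` N'); split.
- exact: measurableU.
- by apply: le_trans (measureU2 _ mN mN') _; rewrite EFinD leeD.
- move=> y /not_orP[Ny Ny']; apply: le_trans (rnorm_triangle _ (g y) _) _.
  by apply: lerD; [exact: fg | exact: gh].
Qed.

(* Baire category in the space of Borel maps modulo null sets, with the metric
   of convergence in probability. *)
Lemma generic_limit (F : set (Y -> Z)) (O : nat -> set (Y -> Z)) :
  F !=set0 -> (forall f, F f -> borel_map f) ->
  (forall k, open_requirement (O k)) ->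
  (forall k f e, F f -> 0 < e -> exists g, [/\ F g, nearby e f g & O k g]) ->
  exists g, [/\ borel_map g, (forall k, O k g) &
    exists f_ : nat -> Y -> Z, (forall n, F (f_ n)) /\
      \forall y \ae P, f_ n y @[n --> \oo] --> g y].
Proof.
move=> [f0 Ff0] bF oO dO.
(* A state is a map with a radius. The new map moves by at most half of the old radius, and the new
   radius is at most half of the old one; so all later maps, and their limit, stay in the ball where
   [O k] is guaranteed. *)
have [step stepP] : {step : nat -> (Y -> Z) * R -> (Y -> Z) * R | forall k x,
    F x.1 -> 0 < x.2 -> [/\ F (step k x).1, 0 < (step k x).2 <= x.2 / 2,
      nearby (x.2 / 2) x.1 (step k x).1 &
      forall g, borel_map g -> nearby (step k x).2 (step k x).1 g -> O k g]}.
  have H k x : exists x' : (Y -> Z) * R, F x.1 -> 0 < x.2 -> [/\ F x'.1, 0 < x'.2 <= x.2 / 2,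
      nearby (x.2 / 2) x.1 x'.1 & forall g, borel_map g -> nearby x'.2 x'.1 g -> O k g].
    have [Fx|] := pselect (F x.1); last by exists x.
    have [x0|] := pselect (0 < x.2); last by exists x.
    have [g [Fg xg Og]] := dO k x.1 (x.2 / 2) Fx (divr_gt0 x0 (@ltr0Sn R 1)).
    have [e e0 eO] := oO k g (bF _ Fg) Og.
    exists (g, Num.min e (x.2 / 2)) => _ _; split => //=.
      by rewrite lt_min e0 divr_gt0//= ge_min lexx orbT.
    by move=> h bh gh; apply: eO => //; apply: nearbyW gh; rewrite ge_min lexx.
  exists (fun k => projT1 (choice (H k))) => k x; exact: (projT2 (choice (H k)) x).
pose s := fix s n := if n is k.+1 then step k (s k) else (f0, 1 : R).
have sP n : F (s n).1 /\ 0 < (s n).2.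
  elim: n => [|n [Fn n0]] /=; first by split.
  by have [? /andP[? _]] := stepP n _ Fn n0.
pose f_ n := (s n).1; pose e_ n := (s n).2.
have e_gt0 n : 0 < e_ n by have [] := sP n.
have F_ n : F (f_ n) by have [] := sP n.
have e_S n : e_ n.+1 <= e_ n / 2.
  by have [_ /andP[_]] := stepP n _ (F_ n) (e_gt0 n).
have /choice[N NP] : forall n, exists N : set Y, [/\ measurable N, (P N <= (e_ n / 2)%:E)%E &
    forall y, ~ N y -> rnorm (f_ n y - f_ n.+1 y) <= e_ n / 2].
  by move=> n; have [_ _ ? _] := stepP n _ (F_ n) (e_gt0 n).
have O_ n g : borel_map g -> nearby (e_ n.+1) (f_ n.+1) g -> O n g.
  by have [_ _ _] := stepP n _ (F_ n) (e_gt0 n); exact.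
pose U k := \bigcup_l N (k + l)%N.
have mN n : measurable (N n) by have [] := NP n.
have mU k : measurable (U k) by apply: bigcup_measurable => l _; exact: mN.
have UP k : (P (U k) <= (e_ k)%:E)%E.
  apply: (@prob_bigcup_le _ (fun l => e_ (k + l)%N / 2)) => // [l|n].
    by have [] := NP (k + l)%N.
  suff : \sum_(0 <= l < n) e_ (k + l)%N / 2 <= e_ k - e_ (k + n)%N.
    by move=> /le_trans; apply; rewrite gerBl ltW.
  elim: n => [|n ih]; first by rewrite big_nil addn0 subrr.
  rewrite big_nat_recr//= addnS; apply: le_trans (lerD ih (lexx _)) _.
  by have := e_S (k + n)%N; lra.
have dist k m y : (k <= m)%N -> ~ U k y -> forall n, rnorm (f_ m y - f_ (m + n)%N y) <= e_ m - e_ (m + n)%N.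
  move=> km kU; elim=> [|n ih]; first by rewrite addn0 !subrr rnorm0.
  apply: le_trans (rnorm_triangle _ (f_ (m + n)%N y) _) _.
  have h : ~ N (m + n)%N y.
    move=> Ny; apply: kU; exists (m + n - k)%N => //.
    by rewrite subnKC// (leq_trans km)// leq_addr.
  have [_ _ /(_ y h)] := NP (m + n)%N; have := e_S (m + n)%N; rewrite -addnS => eS h'.
  by have := lerD ih h'; lra.
have e_cvg k : e_ k <= 2 ^- k.
  elim: k => [|k ih]; first by rewrite expr0 invr1.
  by apply: le_trans (e_S k) _; rewrite exprS invfM mulrC ler_pM2l.
have e_small (e : R) : 0 < e -> exists k, e_ k <= e.
  move=> e0; have : geometric 1 (2^-1 : R) k @[k --> \oo] --> 0.
    by apply: cvg_geometric; rewrite ger0_norm// invf_lt1// ltr1n.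
  move=> /cvgrPdist_lt/(_ e e0)[k _ /(_ k (leqnn k))].
  rewrite /geometric/= mul1r sub0r normrN ger0_norm ?exprn_ge0// exprVn => h.
  by exists k; apply: le_trans (e_cvg k) (ltW h).
(* Null, as [P (U k) <= e_ k] tends to 0; off it the increments are eventually bounded by those of a
   telescoping sum. *)
pose N' := \bigcap_k U k.
have mN' : measurable N' by apply: bigcapT_measurable.
have N'0 : P N' = 0%E.
  apply/eqP; rewrite eq_le measure_ge0 andbT; apply/lee_addgt0Pr => e e0; rewrite add0e.
  have [k ke] := e_small e e0.
  apply: le_trans (_ : (P (U k) <= _)%E).
    by apply: le_measure; rewrite ?inE//; apply: bigcap_inf.
  by apply: le_trans (UP k) _; rewrite lee_fin.
have cvg_off y : ~ N' y -> cvgn (f_ ^~ y).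
  move=> Ny; have [k kU] : exists k, ~ U k y.
    by apply: contrapT => /forallNP h; apply: Ny => k _; exact: contrapT.
  apply: rcauchy_cvg => e e0; have [m me] := e_small e e0.
  exists (maxn k m) => n mn.
  have := dist k (maxn k m) y (leq_maxl _ _) kU (n - maxn k m)%N; rewrite subnKC//.
  move=> /le_trans; apply; apply: le_trans (_ : e_ m <= _) => //.
  have e_mono : {homo e_ : i j / (i <= j)%N >-> j <= i}.
    apply: homo_leq => [x|x y' z h1 h2|i]; [exact: lexx|exact: le_trans h2 h1|].
    by have := e_S i; have := e_gt0 i; lra.
  by have := e_mono _ _ (leq_maxr k m); have := e_gt0 n; lra.
pose g y := if y \in N' then 0 else lim (f_ n y @[n --> \oo]).
have fg y : ~ N' y -> f_ n y @[n --> \oo] --> g y.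
  by move=> Ny; rewrite /g memNset//; exact: cvg_off.
have bg : borel_map g.
  apply: (@borel_map_cvg _ _ _ _ (fun n y => if y \in N' then 0 else f_ n y)).
    by move=> n; apply: borel_map_if => //; [exact: borel_map_cst | exact: bF].
  move=> y; have [yN|yN] := pselect (N' y).
    by rewrite /g mem_set//; exact: cvg_cst.
  by rewrite memNset//; exact: fg.
exists g; split => // [k|]; last first.
  by exists f_; split => //; exists N'; split => // y; apply: contra_notP => /fg.
apply: O_ => //; exists (U k.+1); split => // y kU.
have yN : ~ N' y by move=> /(_ k.+1 I).
have fcg : f_ k.+1 y - f_ n y @[n --> \oo] --> f_ k.+1 y - g y.
  by apply: cvgB; [exact: cvg_cst | exact: fg].
apply: (cvgr_to_le (cvg_rnorm fcg)); exists k.+1 => // n /= kn.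
have := dist k.+1 k.+1 y (leqnn _) kU (n - k.+1)%N; rewrite subnKC//.
by move=> /le_trans; apply; rewrite gerBl ltW.
Qed.

End GenericLimit.

(** * The two kinds of open requirements *)

Section Requirements.
Context {R : realType} {Z : completeNormedModType R[i]} {d : measure_display}
  {Y : measurableType d} (P : probability Y R).
Implicit Types (f g : Y -> Z) (e : R).

Lemma prob_fin_num (B : set Y) : measurable B -> P B \is a fin_num.
Proof. by move=> mB; rewrite ge0_fin_numE// (le_lt_trans (probability_le1 _ mB))// ltry. Qed.

Lemma ae_measure_eq (A B : set Y) : measurable A -> measurable B ->
  (\forall y \ae P, A y <-> B y) -> P A = P B.
Proof.
move=> mA mB [N [mN N0 NP]].
have le C D : measurable C -> measurable D -> C `<=` N `|` D -> (P C <= P D)%E.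
  move=> mC mD CD; apply: (@le_trans _ _ (P (N `|` D))).
    by apply: le_measure; rewrite ?inE//; exact: measurableU.
  apply: (@le_trans _ _ (P N + P D)%E); first exact: measureU2.
  by rewrite N0 add0e.
apply/eqP; rewrite eq_le; apply/andP; split; apply: le => // x Cx.
  have [Nx|Nx] := pselect (N x); [by left|right].
  have [AB _] : A x <-> B x by apply: contrapT => h; apply: Nx; exact: NP.
  exact: AB.
have [Nx|Nx] := pselect (N x); [by left|right].
have [_ BA] : A x <-> B x by apply: contrapT => h; apply: Nx; exact: NP.
exact: BA.
Qed.

Lemma ae_prob1 (U : set Y) : measurable U -> (\forall y \ae P, U y) -> P U = 1%E.
Proof.
move=> mU UP; rewrite -(@probability_setT _ _ _ P); apply: ae_measure_eq => //.
by move: UP; apply: filterS.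
Qed.

Lemma prob_bigcup_fin (p : nat) (B : nat -> set Y) (x : R) :
  (forall i, measurable (B i)) -> (forall i, (P (B i) <= x%:E)%E) ->
  (P (\bigcup_(i < p) B i) <= (p%:R * x)%:E)%E.
Proof.
move=> mB Bx; rewrite bigcup_mkord; elim: p => [|p ih].
  by rewrite big_ord0 measure0 mul0r.
rewrite big_ord_recr/=.
have mU : measurable (\big[setU/set0]_(i < p) B i) by apply: bigsetU_measurable.
apply: (@le_trans _ _ (P (\big[setU/set0]_(i < p) B i) + P (B p))%E).
  exact: measureU2.
by rewrite -natr1 mulrDl mul1r EFinD leeD.
Qed.

Definition charges (U : set Z) : set (Y -> Z) := [set f | (0 < P (f @^-1` U))%E].

(** Some inner parallel set [V m] of [U] already has a preimage of positive measure [v]. A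
    perturbation of size at most [1/(m+1)] outside a set of measure at most [v/2] keeps at least
    [v/2] in [U]. *)
Lemma open_charges (U : set Z) : open U -> open_requirement P (charges U).
Proof.
move=> oU f bf fU.
pose V m := [set z : Z | exists2 r : R, m.+1%:R^-1 < r & forall w, rnorm (z - w) < r -> U w].
have oV m : open (V m) by exact: open_parallel.
have UV : f @^-1` U = \bigcup_m f @^-1` V m.
  apply/seteqP; split=> [y Uy|y [m _ [r mr rU]]].
    have [r r0 rU] := (openP_rnorm U).1 oU _ Uy.
    have [m _ /(_ m (leqnn m)) mr] := near_infty_natSinv_lt (PosNum r0).
    by exists m => //; exists r.
  apply: rU; rewrite subrr rnorm0; apply: lt_trans mr; by rewrite invr_gt0.
have [m Vm] : exists m, (0 < P (f @^-1` V m))%E.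
  apply: contrapT => /forallNP V0; move: fU; rewrite /charges /= UV.
  suff -> : P (\bigcup_m f @^-1` V m) = 0%E by rewrite ltxx.
  apply: measure_negligible; first by apply: bigcup_measurable => m _; exact: bf.
  apply: negligible_bigcup => m; apply/negligibleP; first exact: bf.
  by apply/eqP; rewrite eq_le measure_ge0 andbT leNgt; apply/negP; exact: V0.
have mV : measurable (f @^-1` V m) by exact: bf.
have PV : P (f @^-1` V m) = (fine (P (f @^-1` V m)))%:E by rewrite fineK// prob_fin_num.
have v0 : 0 < fine (P (f @^-1` V m)) by rewrite -lte_fin -PV.
set v := fine _ in PV v0.
exists (Num.min m.+1%:R^-1 (v / 2)); first by rewrite lt_min invr_gt0 ltr0Sn divr_gt0.
move=> g bg [N [mN Ne fg]]; rewrite /charges /=.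
have mgU : measurable (g @^-1` U) by exact: bg.
have sub : f @^-1` V m `<=` N `|` g @^-1` U.
  move=> y [r mr rU]; have [Ny|Ny] := pselect (N y); [by left|right].
  by apply: rU; apply: le_lt_trans (fg y Ny) _; rewrite gt_min mr.
have h : (v%:E <= P N + P (g @^-1` U))%E.
  rewrite -PV; apply: le_trans (measureU2 _ mN mgU).
  by apply: le_measure; rewrite ?inE//; exact: measurableU.
rewrite lt0e measure_ge0 andbT; apply/eqP => g0; move: h; rewrite g0 adde0.
move=> /le_trans/(_ Ne); rewrite lee_fin le_min => /andP[_].
by rewrite leNgt ltr_pdivrMr// mulr_natr mulr2n ltrDl v0.
Qed.

(* Off a set of measure less than [e], the membership in [B] can be read off
   from the value of the map, with a margin. *)
Definition separates (B : set Y) (e : R) : set (Y -> Z) := [set f |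
  exists (C0 C1 : set Z) (eta : R) (N : set Y),
    [/\ open C0, open C1, 0 < eta,
        (forall x y, C0 x -> C1 y -> eta <= rnorm (x - y)) &
        [/\ measurable N, (P N < e%:E)%E,
            (forall y, ~ N y -> B y -> C1 (f y)) &
            (forall y, ~ N y -> ~ B y -> C0 (f y))]]].

Lemma open_enlarge (C : set Z) (r : R) :
  open [set w | exists2 x, C x & rnorm (x - w) < r].
Proof.
have -> : [set w | exists2 x, C x & rnorm (x - w) < r] =
    \bigcup_(x in C) [set w | rnorm (x - w) < r].
  by apply/seteqP; split=> w [x Cx xw]; exists x.
by apply: bigcup_open => x _; exact: open_rball.
Qed.

(** Both sets are enlarged by [eta / 3], which leaves them [eta / 3] apart. Half of the slack in the
    strict bound on [P N] pays for the new exceptional set. *)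
Lemma open_separates B e : open_requirement P (separates B e).
Proof.
move=> f bf [C0 [C1 [eta [N [oC0 oC1 eta0 etaP [mN Ne NC1 NC0]]]]]].
have PN : P N = (fine (P N))%:E by rewrite fineK// prob_fin_num.
move: Ne; rewrite PN lte_fin; set p := fine _ => pe.
exists (Num.min (eta / 4) ((e - p) / 2)).
  by rewrite lt_min !divr_gt0// subr_gt0.
move=> g bg [N' [mN' N'e fg]].
exists [set w | exists2 x, C0 x & rnorm (x - w) < eta / 3].
exists [set w | exists2 x, C1 x & rnorm (x - w) < eta / 3].
exists (eta / 3), (N `|` N'); split; [exact: open_enlarge|exact: open_enlarge| | |].
- by rewrite divr_gt0.
- move=> x y [x' C0x xx'] [y' C1y yy'].
  have := etaP _ _ C0x C1y; have := rnorm_triangle x' x y'; have := rnorm_triangle x y y'.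
  by rewrite (rnormB y y'); lra.
have eta43 : eta / 4 < eta / 3 by lra.
split.
- exact: measurableU.
- apply: (@le_lt_trans _ _ (P N + P N')%E); first exact: measureU2.
  rewrite PN.
  apply: le_lt_trans (leeD (lexx _) N'e) _; rewrite -EFinD lte_fin.
  have : Num.min (eta / 4) ((e - p) / 2) <= (e - p) / 2 by rewrite ge_min lexx orbT.
  by rewrite -/p; lra.
- move=> y /not_orP[Ny N'y] By; exists (f y); first exact: NC1.
  by apply: le_lt_trans (fg y N'y) _; rewrite gt_min eta43.
- move=> y /not_orP[Ny N'y] By; exists (f y); first exact: NC0.
  by apply: le_lt_trans (fg y N'y) _; rewrite gt_min eta43.
Qed.

(** Borel-Cantelli: the errors [2 ^- k] are summable, so for almost every [y] membership in [B] is
    read off correctly by all [C k] with [k] large. Hence [B] is the preimage of their lower limit,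
    up to a null set. *)
Lemma separates_all B f : (forall k, separates B (2 ^- k) f) ->
  exists2 C : set Z, (measurable : set (set (borel Z))) C &
    \forall y \ae P, B y <-> C (f y).
Proof.
move=> sep.
have /choice[CN CNP] : forall k, exists CN : set Z * set Y, [/\ open CN.1, measurable CN.2,
    (P CN.2 <= (2 ^- k)%:E)%E & forall y, ~ CN.2 y -> (B y <-> CN.1 (f y))].
  move=> k; have [C0 [C1 [eta [N [oC0 oC1 eta0 etaP [mN Ne NC1 NC0]]]]]] := sep k.
  exists (C1, N); split => //=; first exact: ltW.
  move=> y Ny; split; first exact: NC1.
  move=> C1y; apply: contrapT => /(NC0 y Ny) C0y.
  by have := etaP _ _ C0y C1y; rewrite subrr rnorm0 leNgt eta0.
pose C k : set Z := (CN k).1; pose N k := (CN k).2.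
exists (\bigcup_m \bigcap_(k in [set k | (m <= k)%N]) C k).
  apply: bigcup_measurable => m _; apply: bigcap_measurable; first by exists m => /=.
  by move=> k _; apply: sub_gen_smallest; have [] := CNP k.
pose N' := \bigcap_m \bigcup_l N (m + l)%N.
have mN k : measurable (N k) by have [] := CNP k.
have mU m : measurable (\bigcup_l N (m + l)%N) by apply: bigcup_measurable.
have mN' : measurable N' by apply: bigcapT_measurable.
exists N'; split => //.
- apply/eqP; rewrite eq_le measure_ge0 andbT; apply/lee_addgt0Pr => e e0; rewrite add0e.
  have [m me] : exists m, 2 * 2 ^- m <= e.
    have : geometric 2 (2^-1 : R) k @[k --> \oo] --> 0.
      by apply: cvg_geometric; rewrite ger0_norm// invf_lt1// ltr1n.
    move=> /cvgrPdist_lt/(_ e e0)[m _ /(_ m (leqnn m))].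
    rewrite /geometric/= sub0r normrN ger0_norm ?mulr_ge0 ?exprn_ge0// exprVn => h.
    by exists m; exact: ltW.
  apply: (@le_trans _ _ (P (\bigcup_l N (m + l)%N))).
    by apply: le_measure; rewrite ?inE//; apply: bigcap_inf.
  apply: (@le_trans _ _ (2 * 2 ^- m)%:E); last by rewrite lee_fin.
  apply: (@prob_bigcup_le _ _ _ P _ (fun l => 2 ^- (m + l))) => [l|l|n].
  + exact: mN.
  + by have [] := CNP (m + l)%N.
  suff : \sum_(0 <= l < n) 2 ^- (m + l) <= 2 * 2 ^- m - 2 * 2 ^- (m + n) :> R.
    by move=> /le_trans; apply; rewrite gerBl mulr_ge0.
  elim: n => [|n ih]; first by rewrite big_nil addn0 subrr.
  rewrite big_nat_recr//= addnS; apply: le_trans (lerD ih (lexx _)) _.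
  by rewrite exprS invfM; lra.
- move=> y /= nBC; apply: contrapT => /existsNP[m /not_implyP[_ mN'y]]; apply: nBC.
  have NmP k : (m <= k)%N -> B y <-> C k (f y).
    move=> mk; have [_ _ _] := CNP k; apply => Ny; apply: mN'y.
    by exists (k - m)%N => //; rewrite subnKC.
  split=> [By|[m' _ Cy]]; first by exists m => // k /= /NmP <-.
  apply/(NmP (maxn m m') (leq_maxl _ _)); apply: Cy; exact: leq_maxr.
Qed.

End Requirements.

(** * Recurrence, markers and disjoint preimages for an ergodic map *)

Section ErgodicTools.
Context {R : realType} {d : measure_display} {Y : measurableType d} (P : probability Y R).
Context (T : Y -> Y).
Hypotheses (mT : measurable_fun setT T) (iT : invariant_measure P T) (eT : ergodic P T).

Lemma measurable_preimage_iter n (B : set Y) : measurable B -> measurable (iter n T @^-1` B).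
Proof.
move=> mB; elim: n => [//|n ih].
have -> : iter n.+1 T @^-1` B = T @^-1` (iter n T @^-1` B).
  by apply/seteqP; split=> y /=; rewrite -iterS iterSr.
by rewrite -[X in measurable X]setTI; exact: mT.
Qed.

Lemma measure_preimage_iter n (B : set Y) : measurable B -> P (iter n T @^-1` B) = P B.
Proof.
move=> mB; elim: n => [//|n ih].
have -> : iter n.+1 T @^-1` B = T @^-1` (iter n T @^-1` B).
  by apply/seteqP; split=> y /=; rewrite -iterS iterSr.
by rewrite iT//; exact: measurable_preimage_iter.
Qed.

Lemma ae_preimage_iter n (Q : Y -> Prop) :
  (\forall y \ae P, Q y) -> \forall y \ae P, Q (iter n T y).
Proof.
move=> [N [mN N0 QN]]; exists (iter n T @^-1` N); split.
- exact: measurable_preimage_iter.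
- by rewrite measure_preimage_iter.
- by move=> y /= ; exact: QN.
Qed.

(** Ergodicity is stated for strictly invariant sets, so it is applied to [J], the points that visit
    [G] infinitely often. The preimages of [U] decrease and all have the measure of [U], hence so
    does their intersection [J]. *)
Lemma recurrence (G : set Y) : measurable G -> (0 < P G)%E ->
  \forall y \ae P, exists n, G (iter n T y).
Proof.
move=> mG G0; pose U := \bigcup_n iter n T @^-1` G.
have mU : measurable U.
  by apply: bigcup_measurable => n _; exact: measurable_preimage_iter.
pose J := \bigcap_m iter m T @^-1` U.
have mJ : measurable J.
  by apply: bigcapT_measurable => m; exact: measurable_preimage_iter.
have decr : {homo (fun m => iter m T @^-1` U) : n m / (n <= m)%N >-> (m <= n)%O}.
  move=> n m nm; apply/subsetPset => y [k _ Gy]; exists (k + (m - n))%N => //=.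
  by rewrite -iterD -addnA subnK// iterD.
have TJ : T @^-1` J = J.
  apply/seteqP; split=> y /= Jy m _ /=.
    have := Jy m I; rewrite /= -iterSr => h.
    by have /subsetPset := decr m m.+1 (leqnSn m); exact.
  by have := Jy m.+1 I; rewrite /= -iterS iterSr.
have PJ : P J = P U.
  apply: (@cvg_unique _ _ (P \o (fun m => iter m T @^-1` U) @ \oo)) => //.
    apply: nonincreasing_cvg_mu => //.
    - by rewrite (le_lt_trans (probability_le1 _ _)) ?ltry//; exact: measurable_preimage_iter.
    - by move=> m; exact: measurable_preimage_iter.
  rewrite (_ : _ \o _ = cst (P U)); first exact: cvg_cst.
  by apply/funext => m /=; rewrite measure_preimage_iter.
have PU : P U = 1%E.
  have := eT mJ TJ; rewrite PJ => -[U0|//].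
  have : (P G <= P U)%E.
    by apply: le_measure; rewrite ?inE// => y Gy; exists 0%N.
  by rewrite U0 leNgt G0.
have PUC : P (~` U) = 0%E by rewrite probability_setC// PU subee.
exists (~` U); split => //; first exact: measurableC.
by move=> y /= h [n _ Gn]; apply: h; exists n.
Qed.

Hypothesis small : forall e : R, 0 < e ->
  exists G, [/\ measurable G, (0 < P G)%E & (P G <= e%:E)%E].

Lemma ergodic_marker (p : nat) (e : R) : 0 < e -> exists D : set Y,
  [/\ measurable D, (P D <= e%:E)%E & \forall y \ae P,
    exists s, forall k, (s <= k < s + p)%N -> D (iter k T y)].
Proof.
move=> e0; have [|G [mG G0 Ge]] := small (_ : 0 < e / p.+1%:R); first by rewrite divr_gt0.
exists (\bigcup_(i < p) (iter i T @^-1` G)); split.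
- by apply: bigcup_measurable => i _; exact: measurable_preimage_iter.
- apply: (@le_trans _ _ (p%:R * (e / p.+1%:R))%:E).
    apply: (@prob_bigcup_fin _ _ _ P _ (fun i => iter i T @^-1` G)) => i.
      exact: measurable_preimage_iter.
    by rewrite measure_preimage_iter.
  by rewrite lee_fin mulrCA ler_piMr ?(ltW e0)// ler_pdivrMr// mul1r ler_nat.
- have := ae_preimage_iter p (recurrence mG G0); apply: filterS => y [n Gn].
  exists n.+1 => k /andP[nk knp].
  exists (n + p - k)%N; first by rewrite /=; lia.
  by rewrite /= -iterD subnK ?iterD//; lia.
Qed.

(** [G] keeps the points of a small [G0] that do not return to it within [N] steps. Were [G] null,
    almost every orbit would, once in [G0], return within [N] steps forever, so the union [W] of [N]
    preimages of [G0] would have full measure; but [P G0 <= 1/(N+1)]. *)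
Lemma ergodic_disjoint (N : nat) (e : R) : 0 < e -> exists G : set Y,
  [/\ measurable G, (0 < P G)%E, (P G <= e%:E)%E &
    forall y i j, (i < j <= N)%N -> G (iter i T y) -> ~ G (iter j T y)].
Proof.
move=> e0; have [|G0 [mG0 G00 G0e]] := small (_ : 0 < Num.min e (N.+1%:R^-1)).
  by rewrite lt_min e0 invr_gt0/=.
pose Ret := \bigcup_(i < N) (iter i.+1 T @^-1` G0).
have mRet : measurable Ret.
  by apply: bigcup_measurable => i _; exact: measurable_preimage_iter.
pose G := G0 `\` Ret.
have mG : measurable G by exact: measurableD.
exists G; split => //; last 2 first.
- apply: le_trans (_ : (P G0 <= _)%E); first by apply: le_measure; rewrite ?inE//; exact: subDsetl.
  by apply: le_trans G0e _; rewrite lee_fin ge_min lexx.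
- move=> y i j /andP[ij jN] [_ nR] [Gj _]; apply: nR.
  exists (j - i).-1; first by rewrite /=; lia.
  by rewrite /= -iterS -iterD; have -> : ((j - i).-1.+1 + i = j)%N by lia.
rewrite lt0e measure_ge0 andbT; apply/eqP => PG.
pose W := \bigcup_(i < N) (iter i T @^-1` G0).
have mW : measurable W.
  by apply: bigcup_measurable => i _; exact: measurable_preimage_iter.
have PW : (P W < 1)%E.
  apply: (@le_lt_trans _ _ (N%:R * N.+1%:R^-1)%:E).
    apply: (@prob_bigcup_fin _ _ _ P _ (fun i => iter i T @^-1` G0)) => i.
      exact: measurable_preimage_iter.
    by rewrite measure_preimage_iter//; apply: le_trans G0e _; rewrite lee_fin ge_min lexx orbT.
  by rewrite lte_fin ltr_pdivrMr// mul1r ltr_nat.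
have WT y : W y -> ~ G y -> W (T y).
  move=> [[|i] /= iN Gi] nG.
    have : Ret y by apply: contrapT => nR; apply: nG.
    by move=> [j jN Gj]; exists j => //=; rewrite -iterSr.
  by exists i; [exact: ltnW|rewrite /= -iterSr].
have nG : \forall y \ae P, forall n, ~ G (iter n T y).
  apply: ae_foralln => n; apply: (@ae_preimage_iter n (fun y => ~ G y)).
  by exists G; split => // y /=; exact: contrapT.
pose D m := \bigcap_(n in [set n | (m <= n)%N]) (iter n T @^-1` W).
have mD m : measurable (D m).
  apply: bigcap_measurable; first by exists m => /=.
  by move=> n _; exact: measurable_preimage_iter.
have N0 : (0 < N)%N.
  rewrite lt0n; apply/eqP => N0; move: PG; rewrite /G /Ret N0 bigcup_mkord big_ord0 setD0 => PG.
  by rewrite PG ltxx in G00.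
have PD : P (\bigcup_m D m) = 1%E.
  apply: ae_prob1; first by apply: bigcup_measurable.
  move: nG (recurrence mG0 G00); apply: filterS2 => y nGy [m Gm].
  exists m => // n /= mn; rewrite -(subnK mn); elim: (n - m)%N => [|k ih]; first by exists 0%N.
  by rewrite addSn /=; apply: WT.
have : (1 <= P W)%E.
  rewrite -PD.
  have cD : (P \o D) n @[n --> \oo] --> P (\bigcup_m D m).
    apply: nondecreasing_cvg_mu => //; first exact: bigcup_measurable.
    move=> m n mn; apply/subsetPset => y Dy k /= nk; apply: Dy; exact: leq_trans nk.
  rewrite -(cvg_lim _ cD)//; apply: lime_le; first by apply/cvg_ex; eexists; exact: cD.
  apply: nearW => m /=; rewrite -(measure_preimage_iter m mW).
  apply: le_measure; rewrite ?inE//; first exact: measurable_preimage_iter.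
  by move=> y /(_ m (leqnn m)).
by rewrite leNgt PW.
Qed.

End ErgodicTools.

(** * Maps with finitely many values *)

(** The point at time [n] of a window needs [N - n] more steps to reach its end; this count codes
    the time as a number below [2 N + 1]. *)
Lemma window_reflectK (N : nat) (n : int) : (`|n| <= N)%N ->
  Posz N - Posz `|(Posz N - n)%R|%N = n.
Proof. lia. Qed.

Lemma window_reflect_lt (N : nat) (n : int) : (`|n| <= N)%N ->
  (`|(Posz N - n)%R| < N.*2.+1)%N.
Proof. lia. Qed.

Lemma window_reflect_nat (N n : nat) : (n <= N)%N -> (`|(Posz N - Posz n)%R| + n)%N = N.
Proof. lia. Qed.

Lemma window_reflect_neg (N n : nat) : `|(Posz N - Negz n)%R|%N = (N + n.+1)%N.
Proof. lia. Qed.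

Section FiniteMaps.
Context {d : measure_display} {Y : measurableType d}.

Definition finite_map (J : finType) (f : Y -> J) := forall j, measurable (f @^-1` [set j]).

Lemma finite_map_preimage (J : finType) (f : Y -> J) (B : set J) :
  finite_map f -> measurable (f @^-1` B).
Proof.
move=> mf; have -> : f @^-1` B = \bigcup_(j in B) f @^-1` [set j].
  by apply/seteqP; split=> [y By|y [j Bj /= ->]//]; exists (f y).
by apply: fin_bigcup_measurable => // j _; exact: mf.
Qed.

Lemma finite_map_comp (J K : finType) (f : Y -> J) (g : J -> K) :
  finite_map f -> finite_map (g \o f).
Proof. by move=> mf k; rewrite comp_preimage; exact: finite_map_preimage. Qed.

Lemma finite_map_pair (J K : finType) (f : Y -> J) (g : Y -> K) :
  finite_map f -> finite_map g -> finite_map (fun y => (f y, g y)).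
Proof.
move=> mf mg [j k].
have -> : (fun y => (f y, g y)) @^-1` [set (j, k)] = f @^-1` [set j] `&` g @^-1` [set k].
  by apply/seteqP; split=> [y [<- <-]|y [/= <- <-]].
exact: measurableI.
Qed.

Lemma finite_map_ffun (I J : finType) (f : I -> Y -> J) :
  (forall i, finite_map (f i)) -> finite_map (fun y => [ffun i => f i y]).
Proof.
move=> mf k; have -> : (fun y => [ffun i => f i y]) @^-1` [set k] =
    \bigcap_(i in [set: I]) f i @^-1` [set k i].
  apply/seteqP; split=> [y <- i _ /=|y yk /=]; first by rewrite ffunE.
  by apply/ffunP => i; rewrite ffunE; exact: yk.
by apply: fin_bigcap_measurable => // i _; exact: mf.
Qed.

Lemma finite_map_indicator (B : set Y) : measurable B -> finite_map (fun y => y \in B).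
Proof.
move=> mB [|].
  by rewrite (_ : _ @^-1` _ = B)//; apply/seteqP; split=> y /=; [exact: set_mem|exact: mem_set].
rewrite (_ : _ @^-1` _ = ~` B); first exact: measurableC.
by apply/seteqP; split=> y /=; [move/negbT; rewrite notin_setE|move=> ?; rewrite memNset].
Qed.

End FiniteMaps.

(** * Orbit sums and the density of the requirements *)

Section Core.
Context {R : realType} {Z : completeNormedModType R[i]} (c : int -> Z).
Hypothesis uc : unconditionally_cauchy c.
Context (A : {linear Z -> Z}) (z0 : {linear Z -> R[i]^o}).
Hypotheses (cA : continuous A) (cz : continuous z0).
Hypothesis Ac : forall n, A (c n) = c (n - 1).
Context (a dg : nat).
Hypothesis suppz : forall n : int, z0 (c n) != 0 -> Posz a <= n <= Posz (a + dg).
Hypothesis z0a : z0 (c a) != 0.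
Hypothesis bottom : a = 0%N \/ (forall n : int, n < 0 -> c n = 0) /\ c 0 != 0.
Hypothesis span_c : forall z, closed_span c z.
Context {d : measure_display} {Y : measurableType d} (P : probability Y R) (T : Y -> Y).
Hypotheses (mT : measurable_fun setT T) (iT : invariant_measure P T) (eT : ergodic P T).
Hypothesis small : forall e : R, 0 < e ->
  exists G, [/\ measurable G, (0 < P G)%E & (P G <= e%:E)%E].
(* The powers of [T]; when [T] is not invertible, the terms of negative index
   are irrelevant because the corresponding coefficients vanish. *)
Context (tau : int -> Y -> Y).
Hypothesis mtau : forall n, measurable_fun setT (tau n).
Hypothesis itau : forall n (B : set Y), measurable B -> P (tau n @^-1` B) = P B.
Hypothesis tauE : forall (n : nat) y, tau n y = iter n T y.
Hypothesis tau_shift : forall n, c n != 0 -> \forall y \ae P, tau n (T y) = tau (n + 1) y.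
Hypothesis tau_opp : forall n : nat, c (- Posz n) != 0 ->
  \forall y \ae P, iter n T (tau (- Posz n) y) = y.

Definition orbit_sum (J : finType) (f : Y -> J) (val : J -> R[i]) (y : Y) : Z :=
  bilateral_sum c (fun n => val (f (tau n y))).

Definition orbit_sums : set (Y -> Z) := [set phi | exists (J : finType) (f : Y -> J)
  (val : J -> R[i]), finite_map f /\ phi = orbit_sum f val].

Lemma eq_bilateral_sum (b b' : int -> R[i]) : (forall n, c n != 0 -> b n = b' n) ->
  bilateral_sum c b = bilateral_sum c b'.
Proof.
move=> bb'; have E : window_sum c ^~ b = window_sum c ^~ b'.
  apply/funext => N; apply: eq_bigr => n _.
  by have [->|/bb' ->//] := eqVneq (c n) 0; rewrite !scaler0.
by rewrite /bilateral_sum E.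
Qed.

Lemma finite_map_tau (J : finType) (f : Y -> J) n : finite_map f -> finite_map (f \o tau n).
Proof.
move=> mf j; rewrite comp_preimage -[X in measurable X]setTI.
by apply: mtau => //; exact: mf.
Qed.

Lemma measurable_tau n (B : set Y) : measurable B -> measurable (tau n @^-1` B).
Proof. by move=> mB; rewrite -[X in measurable X]setTI; exact: mtau. Qed.

Lemma borel_orbit_sum (J : finType) (f : Y -> J) (val : J -> R[i]) :
  finite_map f -> borel_map (orbit_sum f val).
Proof.
move=> mf; apply: (@borel_map_cvg _ _ _ _
    (fun N y => window_sum c N (fun n => val (f (tau n y))))).
  (* A window sum factors through a finite type, so that all its preimages are measurable. *)
  move=> N; suff [K [h [g [mh gh]]]] : exists (K : finType) (h : Y -> K) (g : K -> Z),
      finite_map h /\ forall y, window_sum c N (fun n => val (f (tau n y))) = g (h y).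
    move=> U _; have -> : (fun y => window_sum c N (fun n => val (f (tau n y)))) @^-1` U =
        h @^-1` (g @^-1` U).
      by apply/seteqP; split=> y /=; rewrite gh.
    exact: finite_map_preimage.
  rewrite /window_sum; elim: (window N) => [|n s [K [h [g [mh gh]]]]].
    exists unit, (fun=> tt), (fun=> 0); split=> [[]|y]; last by rewrite big_nil.
    by rewrite (_ : _ @^-1` _ = setT)//; apply/seteqP; split.
  exists (J * K)%type, (fun y => (f (tau n y), h y)), (fun x => val x.1 *: c n + g x.2).
  split; first by apply: finite_map_pair => //; exact: finite_map_tau.
  by move=> y; rewrite big_cons gh.
by move=> y; apply: cvg_window_sum (bounded_by_val val _).
Qed.

Lemma ae_forall_int (Q : int -> Y -> Prop) : (forall n, \forall y \ae P, Q n y) ->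
  \forall y \ae P, forall n, Q n y.
Proof.
move=> h; have h1 : \forall y \ae P, forall n : nat, Q (Posz n) y by apply: ae_foralln => n; exact: h.
have h2 : \forall y \ae P, forall n : nat, Q (- Posz n) y by apply: ae_foralln => n; exact: h.
move: h1 h2; apply: filterS2 => y h1 h2 [n|n]; first exact: h1.
by rewrite NegzE; exact: h2.
Qed.

Lemma orbit_sum_shift (J : finType) (f : Y -> J) (val : J -> R[i]) :
  \forall y \ae P, orbit_sum f val (T y) = A (orbit_sum f val y).
Proof.
have : \forall y \ae P, forall n, c n != 0 -> tau n (T y) = tau (n + 1) y.
  apply: (@ae_forall_int (fun n y => c n != 0 -> tau n (T y) = tau (n + 1) y)) => n.
  have [cn|cn] := eqVneq (c n) 0; first by apply: filterE.
  by move: (tau_shift cn); apply: filterS => y h _.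
apply: filterS => y shift; rewrite /orbit_sum.
rewrite (bilateral_sum_shift uc cA Ac (bounded_by_val val (fun n => f (tau n y)))).
by apply: eq_bilateral_sum => n cn; rewrite shift.
Qed.

Definition orbit_hits (N : nat) (D : set Y) : set Y :=
  \bigcup_(i < N.*2.+1) (tau (Posz i - Posz N) @^-1` D).

Lemma measurable_orbit_hits N D : measurable D -> measurable (orbit_hits N D).
Proof. by move=> mD; apply: bigcup_measurable => i _; exact: measurable_tau. Qed.

Lemma prob_orbit_hits N D x : measurable D -> (P D <= x%:E)%E ->
  (P (orbit_hits N D) <= (N.*2.+1%:R * x)%:E)%E.
Proof.
move=> mD Dx; apply: (@prob_bigcup_fin _ _ _ P _ (fun i => tau (Posz i - Posz N) @^-1` D)) => i.
  exact: measurable_tau.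
by rewrite itau.
Qed.

Lemma orbit_hitsN N D y n : ~ orbit_hits N D y -> (`|n| <= N)%N -> ~ D (tau n y).
Proof.
move=> h nN Dn; apply: h; exists `|(n + Posz N)%R|%N; first by rewrite /=; lia.
by rewrite /=; have -> : Posz `|(n + Posz N)%R|%N - Posz N = n by lia.
Qed.

Lemma orbit_sum_close (J K : finType) (f : Y -> J) (g : Y -> K) (val : J -> R[i])
    (val' : K -> R[i]) (N : nat) (e : R) y :
  (forall b, bounded_by (val_bound val + val_bound val') b ->
     (forall n, (`|n| <= N)%N -> b n = 0) -> rnorm (bilateral_sum c b) <= e) ->
  (forall n, (`|n| <= N)%N -> val (f (tau n y)) = val' (g (tau n y))) ->
  rnorm (orbit_sum f val y - orbit_sum g val' y) <= e.
Proof.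
move=> Ne fg; have b1 := bounded_by_val val (fun n => f (tau n y)).
have b2 := bounded_by_val val' (fun n => g (tau n y)).
rewrite /orbit_sum -(bilateral_sumB uc b1 b2); apply: Ne.
  exact: bounded_byD b1 (bounded_byN b2).
by move=> n /fg ->; rewrite subrr.
Qed.

(** Points with [iter N T y] in [G] get the prescribed name [b0] at the times from [-N] to [N], so
    their sums are close to [v]; they have the same measure as [G]. Disjointness of the preimages of
    [G] makes the prescriptions of different points compatible. *)
Lemma orbit_sums_charges (v : Z) (r e : R) phi : 0 < r -> 0 < e -> orbit_sums phi ->
  exists psi, [/\ orbit_sums psi, nearby P e phi psi &
    charges P [set w | rnorm (v - w) < r] psi].
Proof.
move=> r0 e0 [J [f [val [mf ->]]]].
have [|b0 [N0 [b0N vb0]]] := span_c v (_ : 0 < r / 2); first by rewrite divr_gt0.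
have [B0 b0B] := finite_bounded b0N.
have B0_ge0 : 0 <= B0 := le_trans (rnorm_ge0 _) (b0B 0).
(* The letter [inr i] goes to a point that reaches [G] after [i] steps. This is the point at time
   [N - i] of its orbit segment, whence the coefficient; [m./2] will be [N]. *)
pose mkval m (x : J + 'I_m) := match x with inl j => val j | inr i => b0 (Posz m./2 - Posz i) end.
pose M := val_bound val + B0.
pose e1 := Num.min e (r / 4).
have [|N1 N1P] := bilateral_sum_tail uc (M + M) (_ : 0 < e1).
  by rewrite lt_min e0 divr_gt0.
pose N := maxn N0 N1; pose m := N.*2.+1.
have m0 : 0 < m%:R :> R by rewrite ltr0n.
(* Two unions of [m] preimages, over the steps before the visit to [G] and over the window of times,
   bound the exceptional set by [m * m] times the measure of [G]. *)
have [|G [mG G0 Ge Gdis]] := ergodic_disjoint mT iT eT small m (_ : 0 < e / (m%:R * m%:R)).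
  by rewrite divr_gt0// mulr_gt0.
pose h y : {ffun 'I_m -> bool} * J := ([ffun i : 'I_m => iter i T y \in G], f y).
pose g (x : {ffun 'I_m -> bool} * J) : J + 'I_m :=
  if [pick i | x.1 i] is Some i then inr i else inl x.2.
have mg : finite_map (g \o h).
  apply: finite_map_comp; apply: finite_map_pair => //; apply: finite_map_ffun => i.
  by apply: finite_map_indicator; exact: measurable_preimage_iter.
pose val' := mkval m.
have gM b : bounded_by M (fun n : int => val' (b n)).
  move=> n; rewrite /val' /mkval /M; case: (b n) => [j|i].
    apply: le_trans (_ : val_bound val <= _); first exact: (bounded_by_val val (fun=> j) 0).
    by rewrite lerDl.
  apply: le_trans (b0B _) _; rewrite lerDr sumr_ge0// => k _; exact: rnorm_ge0.
have fM b : bounded_by M (fun n : int => val (b n)).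
  move=> n; rewrite /M; apply: le_trans (bounded_by_val val b n) _.
  by rewrite lerDl.
exists (orbit_sum (g \o h) val'); split; first by exists (J + 'I_m)%type, (g \o h), val'.
  pose D := \bigcup_(i < m) (iter i T @^-1` G).
  have mD : measurable D by apply: bigcup_measurable => i _; exact: measurable_preimage_iter.
  exists (orbit_hits N D); split; first exact: measurable_orbit_hits.
    have De : (P D <= (m%:R * (e / (m%:R * m%:R)))%:E)%E.
      apply: (@prob_bigcup_fin _ _ _ P _ (fun i => iter i T @^-1` G)) => i.
        exact: measurable_preimage_iter.
      by rewrite measure_preimage_iter.
    apply: le_trans (prob_orbit_hits N mD De) _; rewrite lee_fin -/m.
    by rewrite [leLHS](_ : _ = e)//; field; rewrite gt_eqF.
  move=> y yD.
  have b1 := fM (fun n => f (tau n y)); have b2 := gM (fun n => g (h (tau n y))).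
  rewrite /orbit_sum -(bilateral_sumB uc b1 b2).
  apply: le_trans (N1P _ (bounded_byD b1 (bounded_byN b2)) _) _; last first.
    by rewrite /e1 ge_min lexx.
  move=> n nN; have Dn : ~ D (tau n y).
    by apply: orbit_hitsN yD _; rewrite (leq_trans nN)// leq_maxr.
  rewrite /g /=; case: pickP => [i|_]; last by rewrite subrr.
  rewrite ffunE inE => Gi; exfalso; apply: Dn; exists i => //=.
have : \forall y \ae P, forall n : nat, c (- Posz n) != 0 -> iter n T (tau (- Posz n) y) = y.
  apply: ae_foralln => n; have [cn|cn] := eqVneq (c (- Posz n)) 0.
    by apply: filterE.
  by move: (tau_opp cn); apply: filterS => y yE _.
move=> [Q [mQ Q0 QP]].
have mGN : measurable (iter N T @^-1` G) by exact: measurable_preimage_iter.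
pose S := orbit_sum (g \o h) val' @^-1` [set w | rnorm (v - w) < r].
have mS : measurable S.
  by apply: borel_orbit_sum => //; exact: open_rball.
rewrite /charges /= -/S; apply: lt_le_trans G0 _.
rewrite -(measure_preimage_iter mT iT N mG).
apply: (@le_trans _ _ (P (Q `|` S))).
  apply: le_measure; rewrite ?inE//; first exact: measurableU.
  move=> y /= Gy; have [Qy|Qy] := pselect (Q y); [by left|right]; rewrite /S /=.
  have opp : forall n : nat, c (- Posz n) != 0 -> iter n T (tau (- Posz n) y) = y.
    by apply: contrapT => /QP.
  (* At negative times the relation is only known where [c n != 0], which is all that the sum
     sees. *)
  have tauN n : (`|n| <= N)%N -> c n != 0 ->
      iter `|(Posz N - n)%R|%N T (tau n y) = iter N T y.
    move=> nN cn; case: n nN cn => n nN cn.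
      by rewrite tauE -iterD window_reflect_nat.
    by rewrite window_reflect_neg NegzE iterD opp// -NegzE.
  have gE n : (`|n| <= N)%N -> c n != 0 -> val' (g (h (tau n y))) = b0 n.
    move=> nN cn; have Gn := tauN n nN cn.
    have im : (`|(Posz N - n)%R|%N < m)%N := window_reflect_lt nN.
    rewrite /g /=; case: pickP => [i|/(_ (Ordinal im))]; last first.
      by rewrite ffunE /= Gn mem_set.
    rewrite ffunE inE => Gi.
    have iE : nat_of_ord i = `|(Posz N - n)%R|%N.
      case: (ltngtP i `|(Posz N - n)%R|%N) => // ij; exfalso.
        by apply: (Gdis (tau n y) i `|(Posz N - n)%R|%N) => //; [rewrite ij /= ltnW | rewrite Gn].
      by apply: (Gdis (tau n y) `|(Posz N - n)%R|%N i) => //; [rewrite ij /= ltnW | rewrite Gn].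
    rewrite /val' /mkval iE; congr b0; have -> : m./2 = N by rewrite /m /= uphalf_double.
    exact: window_reflectK.
  have b2 := gM (fun n => g (h (tau n y))).
  pose b1 n := if (`|n| <= N)%N then b0 n else val' (g (h (tau n y))).
  have b1M : bounded_by M b1.
    move=> n; rewrite /b1; case: ifP => _; last exact: b2.
    apply: le_trans (b0B _) _; rewrite lerDr sumr_ge0// => k _; exact: rnorm_ge0.
  have -> : orbit_sum (g \o h) val' y = bilateral_sum c b1.
    apply: eq_bilateral_sum => n cn; rewrite /b1; case: ifP => // nN.
    exact: gE.
  have b0M : bounded_by M b0.
    move=> n; apply: le_trans (b0B _) _.
    by rewrite lerDr sumr_ge0// => k _; exact: rnorm_ge0.
  apply: le_lt_trans (rnorm_triangle v (bilateral_sum c b0) _) _.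
  rewrite [ltRHS]splitr; apply: ltr_leD => //.
  rewrite -(bilateral_sumB uc b0M b1M).
  apply: le_trans (N1P _ (bounded_byD b0M (bounded_byN b1M)) _) _.
    move=> n nN; rewrite /b1; have -> : (`|n| <= N)%N by rewrite (leq_trans nN)// leq_maxr.
    by rewrite subrr.
  by rewrite /e1 ge_min; apply/orP; right; lra.
apply: (@le_trans _ _ (P Q + P (S))%E).
  exact: measureU2.
by rewrite Q0 add0e.
Qed.

(** The choices are nested: the shift [t] of the values, then the marker, then the block length [p]
    given by [determination], then the rare set [D], and last the length [L]. A point is exceptional
    if it lies in [D], where its label is overwritten, or if no marker block lies within range
    [L]. *)
Lemma orbit_sums_separates (B : set Y) (dl e : R) phi : measurable B -> 0 < dl -> 0 < e ->
  orbit_sums phi ->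
  exists psi, [/\ orbit_sums psi, nearby P e phi psi & separates P B dl psi].
Proof.
move=> mB dl0 e0 [J [f [val [mf ->]]]].
have [K K0 KP] := bilateral_sum_bound uc.
have [gap gap0 gapP] := finite_gap (fun x : J * J => val x.1 - val x.2).
(* As [t < gap], a shift by [t] cannot turn one old value into another, so the values on [B] and off
   [B] are disjoint; the other bound moves the sum by at most [e / 2]. *)
pose t := Num.min (gap / 2) (e / (2 * K)).
have t0 : 0 < t by rewrite lt_min !divr_gt0// mulr_gt0.
have tgap : t < gap by rewrite /t gt_min; apply/orP; left; lra.
have tK : t * K <= e / 2.
  have : t <= e / (2 * K) by rewrite /t ge_min lexx orbT.
  by rewrite ler_pdivlMr ?mulr_gt0// => h; lra.
pose f1 y := (f y, y \in B).
pose val1 (x : J * bool) : R[i] := val x.1 + (if x.2 then t%:C else 0).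
have val1_neq j j' : val1 (j, true) != val1 (j', false).
  rewrite /val1 /= addr0 -subr_eq0 addrAC; apply/eqP => h.
  have tE : val j - val j' = - t%:C by apply/eqP; rewrite -addr_eq0 h.
  have tC0 : (t%:C : R[i]) != 0 by apply/eqP => /complexI t0'; rewrite t0' ltxx in t0.
  have := gapP (j, j'); rewrite /= tE oppr_eq0 tC0 rnormN rnorm_complex gtr0_norm//.
  by rewrite leNgt tgap => /(_ isT).
(* Exceeds by at least 1 the modulus of every other value, so its real part is strictly maximal. *)
pose star : R[i] := (val_bound val1 + 1)%:C.
pose val2 (x : option (J * bool)) : R[i] := if x is Some x then val1 x else star.
have val2_star j : j != None -> complex.Re (val2 j) < complex.Re (val2 None).
  case: j => // x _ /=; rewrite ltr_pwDr//.
  apply: le_trans (ler_norm _) _; apply: le_trans (normr_Re _) _.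
  exact: (bounded_by_val val1 (fun=> x) 0).
have [p [L0 det]] := determination uc cA cz Ac suppz z0a bottom val2_star.
have mf1 : finite_map f1 by apply: finite_map_pair => //; exact: finite_map_indicator.
have [|N NP] := bilateral_sum_tail uc (val_bound val1 + val_bound val2) (_ : 0 < e / 2).
  by rewrite divr_gt0.
pose m := N.*2.+1.
have m0 : 0 < m%:R :> R by rewrite ltr0n.
have [|D [mD De Dblock]] := ergodic_marker mT iT eT small p (_ : 0 < Num.min (e / 2 / m%:R) (dl / 2)).
  by rewrite lt_min !divr_gt0.
have De1 : (P D <= (e / 2 / m%:R)%:E)%E.
  by apply: le_trans De _; rewrite lee_fin ge_min lexx.
have De2 : (P D <= (dl / 2)%:E)%E.
  by apply: le_trans De _; rewrite lee_fin ge_min lexx orbT.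
pose f2 y := if y \in D then None else Some (f1 y).
have mf2 : finite_map f2.
  apply: (@finite_map_comp _ _ _ _ (fun y => (y \in D, f1 y))
    (fun x => if x.1 then None else Some x.2)).
  by apply: finite_map_pair => //; exact: finite_map_indicator.
exists (orbit_sum f2 val2); split; first by exists (option (J * bool)), f2, val2.
  have -> : e = e / 2 + e / 2 by rewrite -splitr.
  apply: (@nearby_trans _ _ _ _ P _ _ _ (orbit_sum f1 val1)).
    exists set0; split=> [//||y _]; first by rewrite measure0 lee_fin divr_ge0// ltW.
    have b1 := bounded_by_val val (fun n => f (tau n y)).
    have b2 := bounded_by_val val1 (fun n => f1 (tau n y)).
    rewrite rnormB /orbit_sum -(bilateral_sumB uc b2 b1).
    pose b n : R[i] := if tau n y \in B then 1 else 0.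
    have bb : bounded_by 1 b.
      move=> n; rewrite /b; case: ifP => _; last by rewrite rnorm0.
      by rewrite (_ : 1 = 1%:C)// rnorm_complex normr1.
    have -> : (fun n => val1 (f1 (tau n y)) - val (f (tau n y))) = fun n => t%:C * b n.
      apply/funext => n; rewrite /val1 /f1 /b /= addrAC subrr add0r.
      by case: ifP; rewrite ?mulr1 ?mulr0.
    rewrite (bilateral_sumZ uc _ bb) rnormZ rnorm_complex (gtr0_norm t0).
    by apply: le_trans tK; rewrite ler_pM2l// KP.
  exists (orbit_hits N D); split; first exact: measurable_orbit_hits.
    apply: le_trans (prob_orbit_hits N mD De1) _; rewrite lee_fin -/m.
    by rewrite mulrC divfK// gt_eqF.
  move=> y yD; apply: orbit_sum_close NP _ => n nN.
  by rewrite /f2 memNset//; exact: orbit_hitsN yD nN.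
(* Almost every point has a marker block eventually, so the increasing sets [Good L] fill the space
   up to a null set and one of them misses less than [dl / 2]. *)
pose Good L := [set y | has_block a None p L (fun n => f2 (tau n y))].
have mGood L : measurable (Good L).
  have -> : Good L = \bigcup_(s in [set s | (s + p <= L)%N])
      \bigcap_(k in [set k | (s <= k < s + p)%N]) (tau (Posz (a + k)) @^-1` (f2 @^-1` [set None])).
    by apply/seteqP; split=> y [s sL sb]; exists s.
  apply: bigcup_measurable => s _; apply: fin_bigcap_measurable.
    apply: (@sub_finite_set _ _ `I_(s + p)) => // k /= /andP[_]; exact.
  by move=> k _; apply: measurable_tau; exact: mf2.
have f2D y : D y -> f2 y = None by move=> Dy; rewrite /f2 mem_set.
have PGood : P (\bigcup_L Good L) = 1%E.
  apply: ae_prob1; first by apply: bigcup_measurable.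
  have := ae_preimage_iter mT iT a Dblock; apply: filterS => y [s sD].
  exists (s + p)%N => //; exists s => // k ks; rewrite tauE; apply: f2D.
  by rewrite addnC iterD; exact: sD.
have [L L0L GoodL] : exists2 L, (L0 <= L)%N & (P (~` Good L) < (dl / 2)%:E)%E.
  have cG : (P \o Good) n @[n --> \oo] --> 1%E.
    rewrite -PGood; apply: nondecreasing_cvg_mu => //; first exact: bigcup_measurable.
    move=> L L' LL'; apply/subsetPset => y [s sL sb]; exists s => //; exact: leq_trans LL'.
  have : (1 - (P \o Good) n)%E @[n --> \oo] --> (1 - 1)%E.
    apply: cvgeB => //; exact: cvg_cst.
  rewrite subee// => /fine_cvgP[_ /cvgrPdist_lt/(_ (dl / 2))].
  rewrite divr_gt0// => /(_ isT)[L1 _ L1P].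
  exists (maxn L0 L1); first exact: leq_maxl.
  have := L1P (maxn L0 L1) (leq_maxr _ _); rewrite /= -probability_setC//.
  rewrite sub0r normrN => /(le_lt_trans (ler_norm _)).
  by rewrite -lte_fin fineK// prob_fin_num//; exact: measurableC.
have [eta eta0 etaP] := det L L0L.
(* Neighbourhoods of the sums of all names with a marker block and with label [lab] at time 0,
   whether or not a point of [Y] has that name. [determination] keeps the two families of sums [eta]
   apart, hence the neighbourhoods [eta / 3]. *)
pose near (lab : bool) := [set w : Z | exists b : int -> option (J * bool),
  [/\ has_block a None p L b, (exists j, b 0 = Some (j, lab)) &
      rnorm (bilateral_sum c (val2 \o b) - w) < eta / 3]].
have onear lab : open (near lab).
  rewrite (_ : near lab = [set w | exists2 x, [set x | exists b : int -> option (J * bool),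
    [/\ has_block a None p L b, (exists j, b 0 = Some (j, lab)) &
      x = bilateral_sum c (val2 \o b)]] x & rnorm (x - w) < eta / 3]).
    exact: open_enlarge.
  apply/seteqP; split=> w; first by move=> [b [h1 h2 h3]]; exists (bilateral_sum c (val2 \o b)) => //; exists b.
  by move=> [_ [b [h1 h2 ->]] h3]; exists b.
exists (near false), (near true), (eta / 3), (~` Good L `|` D).
split; [exact: onear|exact: onear|by rewrite divr_gt0| |split].
- move=> x y [b [gb [j bj] bx]] [b' [gb' [j' bj'] by']].
  have : eta <= rnorm (bilateral_sum c (val2 \o b) - bilateral_sum c (val2 \o b')).
    by apply: etaP => //; rewrite bj bj' /= eq_sym val1_neq.
  have := rnorm_triangle (bilateral_sum c (val2 \o b)) x (bilateral_sum c (val2 \o b')).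
  have := rnorm_triangle x y (bilateral_sum c (val2 \o b')).
  by rewrite (rnormB y (bilateral_sum c (val2 \o b'))); lra.
- by apply: measurableU => //; exact: measurableC.
- apply: (@le_lt_trans _ _ (P (~` Good L) + P D)%E).
    by apply: measureU2 => //; exact: measurableC.
  by rewrite [in ltRHS](splitr dl) EFinD lte_leD// prob_fin_num.
- move=> y /not_orP[/contrapT Gy Dy] By; exists (fun n => f2 (tau n y)); split => //.
    by exists (f y); rewrite (tauE 0) /= /f2 /f1 memNset// mem_set.
  by rewrite subrr rnorm0 divr_gt0.
- move=> y /not_orP[/contrapT Gy Dy] By; exists (fun n => f2 (tau n y)); split => //.
    by exists (f y); rewrite (tauE 0) /= /f2 /f1 memNset// memNset.
  by rewrite subrr rnorm0 divr_gt0.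
Qed.

Theorem ergodic_embedding (q : nat -> Z) (B : nat -> set Y) :
  dense_sequence q -> (forall i, measurable (B i)) ->
  exists Phi : Y -> Z, [/\ borel_map Phi,
    forall U, open U -> U !=set0 -> (0 < P (Phi @^-1` U))%E,
    \forall y \ae P, Phi (T y) = A (Phi y) &
    forall i, exists2 C : set Z, (measurable : set (set (borel Z))) C &
      \forall y \ae P, B i y <-> C (Phi y)].
Proof.
move=> qP mB.
(* Requirements coded by natural numbers: charge the ball of radius [1/(m+1)] around [q i], or read
   off [B i] up to measure [2 ^- m]. *)
pose O k : set (Y -> Z) := match unpickle k : option (nat * nat + nat * nat) with
  | Some (inl (i, m)) => charges P [set w | rnorm (q i - w) < m.+1%:R^-1]
  | Some (inr (i, m)) => separates P (B i) (2 ^- m)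
  | None => setT end.
have [|||k phi e sphi e0|Phi [bPhi OPhi [f_ [F_ f_cvg]]]] := @generic_limit _ _ _ _ P orbit_sums O.
- exists (orbit_sum (fun=> tt) (fun=> 0)), unit, (fun=> tt), (fun=> 0); split => //.
  by move=> [] ; rewrite (_ : _ @^-1` _ = setT)//; apply/seteqP; split.
- by move=> phi [J [f [val [mf ->]]]]; exact: borel_orbit_sum.
- move=> k; rewrite /O; case: unpickle => [[[i m]|[i m]]|].
  + by apply: open_charges; exact: open_rball.
  + exact: open_separates.
  + by move=> f _ _; exists 1.
- rewrite /O; case: unpickle => [[[i m]|[i m]]|].
  + by apply: orbit_sums_charges => //; rewrite invr_gt0.
  + by apply: orbit_sums_separates => //; rewrite invr_gt0 exprn_gt0.
  + exists phi; split => //; exists set0; split => [//||y _].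
      by rewrite measure0 lee_fin ltW.
    by rewrite subrr rnorm0 ltW.
exists Phi; split => //.
- move=> U oU [u Uu]; have [r r0 rU] := (openP_rnorm U).1 oU _ Uu.
  have [m _ /(_ m (leqnn m)) mr] := near_infty_natSinv_lt (PosNum (divr_gt0 r0 (@ltr0Sn R 1))).
  have [|i qi] := qP u m.+1%:R^-1; first by rewrite invr_gt0.
  have := OPhi (pickle (inl (i, m) : nat * nat + nat * nat)); rewrite /O pickleK /charges /=.
  move=> h; apply: lt_le_trans h _; apply: le_measure; rewrite ?inE.
  + by apply: bPhi; exact: open_rball.
  + exact: bPhi.
  + move=> y /= yq; apply: rU; apply: le_lt_trans (rnorm_triangle u (q i) _) _.
    by move: mr qi yq => /=; move: (m.+1%:R^-1) => x; lra.
(* Each approximant satisfies the relation almost everywhere; the convergence also holds at [T y]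
   for almost every [y], because [T] preserves [P]. *)
- have h1 := ae_preimage_iter mT iT 1 f_cvg.
  have h2 : \forall y \ae P, forall n, f_ n (T y) = A (f_ n y).
    apply: ae_foralln => n; have [J [f [val [mf ->]]]] := F_ n.
    exact: orbit_sum_shift.
  move: f_cvg h1 h2; apply: filterS3 => y fy fTy fA.
  have hA : A (f_ n y) @[n --> \oo] --> A (Phi y).
    by apply: continuous_cvg; [exact: cA|exact: fy].
  rewrite -(norm_cvg_lim hA); apply/esym; apply: norm_cvg_lim.
  rewrite (_ : (fun n => A (f_ n y)) = (fun n => f_ n (T y))); first exact: fTy.
  by apply/funext => n; rewrite fA.
- move=> i; apply: separates_all => m.
  by have := OPhi (pickle (inr (i, m) : nat * nat + nat * nat)); rewrite /O pickleK.
Qed.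

End Core.

(** * Maps modulo null sets *)

Section Mod0.
Context {R : realType} {d d' d'' : measure_display} {X : measurableType d}
  {Y : measurableType d'} {W : measurableType d''}.
Context (mu : probability X R) (nu : probability Y R) (rho : probability W R).

Lemma mod0_of_measurable (f : X -> Y) : measurable_fun setT f ->
  (forall B, measurable B -> mu (f @^-1` B) = nu B) -> measure_preserving_mod0 mu nu f.
Proof.
move=> mf fB B mB; exists (f @^-1` B), set0; split.
- by rewrite -[X in measurable X]setTI; exact: mf.
- exact: negligible_set0.
- by rewrite setU0.
- exact: fB.
Qed.

Lemma mod0_negligible (f : X -> Y) N : measure_preserving_mod0 mu nu f ->
  nu.-negligible N -> mu.-negligible (f @^-1` N).
Proof.
move=> pf [M [mM M0 NM]]; have [A [N' [mA nN' fM AM]]] := pf M mM.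
apply: (@negligibleS _ _ _ _ (A `|` N')); last first.
  by apply: negligibleU nN' => //; exists A; split => //; exact: etrans AM M0.
by rewrite -fM => x /= /NM.
Qed.

Lemma mod0_ae (f : X -> Y) (Q : Y -> Prop) : measure_preserving_mod0 mu nu f ->
  (\forall y \ae nu, Q y) -> \forall x \ae mu, Q (f x).
Proof. by move=> pf nQ; exact: (mod0_negligible pf nQ). Qed.

Lemma mod0_comp (f : X -> Y) (g : Y -> W) : measure_preserving_mod0 mu nu f ->
  measure_preserving_mod0 nu rho g -> measure_preserving_mod0 mu rho (g \o f).
Proof.
move=> pf pg B mB; have [A [N [mA nN gB AB]]] := pg B mB.
have [A' [N' [mA' nN' fA A'A]]] := pf A mA.
exists A', (N' `|` f @^-1` N); split => //.
- by apply: negligibleU => //; exact: mod0_negligible nN.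
- by rewrite comp_preimage gB preimage_setU fA setUA.
- by rewrite A'A.
Qed.

Lemma mod0_measure (f f' : X -> Y) B : measure_preserving_mod0 mu nu f ->
  measurable_fun setT f' -> (\forall x \ae mu, f' x = f x) -> measurable B ->
  mu (f' @^-1` B) = nu B.
Proof.
move=> pf mf' ff' mB; have [A [N [mA nN fB <-]]] := pf B mB.
apply: ae_measure_eq => //; first by rewrite -[X in measurable X]setTI; exact: mf'.
have : \forall x \ae mu, ~ N x.
  by apply: negligibleS nN => x /=; exact: contrapT.
move: ff'; apply: filterS2 => x /= -> Nx.
have -> : B (f x) = (A `|` N) x by rewrite -fB.
by split=> [[]//|]; left.
Qed.

End Mod0.

Lemma real_measurability {R : realType} {d} {X : measurableType d}
    (f : X -> measurableTypeR R) :
  (forall x : R, measurable [set t | x < f t]) -> measurable_fun setT f.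
Proof.
move=> mf; apply: (measurability _ (measurable_realfun.RGenOInfty.measurableE R)) => _ [_ [x ->] <-].
rewrite setTI (_ : _ @^-1` _ = [set t | x < f t])//.
by apply/seteqP; split=> t /=; rewrite in_itv/= andbT.
Qed.

Definition enum_rat (R : realType) (n : nat) : R :=
  if unpickle n is Some q then ratr (q : rat) else 0.

Lemma enum_rat_between {R : realType} (x y : R) : x < y ->
  exists n, x < enum_rat R n < y.
Proof.
move=> /rat_in_itvoo[q]; rewrite in_itv/= => qxy; exists (pickle q).
by rewrite /enum_rat pickleK.
Qed.

(** A real function is determined by the sets where it exceeds a rational. Each of them is
    measurable up to a null set; setting [f] to 0 on one measurable null set [M] containing all the
    errors makes them measurable. *)
Lemma mod0_regularize {R : realType} {d} {X : measurableType d}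
    (mu : probability X R) (nu : probability (measurableTypeR R) R)
    (f : X -> measurableTypeR R) : measure_preserving_mod0 mu nu f ->
  exists2 g : X -> measurableTypeR R, measurable_fun setT g & \forall x \ae mu, g x = f x.
Proof.
move=> pf; have mray (x : R) : measurable ([set t | x < t] : set (measurableTypeR R)).
  rewrite (_ : [set t | x < t] = `]x, +oo[%classic)//.
  by apply/seteqP; split=> t /=; rewrite in_itv/= andbT.
have /choice[AN ANP] : forall n, exists AN : set X * set X, [/\ measurable AN.1,
    mu.-negligible AN.2 & f @^-1` [set t | enum_rat R n < t] = AN.1 `|` AN.2].
  by move=> n; have [A [N [mA nN fA _]]] := pf _ (mray (enum_rat R n)); exists (A, N).
have [M [mM M0 NM]] : mu.-negligible (\bigcup_n (AN n).2).
  by apply: negligible_bigcup => n; have [] := ANP n.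
exists (fun x => if x \in M then 0 else f x); last first.
  exists M; split => // x /= h; apply: contrapT => Mx; apply: h.
  by rewrite memNset.
apply: real_measurability => x.
have -> : [set t | x < (if t \in M then 0 else f t)] =
    (M `&` [set t | x < 0]) `|` (\bigcup_(n in [set n | x < enum_rat R n]) (AN n).1 `\` M).
  apply/seteqP; split=> t /=.
    have [Mt|Mt] := pselect (M t); first by rewrite mem_set//; left.
    rewrite memNset// => xft; right; split => //.
    have [n /andP[xn nf]] := enum_rat_between xft; exists n => //=.
    have [_ _ fE] := ANP n; have : (f @^-1` [set t | enum_rat R n < t]) t by [].
    by rewrite fE => -[//|Nt]; case: Mt; apply: NM; exists n.
  case=> [[Mt x0]|[[n /= xn At] Mt]]; first by rewrite mem_set.
  rewrite memNset//; apply: lt_trans xn _.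
  have [_ _ fE] := ANP n.
  have : (f @^-1` [set t | enum_rat R n < t]) t by rewrite fE; left.
  by [].
apply: measurableU; last first.
  by apply: measurableD => //; apply: bigcup_measurable => n _; have [] := ANP n.
by have [x0|x0] := pselect (x < 0); [rewrite (_ : [set _ | _] = setT) ?setIT//|
   rewrite (_ : [set _ | _] = set0) ?setI0//]; apply/seteqP; split.
Qed.

(** * The unit interval *)

Definition uniform01 (R : realType) : probability (measurableTypeR R) R :=
  uniform_prob (@ltr01 R).

#[local] Instance ae_filter_real {R : realType} (P : probability (measurableTypeR R) R) :
  Filter (nbhs (almost_everywhere P)).
Proof. exact: ae_filter_ringOfSetsType. Qed.

Section Uniform.
Context {R : realType}.
Notation U01 := (uniform01 R).

Lemma uniform_ae01 : \forall y \ae U01, 0 <= y <= 1.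
Proof.
exists (~` `[0, 1]%classic); split.
- exact: measurableC.
- by rewrite /uniform01/= /uniform_prob integral_uniform_pdf setICl integral_set0.
- by move=> y /= h; rewrite in_itv.
Qed.

Lemma uniform_small (e : R) : 0 < e ->
  exists G, [/\ measurable G, (0 < U01 G)%E & (U01 G <= e%:E)%E].
Proof.
move=> e0; pose e1 := Num.min e 1.
have e10 : 0 < e1 by rewrite lt_min e0 ltr01.
have e11 : e1 <= 1 by rewrite ge_min lexx orbT.
have PE : U01 `[0, e1]%classic = e1%:E.
  rewrite /uniform01/= /uniform_prob integral_uniform_pdf setIidl; last first.
    by move=> x /=; rewrite !in_itv/= => /andP[-> /le_trans]; apply.
  rewrite (eq_integral (cst 1%:E)); last first.
    move=> x; rewrite inE/= in_itv/= => /andP[x0 x1].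
    by rewrite /uniform_pdf x0 (le_trans x1 e11) /= subr0 invr1.
  by rewrite integral_cst//= mul1e lebesgue_measure_itv/= lte_fin e10 oppr0 adde0.
exists `[0, e1]%classic; split => //; first by rewrite PE lte_fin.
by rewrite PE lee_fin ge_min lexx.
Qed.

End Uniform.

(** * The model on the unit interval and its transport *)

Section Model.
Context {R : realType} {Z : completeNormedModType R[i]} (c : int -> Z).
Hypothesis uc : unconditionally_cauchy c.
Context (A : {linear Z -> Z}) (z0 : {linear Z -> R[i]^o}).
Hypotheses (cA : continuous A) (cz : continuous z0).
Hypothesis Ac : forall n, A (c n) = c (n - 1).
Context (a dg : nat).
Hypothesis suppz : forall n : int, z0 (c n) != 0 -> Posz a <= n <= Posz (a + dg).
Hypothesis z0a : z0 (c a) != 0.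
Hypothesis span_c : forall z, closed_span c z.
Context (q : nat -> Z).
Hypothesis qP : dense_sequence q.
Notation Y := (measurableTypeR R).
Notation U01 := (uniform01 R).

Lemma continuous_borel_measurable (B : set (borel Z)) : measurable B ->
  measurable (A @^-1` B : set (borel Z)).
Proof.
move=> mB; have : measurable_fun setT (A : borel Z -> borel Z).
  apply: (@measurability _ _ _ (borel Z) setT _ (@open Z)) => //.
  move=> _ [U oU <-]; rewrite setTI; apply: sub_gen_smallest.
  by move/continuousP: cA; exact.
by move=> /(_ measurableT _ mB); rewrite setTI.
Qed.

(** [ergodic_embedding] is applied to the rays above rationals, which separate the points of the
    line. The inverse of [Phi] is built from the Borel sets [C i] alone, and [nu] is the law of
    [Phi]. *)
Lemma uniform_model (T : Y -> Y) (tau : int -> Y -> Y) :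
  a = 0%N \/ (forall n : int, n < 0 -> c n = 0) /\ c 0 != 0 -> measurable_fun setT T -> invariant_measure U01 T -> ergodic U01 T ->
  (forall n, measurable_fun setT (tau n)) ->
  (forall n (B : set Y), measurable B -> U01 (tau n @^-1` B) = U01 B) ->
  (forall (n : nat) y, tau n y = iter n T y) ->
  (forall n, c n != 0 -> \forall y \ae U01, tau n (T y) = tau (n + 1) y) ->
  (forall n : nat, c (- Posz n) != 0 -> \forall y \ae U01, iter n T (tau (- Posz n) y) = y) ->
  exists (nu : probability (borel Z) R) (Phi : Y -> borel Z) (gam : borel Z -> Y),
    [/\ invariant_measure nu A, full_support nu, isomorphism_mod0 U01 nu Phi gam &
        \forall y \ae U01, Phi (T y) = A (Phi y)].
Proof.
move=> bot mT iT eT mtau itau tauE tau_shift tau_opp.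
have mray (x : R) : measurable ([set t | x < t] : set Y).
  rewrite (_ : [set t | x < t] = `]x, +oo[%classic)//.
  by apply/seteqP; split=> t /=; rewrite in_itv/= andbT.
have [Phi [bPhi PhiU PhiT CE]] := @ergodic_embedding R Z c uc A z0 cA cz Ac
  a dg suppz z0a bot span_c _ Y U01 T mT iT eT uniform_small tau mtau itau tauE
  tau_shift tau_opp q (fun n => [set t | enum_rat R n < t]) qP (fun n => mray _).
have /choice[C CP] : forall i, exists C : set (borel Z), measurable C /\
    \forall y \ae U01, enum_rat R i < y <-> C (Phi y).
  by move=> i; have [C mC CP] := CE i; exists C.
have mPhi : measurable_fun setT (Phi : Y -> borel Z) by exact: borel_mapP.
pose PhiM : {mfun Y >-> borel Z} := mfun_Sub (mem_set mPhi).
pose nu : probability (borel Z) R := distribution U01 PhiM.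
have nuE B : nu B = U01 (Phi @^-1` B) by [].
have mPhiB (B : set (borel Z)) : measurable B -> measurable (Phi @^-1` B).
  by move=> mB; rewrite -[X in measurable X]setTI; exact: (mPhi measurableT B mB).
(* A point is the supremum of the rationals below it. The default 0 and the restriction to [[0, 1]]
   make the supremum exist at every [z], also off the range of [Phi]; being countable, it is
   measurable. *)
pose u i z : R := if (z \in C i) && (0 <= enum_rat R i <= 1) then enum_rat R i else 0.
pose gam (z : borel Z) : Y := sup (range (u ^~ z)).
have u01 i z : 0 <= u i z <= 1.
  by rewrite /u; case: ifP => [/andP[]//|_]; rewrite lexx ler01.
have has_sup_u z : has_sup (range (u ^~ z)).
  split; first by exists (u 0%N z); exists 0%N.
  by exists 1 => _ [i _ <-]; have /andP[] := u01 i z.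
have u_le i z : u i z <= gam z by apply: sup_upper_bound => //; exists i.
have mgam : measurable_fun setT gam.
  apply: real_measurability => x.
  have -> : [set z | x < gam z] = \bigcup_i [set z | x < u i z].
    apply/seteqP; split=> z /=; last by move=> [i _ /=] /lt_le_trans; apply.
    move=> xg; have [_ [i _ <-] xu] := sup_gt (has_sup_u z).1 xg.
    by exists i.
  apply: bigcup_measurable => i _; have [mC _] := CP i.
  have -> : [set z | x < u i z] =
      (C i `&` [set z | x < u i z]) `|` (~` C i `&` [set z | x < u i z]).
    by rewrite -setIUl setUv setTI.
  have cst (b : bool) (D : set (borel Z)) : (forall z, D z -> x < u i z = b) ->
      measurable D -> measurable (D `&` [set z | x < u i z]).
    move=> Db mD; case: b Db => Db.
      by rewrite (_ : _ `&` _ = D)//; apply/seteqP; split=> z; [case|move=> Dz; split => //=; rewrite Db].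
    by rewrite (_ : _ `&` _ = set0)//; apply/seteqP; split=> z // [Dz /=]; rewrite Db.
  apply: measurableU.
    apply: (cst (x < if 0 <= enum_rat R i <= 1 then enum_rat R i else 0)) => // z Cz.
    by rewrite /u mem_set.
  apply: (cst (x < 0)) => [z Cz|]; last exact: measurableC.
  by rewrite /u memNset.
have gamPhi : \forall y \ae U01, gam (Phi y) = y.
  have h : \forall y \ae U01, forall i, enum_rat R i < y <-> C i (Phi y).
    by apply: ae_foralln => i; have [] := CP i.
  move: h (@uniform_ae01 R); apply: filterS2 => y Cy /andP[y0 y1].
  apply/eqP; rewrite eq_le; apply/andP; split.
    apply: ge_sup; first by have [] := has_sup_u (Phi y).
    move=> _ [i _ <-]; rewrite /u; case: ifP => // /andP[/set_mem/Cy/ltW]//.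
  rewrite leNgt; apply/negP => /enum_rat_between[i /andP[gi iy]].
  have := u_le i (Phi y); rewrite /u mem_set; last exact/Cy.
  have g0 : 0 <= gam (Phi y) by apply: le_trans (u_le 0%N _); have /andP[] := u01 0%N (Phi y).
  rewrite (le_trans g0 (ltW gi)) (le_trans (ltW iy) y1) /=.
  by rewrite leNgt gi.
have mgamB (B : set Y) : measurable B -> measurable (gam @^-1` B).
  by move=> mB; rewrite -[X in measurable X]setTI; exact: (mgam measurableT B mB).
have gam_nu (B : set Y) : measurable B -> nu (gam @^-1` B) = U01 B.
  move=> mB; rewrite nuE; apply: ae_measure_eq => //.
    by apply: mPhiB; exact: mgamB.
  by move: gamPhi; apply: filterS => y /= ->.
have mPhi0 : measure_preserving_mod0 U01 nu Phi by apply: mod0_of_measurable.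
have mgam0 : measure_preserving_mod0 nu U01 gam by apply: mod0_of_measurable.
exists nu, Phi, gam; split => //.
- move=> B mB; rewrite !nuE.
  have mAB := continuous_borel_measurable mB.
  rewrite -(iT (Phi @^-1` B) (mPhiB _ mB)); apply: ae_measure_eq.
  + exact: mPhiB.
  + by rewrite -[X in measurable X]setTI; apply: mT => //; exact: mPhiB.
  + by move: PhiT; apply: filterS => y /= ->.
- split => //.
  (* If [Phi (gam z)] differs from [z], some ball of a countable family contains [z] and not
     [Phi (gam z)]. Each set [E i m] of such [z] is null, because [gam (Phi y) = y] almost
     everywhere. *)
  pose ball i m : set (borel Z) := [set w | rnorm (q i - w) < m.+1%:R^-1].
  have mball i m : measurable (ball i m) by apply: sub_gen_smallest; exact: open_rball.
  pose E i m := ball i m `&` (gam @^-1` (Phi @^-1` (~` ball i m))).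
  have mE i m : measurable (E i m).
    by apply: measurableI => //; apply: mgamB; apply: mPhiB; exact: measurableC.
  have E0 i m : nu (E i m) = 0%E.
    rewrite nuE; have [N [mN N0 NP]] := gamPhi.
    apply: measure_negligible; first exact: mPhiB.
    exists N; split => // y [/= h1 h2]; apply: NP => /= gE.
    by apply: h2; rewrite gE.
  exists (\bigcup_i \bigcup_m E i m); split.
  + by apply: bigcup_measurable => i _; apply: bigcup_measurable => m _.
  + apply: measure_negligible.
      by apply: bigcup_measurable => i _; apply: bigcup_measurable => m _.
    apply: negligible_bigcup => i; apply: negligible_bigcup => m.
    by exists (E i m); split => //; exact: E0.
  + move=> z /= /eqP zz; have r0 : 0 < rnorm (z - Phi (gam z)).
      rewrite lt_def rnorm_ge0 andbT; apply: contra zz => /eqP/rnorm_eq0/eqP.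
      by rewrite subr_eq0 eq_sym.
    have [m _ /(_ m (leqnn m)) mr] := near_infty_natSinv_lt (PosNum (divr_gt0 r0 (@ltr0Sn R 1))).
    have [|i qi] := @qP z m.+1%:R^-1; first by rewrite invr_gt0.
    exists i => //; exists m => //; split; rewrite /ball /=; first by rewrite rnormB.
    apply/negP; rewrite -leNgt; have := rnorm_triangle z (q i) (Phi (gam z)).
    by move: mr qi => /=; move: (m.+1%:R^-1) => x; lra.
Qed.

Section Transport.
Context {d : measure_display} {X : measurableType d} (mu : probability X R).

(* Everything is transported to the unit interval, where maps that are only
   measurable for the completed sigma-algebra have Borel versions. *)
Lemma transport_ergodic (T : X -> X) (T' : Y -> Y) (h : X -> Y) :
  dynamical_system mu T -> ergodic mu T -> measure_preserving_mod0 mu U01 h ->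
  measurable_fun setT T' -> (\forall x \ae mu, T' (h x) = h (T x)) -> ergodic U01 T'.
Proof.
move=> [mT iT] eT ph mT' hT B mB TB.
have [C [N [mC nN hB CB]]] := ph B mB; rewrite -CB.
have mTn n (D : set X) : measurable D -> measurable (iter n T @^-1` D).
  exact: measurable_preimage_iter.
have CT : \forall x \ae mu, C (T x) <-> C x.
  have nNc : \forall x \ae mu, ~ N x by apply: negligibleS nN => x /=; exact: contrapT.
  have nNT := ae_preimage_iter mT iT 1 nNc.
  move: hT nNc nNT; apply: filterS3 => x hx Nx NTx.
  have hE y : ~ N y -> C y <-> B (h y).
    move=> Ny; have -> : B (h y) = (C `|` N) y by rewrite -hB.
    by split=> [|[]//]; left.
  rewrite !hE// -hx; have {2}<- := TB.
  by [].
have CTn : \forall x \ae mu, forall n, C (iter n T x) <-> C x.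
  have : \forall x \ae mu, forall n, C (T (iter n T x)) <-> C (iter n T x).
    by apply: ae_foralln => n; exact: (ae_preimage_iter mT iT n CT).
  by apply: filterS => x h' n; elim: n => //= n ih; rewrite h'.
(* [C] is invariant only almost everywhere, while [ergodic] speaks of strict invariance. The points
   that visit [C] infinitely often form a strictly invariant set, equal to [C] up to a null set. *)
pose D := \bigcap_m \bigcup_n (iter (m + n) T @^-1` C).
have mD : measurable D.
  by apply: bigcapT_measurable => m; apply: bigcup_measurable => n _; exact: mTn.
have TD : T @^-1` D = D.
  apply/seteqP; split=> x /= Dx m _.
    have [n _ /=] := Dx m Logic.I; rewrite -iterSr => Cx.
    by exists n.+1 => //=; rewrite addnS.
  have [n _ /=] := Dx m.+1 Logic.I; rewrite -iterS iterSr => Cx.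
  by exists n.
have -> : mu C = mu D.
  apply: ae_measure_eq => //; move: CTn; apply: filterS => x h'.
  split=> [Cx m _|/(_ 0%N Logic.I)[n _ /=]]; last by rewrite h'.
  by exists 0%N => //=; rewrite h'.
exact: eT.
Qed.

(** [h \o T \o k] preserves the uniform measure modulo null sets, so it has a Borel version, and
    invariance does not notice the null set. *)
Lemma real_version (h : X -> Y) (k : Y -> X) (T : X -> X) :
  isomorphism_mod0 mu U01 h k -> measure_preserving_mod0 mu mu T ->
  exists T' : Y -> Y, [/\ measurable_fun setT T', invariant_measure U01 T',
    (\forall y \ae U01, T' y = h (T (k y))) & (\forall x \ae mu, T' (h x) = h (T x))].
Proof.
move=> [ph pk kh hk] pT; have phTk := mod0_comp pk (mod0_comp pT ph).
have [T' mT' T'E] := mod0_regularize phTk; exists T'; split => //.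
  by move=> B mB; exact: (mod0_measure phTk).
have h1 := mod0_ae ph T'E; move: kh h1; apply: filterS2 => x /= khx ->.
by rewrite khx.
Qed.

Lemma real_version_cancel (h : X -> Y) (k : Y -> X) (T S : X -> X) (T' S' : Y -> Y) :
  isomorphism_mod0 mu U01 h k -> measure_preserving_mod0 mu mu T ->
  (\forall y \ae U01, T' y = h (T (k y))) -> (\forall x \ae mu, S' (h x) = h (S x)) ->
  (\forall x \ae mu, S (T x) = x) -> \forall y \ae U01, S' (T' y) = y.
Proof.
move=> [ph pk kh hk] pT T'E S'E ST.
have h1 := mod0_ae (mod0_comp pk pT) S'E; have h2 := mod0_ae pk ST.
have h3 : \forall y \ae U01, S' (T' y) = h (k y).
  by move: T'E h1 h2; apply: filterS3 => y /= -> -> ->.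
by move: h3 hk; apply: filterS2 => y /= -> ->.
Qed.

Lemma has_model_transport (h : X -> Y) (k : Y -> X) (T : X -> X) (T' : Y -> Y) :
  isomorphism_mod0 mu U01 h k -> (\forall x \ae mu, T' (h x) = h (T x)) ->
  (exists (nu : probability (borel Z) R) (Phi : Y -> borel Z) (gam : borel Z -> Y),
    [/\ invariant_measure nu A, full_support nu, isomorphism_mod0 U01 nu Phi gam &
        \forall y \ae U01, Phi (T' y) = A (Phi y)]) ->
  has_model A mu T.
Proof.
move=> [ph pk kh hk] T'h [nu [Phi [gam [inu fnu [pPhi pgam gP Pg] PhiT]]]].
exists nu; split => //; exists (Phi \o h), (k \o gam); split.
  split; [exact: mod0_comp ph pPhi|exact: mod0_comp pgam pk| |].
  - by have h1 := mod0_ae ph gP; move: kh h1; apply: filterS2 => x /= khx ->.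
  - by have h1 := mod0_ae pgam hk; move: Pg h1; apply: filterS2 => z /= Pgz ->.
by have h1 := mod0_ae ph PhiT; move: T'h h1; apply: filterS2 => x /= ->.
Qed.

End Transport.

Lemma universal_ergodic_model :
  (forall n : int, n < 0 -> c n = 0) -> c 0 != 0 -> universal_ergodic A.
Proof.
move=> cneg c0 d X mu T [h [k iso]] sT eT; have [mT iT] := sT.
have pT : measure_preserving_mod0 mu mu T by exact: mod0_of_measurable.
have [T' [mT' iT' T'E T'h]] := real_version iso pT.
have [ph _ _ _] := iso.
have eT' := transport_ergodic sT eT ph mT' T'h.
apply: (has_model_transport iso T'h).
pose tau (n : int) : Y -> Y := match n with Posz m => iter m T' | Negz _ => id end.
apply: (@uniform_model T' tau) => //.
- by right.
- move=> [n|n] _ B mB; rewrite setTI; last by rewrite preimage_id.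
  exact: measurable_preimage_iter.
- by move=> [n|n] B mB //; exact: measure_preimage_iter.
- move=> [n|n] cn; last by rewrite cneg ?eqxx in cn.
  by apply: filterE => y /=; rewrite addn1 -iterSr.
- by move=> [|n] cn; [exact: filterE|rewrite cneg ?eqxx in cn].
Qed.

Lemma universal_invertible_model : a = 0%N -> universal_invertible_ergodic A.
Proof.
move=> a0 d X mu T [h [k iso]] sT eT [S [pT pS ST TS]]; have [mT iT] := sT.
have [T' [mT' iT' T'E T'h]] := real_version iso pT.
have [S' [mS' iS' S'E S'h]] := real_version iso pS.
have [ph _ _ _] := iso.
have eT' := transport_ergodic sT eT ph mT' T'h.
have S'T' := real_version_cancel iso pT T'E S'h ST.
have T'S' := real_version_cancel iso pS S'E T'h TS.
apply: (has_model_transport iso T'h).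
pose tau (n : int) : Y -> Y := match n with Posz m => iter m T' | Negz m => iter m.+1 S' end.
apply: (@uniform_model T' tau) => //.
- by left.
- by move=> [n|n] _ B mB; rewrite setTI; exact: measurable_preimage_iter.
- by move=> [n|n] B mB; exact: measure_preimage_iter.
- move=> [n|n] cn; first by apply: filterE => y /=; rewrite addn1 -iterSr.
  move: S'T'; apply: filterS => y STy; rewrite /tau iterSr STy.
  by case: n {cn} => [|n] /=; rewrite ?subn1.
- move=> n cn; have h1 : \forall y \ae U01, forall m, T' (S' (iter m S' y)) = iter m S' y.
    by apply: ae_foralln => m; exact: (ae_preimage_iter mS' iS' m T'S').
  move: h1; apply: filterS => y TSy.
  have -> : tau (- Posz n) y = iter n S' y by case: n {cn} => [|n].
  by elim: n {cn} => //= n ih; rewrite -iterS iterSr /= TSy.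
Qed.

End Model.

(** * Integrals of nonnegative functions *)

Section NonnegIntegral.
Import HBNNSimple.
Context {R : realType} {d : measure_display} {X : measurableType d} (mu : probability X R).

(* The integral of a nonnegative function is the supremum of the integrals of the
   simple functions below it, whether or not the function is measurable. *)
Lemma ae_le_integral (f g : X -> \bar R) (N : set X) :
  (forall x, 0 <= f x)%E -> (forall x, 0 <= g x)%E -> measurable N -> mu N = 0%E ->
  (forall x, ~ N x -> f x <= g x)%E -> (\int[mu]_x f x <= \int[mu]_x g x)%E.
Proof.
move=> f0 g0 mN N0 fg; rewrite !ge0_integralTE//; apply: ge_ereal_sup => _ [h hf <-].
have mNC : measurable (~` N) by exact: measurableC.
pose h' := proj_nnsfun h mNC.
have h'E x : h' x = if x \in N then 0 else h x.
  by rewrite -[LHS]/((proj_nnsfun h mNC : X -> R) x) -mrestrict patchE in_setC; case: (x \in N).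
have -> : sintegral mu h = sintegral mu h'.
  rewrite -!integralT_nnsfun; apply: ge0_ae_eq_integral => //.
  - by apply/measurable_EFinP.
  - by apply/measurable_EFinP.
  - by move=> x _; rewrite lee_fin.
  - by move=> x _; rewrite lee_fin.
  - exists N; split => // x hx; apply: contrapT => Nx; apply: hx => _.
    have e : h x = h' x by rewrite h'E memNset.
    by rewrite e.
apply: ereal_sup_ubound; exists h' => // x; rewrite h'E.
have [Nx|Nx] := pselect (N x); first by rewrite mem_set.
by rewrite memNset//; apply: le_trans (hf x) (fg x Nx).
Qed.

Lemma le_integral_ge0 (f g : X -> \bar R) :
  (forall x, 0 <= f x)%E -> (forall x, f x <= g x)%E ->
  (\int[mu]_x f x <= \int[mu]_x g x)%E.
Proof.
move=> f0 fg; apply: (@ae_le_integral _ _ set0) => // x.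
exact: le_trans (f0 x) (fg x).
Qed.

Lemma ae_eq_integral_ge0 (f g : X -> \bar R) :
  (forall x, 0 <= f x)%E -> (forall x, 0 <= g x)%E ->
  (\forall x \ae mu, f x = g x) -> (\int[mu]_x f x = \int[mu]_x g x)%E.
Proof.
move=> f0 g0 [N [mN N0 NP]].
have fg x : ~ N x -> f x = g x by move=> Nx; apply: contrapT => h; apply: Nx; exact: NP.
apply/eqP; rewrite eq_le; apply/andP; split; apply: (@ae_le_integral _ _ N) => // x Nx.
  by rewrite fg.
by rewrite fg.
Qed.

End NonnegIntegral.

(** * Simple functions *)

Section SimpleFunctions.
Context {R : realType} {Z : normedModType R[i]} {d : measure_display}
  {X : measurableType d} (mu : probability X R).

Lemma simple_finite_map (J : finType) (h : X -> J) (g : J -> Z) :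
  finite_map h -> simple_fun (g \o h).
Proof.
move=> mh; split.
  apply: (@sub_finite_set _ _ (range g)); first by move=> _ [x _ <-]; exists (h x).
  exact: finite_image.
by move=> z; rewrite comp_preimage; exact: finite_map_preimage.
Qed.

(** Factoring through a finite type turns sums over the range into sums over a [finType], and lets
    two simple functions share one factorization, through the product type. *)
Lemma simple_funP (s : X -> Z) : simple_fun s ->
  exists (J : finType) (h : X -> J) (g : J -> Z), finite_map h /\ s = g \o h.
Proof.
move=> [/finite_seqP[l sl] ms].
have memP x : s x \in l.
  have : range s (s x) by exists x.
  by rewrite sl.
pose h x : 'I_(size l).+1 := inord (index (s x) l).
have hE x : h x = index (s x) l :> nat.
  by rewrite /h inordK// ltnS ltnW// index_mem.
exists 'I_(size l).+1, h, (fun j : 'I_(size l).+1 => nth 0 l j); split.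
  move=> j; have -> : h @^-1` [set j] =
      \bigcup_(z in [set` [seq z <- l | index z l == j :> nat]]) s @^-1` [set z].
    apply/seteqP; split=> x /=.
      move=> hx; exists (s x) => //=; rewrite mem_filter memP andbT -hE.
      by rewrite (_ : h x = j).
    move=> [z /=]; rewrite mem_filter => /andP[/eqP zj _] sxz.
    by apply: ord_inj; rewrite hE sxz.
  by apply: fin_bigcup_measurable => // z _; exact: ms.
by apply/funext => x /=; rewrite hE nth_index.
Qed.

Lemma prob_fine (B : set X) : measurable B -> (fine (mu B))%:E = mu B.
Proof. by move=> mB; rewrite fineK// prob_fin_num. Qed.

Lemma prob_fibers (J : finType) (h : X -> J) (p : pred J) : finite_map h ->
  fine (mu [set x | p (h x)]) = \sum_(j | p j) fine (mu (h @^-1` [set j])).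
Proof.
move=> mh; have -> : [set x | p (h x)] = \bigcup_(j in [set` enum p]) (h @^-1` [set j]).
  apply/seteqP; split=> x /=; first by move=> px; exists (h x) => //=; rewrite mem_enum.
  by move=> [j /=]; rewrite mem_enum => pj ->.
rewrite measure_fin_bigcup//; last by move=> j k _ _ [x [/= -> ->]].
rewrite -fsbig_seq ?enum_uniq// big_enum/=.
under eq_bigr do rewrite -prob_fine//.
by rewrite sumEFin.
Qed.

Definition finite_integral (J : finType) (h : X -> J) (g : J -> Z) : Z :=
  \sum_j (fine (mu (h @^-1` [set j])))%:C *: g j.

Lemma simple_integralE (J : finType) (h : X -> J) (g : J -> Z) : finite_map h ->
  simple_integral mu (g \o h) = finite_integral h g.
Proof.
move=> mh; pose l := undup [seq g j | j <- enum J].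
have gl j : g j \in l by rewrite mem_undup map_f// mem_enum.
rewrite /simple_integral (fsbig_widen _ [set` l]); last 2 first.
- by move=> _ [x _ <-] /=; exact: gl.
- move=> z /= [_ nz]; rewrite (_ : _ @^-1` _ = set0) ?measure0 ?scale0r//.
  by apply/seteqP; split=> x //= hx; apply: nz; exists x.
rewrite -fsbig_seq ?undup_uniq//.
under eq_bigr => z _.
  rewrite (_ : _ @^-1` _ = [set x | g (h x) == z]); last first.
    by apply/seteqP; split=> x /= => [->|/eqP].
  rewrite (prob_fibers (fun j => g j == z) mh) rmorph_sum/= scaler_suml big_mkcond/=.
  over.
rewrite exchange_big/=; apply: eq_bigr => j _.
rewrite -big_mkcond/= (big_rem (g j)) ?gl//= eqxx big1_seq ?addr0// => z /andP[/eqP <-].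
by rewrite mem_rem_uniqF ?undup_uniq.
Qed.

Lemma finite_integral_norm (J : finType) (h : X -> J) (g : J -> Z) : finite_map h ->
  (\int[mu]_x (rnorm (g (h x)))%:E = (\sum_j fine (mu (h @^-1` [set j])) * rnorm (g j))%:E)%E.
Proof.
move=> mh; under eq_integral => x _.
  rewrite (_ : rnorm (g (h x)) = \sum_j rnorm (g j) * \1_(h @^-1` [set j]) x); last first.
    rewrite (bigD1 (h x))//= indicE mem_set//= mulr1 big1 ?addr0// => j jh.
    by rewrite indicE memNset ?mulr0//= => hx; rewrite hx eqxx in jh.
  rewrite -sumEFin.
  over.
rewrite ge0_integral_sum//; last 2 first.
- move=> j; apply/measurable_EFinP; apply: measurable_funM.
    exact: measurable_cst.
  exact: (measurable_indic (mh j)).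
- by move=> j x _; rewrite lee_fin mulr_ge0 ?rnorm_ge0.
rewrite -sumEFin; apply: eq_bigr => j _.
under eq_integral do rewrite EFinM.
rewrite ge0_integralZl_EFin ?rnorm_ge0//; last first.
  by apply/measurable_EFinP; exact: (measurable_indic (mh j)).
rewrite (integral_indic mu measurableT (mh j)).
by rewrite setIT EFinM (prob_fine (mh j)) muleC.
Qed.

Lemma simple_integral_norm (s : X -> Z) : simple_fun s ->
  ((rnorm (simple_integral mu s))%:E <= \int[mu]_x (rnorm (s x))%:E)%E.
Proof.
move=> /simple_funP[J [h [g [mh ->]]]].
rewrite simple_integralE// finite_integral_norm// lee_fin.
apply: le_trans (rnorm_sum _ _ _) _; apply: ler_sum => j _.
by rewrite rnormZ rnorm_complex ger0_norm// fine_ge0.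
Qed.

Lemma simple_pair (s t : X -> Z) : simple_fun s -> simple_fun t ->
  exists (J : finType) (h : X -> J) (g k : J -> Z), [/\ finite_map h, s = g \o h & t = k \o h].
Proof.
move=> /simple_funP[J [h [g [mh ->]]]] /simple_funP[J' [h' [g' [mh' ->]]]].
exists (J * J')%type, (fun x => (h x, h' x)), (g \o fst), (g' \o snd); split => //.
exact: finite_map_pair.
Qed.

Lemma simple_funD (s t : X -> Z) (a : R[i]) : simple_fun s -> simple_fun t ->
  simple_fun (fun x => a *: s x + t x).
Proof.
move=> ss /(simple_pair ss)[J [h [g [k [mh -> ->]]]]].
exact: (simple_finite_map (fun j => a *: g j + k j) mh).
Qed.

Lemma simple_integralD (s t : X -> Z) (a : R[i]) : simple_fun s -> simple_fun t ->
  simple_integral mu (fun x => a *: s x + t x) =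
  a *: simple_integral mu s + simple_integral mu t.
Proof.
move=> ss /(simple_pair ss)[J [h [g [k [mh -> ->]]]]].
have -> : (fun x => a *: (g \o h) x + (k \o h) x) = (fun j => a *: g j + k j) \o h by [].
rewrite !simple_integralE// /finite_integral scaler_sumr -big_split/=.
by apply: eq_bigr => j _; rewrite scalerDr !scalerA mulrC.
Qed.

Lemma simple_borel (s : X -> Z) : simple_fun s -> borel_map s.
Proof.
by move=> /simple_funP[J [h [g [mh ->]]]] U _; rewrite comp_preimage; exact: finite_map_preimage.
Qed.

Lemma borel_shift_simple (f s : X -> Z) (a : R[i]) : borel_map f -> simple_fun s ->
  borel_map (fun x => a *: f x + s x).
Proof.
move=> bf /simple_funP[J [h [g [mh ->]]]] U oU.
have -> : (fun x => a *: f x + (g \o h) x) @^-1` U =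
    \bigcup_(j in [set: J]) (h @^-1` [set j] `&` f @^-1` [set z | U (a *: z + g j)]).
  apply/seteqP; split=> x /=; first by move=> Ux; exists (h x).
  by move=> [j _ [/= ->]].
apply: fin_bigcup_measurable => // j _; apply: measurableI; first exact: mh.
apply: bf; apply/openP_rnorm => z /= Uz.
have [e e0 eU] := (openP_rnorm U).1 oU _ Uz.
have a0 : 0 < rnorm (a : R[i]^o) + 1 by rewrite ltr_wpDl// rnorm_ge0.
exists (e / (rnorm (a : R[i]^o) + 1)); first by rewrite divr_gt0.
move=> y zy; apply: eU; rewrite opprD addrACA subrr addr0 -scalerBr rnormZ.
apply: le_lt_trans (_ : (rnorm (a : R[i]^o) + 1) * rnorm (z - y) < _).
  by rewrite ler_wpM2r ?rnorm_ge0// lerDl.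
by rewrite mulrC -ltr_pdivlMr.
Qed.

Lemma measurable_rnorm (f : X -> Z) : borel_map f ->
  measurable_fun setT (fun x => rnorm (f x)).
Proof.
move=> bf; apply: real_measurability => r.
have -> : [set t | r < rnorm (f t)] = f @^-1` [set z | r < rnorm z] by [].
apply: bf; apply/openP_rnorm => z /= rz; exists (rnorm z - r); first by rewrite subr_gt0.
by move=> y; rewrite ltrBrDl => h; have := rnormB_le z y; lra.
Qed.

End SimpleFunctions.

(** * Borel maps into a separable space *)

Section Approximation.
Context {R : realType} {Z : normedModType R[i]} {d : measure_display}
  {X : measurableType d}.
Context (q : nat -> Z).
Hypothesis qP : dense_sequence q.
Hypothesis q0 : q 0%N = 0.

(* [s_ n] picks a nearest point among the first [n + 1] terms of a dense
   sequence starting with [0]. *)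
Lemma borel_simple_approx (f : X -> Z) : borel_map f -> exists s_ : nat -> X -> Z,
  [/\ forall n, simple_fun (s_ n), forall x, s_ n x @[n --> \oo] --> f x &
      forall n x, rnorm (f x - s_ n x) <= rnorm (f x)].
Proof.
move=> bf.
pose idx x := fix idx n := if n is m.+1 then
  (if rnorm (f x - q m.+1) < rnorm (f x - q (idx m)) then m.+1 else idx m) else 0%N.
have idx_le x n : (idx x n <= n)%N.
  by elim: n => //= n ih; case: ifP => // _; exact: leqW.
have idx_min x n i : (i <= n)%N -> rnorm (f x - q (idx x n)) <= rnorm (f x - q i).
  elim: n => [|n ih]; first by rewrite leqn0 => /eqP ->.
  rewrite leq_eqVlt => /predU1P[->|]; rewrite /=.
    by case: ltP => // /ltW.
  rewrite ltnS => /ih; case: ltP => // /ltW; exact: le_trans.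
have midx n k : measurable [set x | idx x n = k].
  elim: n k => [|n ih] k.
    have [<-|k0] := eqVneq 0%N k; first by rewrite (_ : [set _ | _] = setT)//; apply/seteqP; split.
    rewrite (_ : [set _ | _] = set0)//; apply/seteqP; split=> x //= h.
    by rewrite h eqxx in k0.
  pose M := \bigcup_j ([set x | idx x n = j] `&`
    f @^-1` [set z | rnorm (z - q n.+1) < rnorm (z - q j)]).
  have mM : measurable M.
    apply: bigcup_measurable => j _; apply: measurableI; first exact: ih.
    apply: bf; apply/openP_rnorm => z /= zj.
    exists ((rnorm (z - q j) - rnorm (z - q n.+1)) / 2).
      by rewrite divr_gt0// subr_gt0.
    move=> y zy; have := rnorm_triangle y z (q n.+1); have := rnorm_triangle z y (q j).
    by move: zy; rewrite (rnormB y z); lra.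
  have ME x : (rnorm (f x - q n.+1) < rnorm (f x - q (idx x n))) <-> M x.
    by split=> [h|[j _ [/= <-]]//]; exists (idx x n).
  have -> : [set x | idx x n.+1 = k] =
      (M `&` [set x | n.+1 = k]) `|` ([set x | idx x n = k] `\` M).
    apply/seteqP; split=> x /=.
      by case: ifPn => [/ME Mx ->|nM <-]; [left|right; split => // /ME; exact/negP].
    by move=> [[/ME -> ->]|[<- nM]] //; case: ifPn => // /ME.
  apply: measurableU; last exact: measurableD.
  apply: measurableI => //; have [<-|k0] := eqVneq n.+1 k.
    by rewrite (_ : [set _ | _] = setT)//; apply/seteqP; split.
  rewrite (_ : [set _ | _] = set0)//; apply/seteqP; split=> x //= h.
  by rewrite h eqxx in k0.
exists (fun n x => q (idx x n)); split.
- move=> n; pose h x : 'I_n.+1 := inord (idx x n).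
  have hE x : h x = idx x n :> nat by rewrite /h inordK// ltnS.
  have mh : finite_map h.
    move=> j; rewrite (_ : h @^-1` [set j] = [set x | idx x n = j]); first exact: midx.
    by apply/seteqP; split=> x /= => [<-|hx]; [rewrite hE|apply: ord_inj; rewrite hE].
  rewrite (_ : (fun x => _) = (fun j : 'I_n.+1 => q j) \o h); first exact: simple_finite_map.
  by apply/funext => x /=; rewrite hE.
- move=> x; apply/rcvgP => e e0; have [i qi] := qP (f x) e0.
  by exists i => // n /= ni; apply: le_lt_trans (idx_min x n i ni) qi.
- by move=> n x; have := idx_min x n 0%N (leq0n n); rewrite q0 subr0.
Qed.

(** Adding a simple function only needs finite unions of measurable sets; the general case follows
    by approximating [g] pointwise by simple functions. *)
Lemma borel_lin (f g : X -> Z) (a : R[i]) : borel_map f -> borel_map g ->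
  borel_map (fun x => a *: f x + g x).
Proof.
move=> bf /borel_simple_approx[s_ [ss sg _]].
apply: (@borel_map_cvg _ _ _ _ (fun n x => a *: f x + s_ n x)).
  by move=> n; exact: borel_shift_simple.
by move=> x; apply: cvgD; [exact: cvg_cst|exact: sg].
Qed.

Lemma borelB (f g : X -> Z) : borel_map f -> borel_map g -> borel_map (fun x => f x - g x).
Proof.
move=> bf bg; have := borel_lin (-1) bg bf.
by congr borel_map; apply/funext => x; rewrite scaleN1r addrC.
Qed.

Lemma borel_scale (p : X -> R[i]^o) (f : X -> Z) : borel_map p -> borel_map f ->
  borel_map (fun x => p x *: f x).
Proof.
move=> bp /borel_simple_approx[s_ [ss sf _]].
apply: (@borel_map_cvg _ _ _ _ (fun n x => p x *: s_ n x)); last first.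
  by move=> x; apply: cvgZr; exact: sf.
move=> n U oU; have [J [h [g [mh ->]]]] := simple_funP (ss n).
have -> : (fun x => p x *: (g \o h) x) @^-1` U =
    \bigcup_(j in [set: J]) (h @^-1` [set j] `&` p @^-1` [set a | U (a *: g j)]).
  apply/seteqP; split=> x /=; first by move=> Ux; exists (h x).
  by move=> [j _ [/= ->]].
apply: fin_bigcup_measurable => // j _; apply: measurableI; first exact: mh.
apply: bp; apply/openP_rnorm => z /= Uz.
have [e e0 eU] := (openP_rnorm U).1 oU _ Uz.
have a0 : 0 < rnorm (g j) + 1 by rewrite ltr_wpDl// rnorm_ge0.
exists (e / (rnorm (g j) + 1)); first by rewrite divr_gt0.
move=> y zy; apply: eU; rewrite -scalerBl rnormZ.
apply: le_lt_trans (_ : rnorm (z - y : R[i]^o) * (rnorm (g j) + 1) < _).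
  by rewrite ler_wpM2l ?rnorm_ge0// lerDl.
by rewrite -ltr_pdivlMr.
Qed.

End Approximation.

(** * The Bochner integral *)

Lemma ecvg0P {R : realType} (u : nat -> \bar R) : (forall n, (0 <= u n)%E) ->
  u n @[n --> \oo] --> 0%E <-> forall e : R, 0 < e -> \forall n \near \oo, (u n <= e%:E)%E.
Proof.
move=> u0; split=> [/fine_cvgP[ufin /cvgrPdist_lt uf] e /uf|h].
  move: ufin; apply: filterS2 => n un; rewrite sub0r normrN /= => un_e.
  by rewrite -(fineK un) lee_fin; apply: le_trans (ler_norm _) (ltW un_e).
have fin : \forall n \near \oo, u n \is a fin_num.
  have := h 1 ltr01; apply: filterS => n un1.
  by rewrite ge0_fin_numE// (le_lt_trans un1)// ltry.
apply/fine_cvgP; split => //; apply/cvgrPdist_lt => e e0.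
have e20 : 0 < e / 2 by rewrite divr_gt0.
move: fin (h _ e20); apply: filterS2 => n un une.
rewrite sub0r normrN /= ger0_norm ?fine_ge0//.
apply: le_lt_trans (_ : e / 2 < e); last by lra.
by rewrite -lee_fin fineK.
Qed.

Section Bochner.
Context {R : realType} {Z : normedModType R[i]} {d : measure_display}
  {X : measurableType d} (mu : probability X R).
Context (q : nat -> Z).
Hypothesis qP : dense_sequence q.
Hypothesis q0 : q 0%N = 0.
Implicit Types (f g : X -> Z) (v w : Z).

Notation bint := (is_bochner_integral mu).
Notation inorm f := (\int[mu]_x (rnorm (f x))%:E)%E.

Lemma inorm_ge0 f : (0 <= inorm f)%E.
Proof. by apply: integral_ge0 => x _; rewrite lee_fin rnorm_ge0. Qed.

Lemma inorm_triangle f g : borel_map f -> borel_map g ->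
  (inorm f <= inorm (fun x => f x - g x)%R + inorm g)%E.
Proof.
move=> bf bg; rewrite -ge0_integralD//; last 4 first.
- by move=> x _; rewrite lee_fin rnorm_ge0.
- by apply/measurable_EFinP; apply: measurable_rnorm; exact: (borelB qP q0).
- by move=> x _; rewrite lee_fin rnorm_ge0.
- by apply/measurable_EFinP; exact: measurable_rnorm.
apply: le_integral_ge0 => x; first by rewrite lee_fin rnorm_ge0.
by rewrite -EFinD lee_fin; apply: le_trans (rnormD _ _); rewrite subrK.
Qed.

Lemma bochner_ae_eq f g v : (\forall x \ae mu, f x = g x) -> bint f v -> bint g v.
Proof.
move=> fg [s_ [ss sf s0 sv]]; exists s_; split => //.
  by move: fg sf; apply: filterS2 => x <-.
rewrite (_ : (fun n => _) = (fun n => inorm (fun x => f x - s_ n x)%R))//.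
apply/funext => n; apply: ae_eq_integral_ge0.
- by move=> x; rewrite lee_fin rnorm_ge0.
- by move=> x; rewrite lee_fin rnorm_ge0.
- by move: fg; apply: filterS => x ->.
Qed.

(** True for simple functions, and stable under the limit that defines the integral. Applied to a
    difference, it makes the integral unique. *)
Lemma bochner_norm f v : borel_map f -> bint f v -> ((rnorm v)%:E <= inorm f)%E.
Proof.
move=> bf [s_ [ss sf s0 sv]]; apply/lee_addgt0Pr => e e0.
have e20 : 0 < e / 2 by rewrite divr_gt0.
have /ecvg0P := s0 => /(_ (fun n => inorm_ge0 _) _ e20)[N _ Ns].
have [N' _ Nv] := (rcvgP _ _).1 sv _ e20.
pose n := maxn N N'.
have h1 := Ns n (leq_maxl _ _); have h2 := Nv n (leq_maxr _ _).
have h3 := simple_integral_norm mu (ss n).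
have h4 : (inorm (s_ n) <= inorm (fun x => s_ n x - f x)%R + inorm f)%E.
  by apply: inorm_triangle => //; exact: simple_borel.
have h5 : inorm (fun x => s_ n x - f x)%R = inorm (fun x => f x - s_ n x)%R.
  by under eq_integral do rewrite rnormB.
apply: (@le_trans _ _ ((e / 2)%:E + (rnorm (simple_integral mu (s_ n)))%:E)%E).
  by rewrite -EFinD lee_fin; have := rnormB_le v (simple_integral mu (s_ n)); move: h2 => /=; lra.
rewrite [in leRHS](splitr e) EFinD addeA [leRHS]addeC.
apply: leeD => //; apply: le_trans h3 _; apply: le_trans h4 _.
by rewrite h5 addeC leeD.
Qed.

Lemma inorm_lin f g (a : R[i]) : borel_map f -> borel_map g ->
  (inorm (fun x => a *: f x + g x)%R <= (rnorm (a : R[i]^o))%:E * inorm f + inorm g)%E.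
Proof.
move=> bf bg; rewrite -ge0_integralZl_EFin ?rnorm_ge0//; last first.
- by apply/measurable_EFinP; exact: measurable_rnorm.
- by move=> x _; rewrite lee_fin rnorm_ge0.
rewrite -ge0_integralD//; last 4 first.
- by move=> x _; rewrite -EFinM lee_fin mulr_ge0 ?rnorm_ge0.
- apply/measurable_EFinP; apply: measurable_funM; first exact: measurable_cst.
  exact: measurable_rnorm.
- by move=> x _; rewrite lee_fin rnorm_ge0.
- by apply/measurable_EFinP; exact: measurable_rnorm.
apply: le_integral_ge0 => x; first by rewrite lee_fin rnorm_ge0.
by rewrite -EFinM -EFinD lee_fin -rnormZ rnormD.
Qed.

Lemma bochner_lin f g v w (a : R[i]) : borel_map f -> borel_map g -> bint f v -> bint g w ->
  bint (fun x => a *: f x + g x) (a *: v + w).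
Proof.
move=> bf bg [s_ [ss sf s0 sv]] [t_ [st tg t0 tw]].
exists (fun n x => a *: s_ n x + t_ n x); split.
- by move=> n; exact: simple_funD.
- by move: sf tg; apply: filterS2 => x h1 h2; apply: cvgD => //; exact: cvgZr.
- apply/ecvg0P => [n|e e0]; first exact: inorm_ge0.
  pose K := rnorm (a : R[i]^o) + 1.
  have K0 : 0 < K by rewrite ltr_wpDl// rnorm_ge0.
  have e1 : 0 < e / 2 / K by rewrite !divr_gt0.
  have e2 : 0 < e / 2 by rewrite divr_gt0.
  have /ecvg0P := s0 => /(_ (fun n => inorm_ge0 _) _ e1) h1.
  have /ecvg0P := t0 => /(_ (fun n => inorm_ge0 _) _ e2) h2.
  move: h1 h2; apply: filterS2 => n h1 h2.
  under eq_integral do rewrite opprD addrACA -scalerBr.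
  apply: le_trans (inorm_lin _ _ _) _.
  + by apply: (borelB qP q0) => //; exact: simple_borel.
  + by apply: (borelB qP q0) => //; exact: simple_borel.
  rewrite [in leRHS](splitr e) EFinD leeD//.
  apply: (@le_trans _ _ ((rnorm (a : R[i]^o))%:E * (e / 2 / K)%:E)%E).
    by rewrite lee_pmul ?lee_fin ?rnorm_ge0 ?inorm_ge0.
  rewrite -EFinM lee_fin mulrA ler_pdivrMr// mulrC ler_pM2l// lerDl//.
- under eq_fun do rewrite simple_integralD//.
  by apply: cvgD => //; exact: cvgZr.
Qed.

Lemma bochnerB f g v w : borel_map f -> borel_map g -> bint f v -> bint g w ->
  bint (fun x => f x - g x) (v - w).
Proof.
move=> bf bg fv gw; have := bochner_lin (-1) bg bf gw fv.
rewrite scaleN1r addrC; congr (bint _ _); apply/funext => x.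
by rewrite scaleN1r addrC.
Qed.

Lemma bochner_unique f v w : borel_map f -> bint f v -> bint f w -> v = w.
Proof.
move=> bf fv fw; apply/eqP; rewrite -subr_eq0; apply/eqP/rnorm_eq0/eqP.
rewrite eq_le rnorm_ge0 andbT -lee_fin.
apply: le_trans (bochner_norm _ (bochnerB bf bf fv fw)) _; first exact: (borelB qP q0).
by under eq_integral do rewrite subrr rnorm0; rewrite integral0.
Qed.

Lemma inorm_dominated (f_ : nat -> X -> Z) (G : X -> R) :
  (forall n, borel_map (f_ n)) -> mu.-integrable setT (EFin \o G) ->
  (forall n x, rnorm (f_ n x) <= G x) -> (\forall x \ae mu, f_ n x @[n --> \oo] --> (0 : Z)) ->
  inorm (f_ n) @[n --> \oo] --> 0%E.
Proof.
move=> bf iG fG f0.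
have [||||_ _] := @dominated_convergence _ X R mu setT measurableT
  (fun n x => (rnorm (f_ n x))%:E) (cst 0%E) (EFin \o G) _ _ _ iG.
- by move=> n; apply/measurable_EFinP; exact: measurable_rnorm.
- exact: measurable_cst.
- move: f0; apply: filterS => x /cvg_rnorm; rewrite rnorm0 => h _.
  by apply: cvg_EFin => //; apply: filterE.
- apply: filterE => x n _ /=; rewrite lee_fin ger0_norm ?rnorm_ge0//.
by rewrite integral0.
Qed.

Lemma integrable_rnorm f : borel_map f -> (inorm f < +oo)%E ->
  mu.-integrable setT (EFin \o (fun x => rnorm (f x))).
Proof.
move=> bf fi; apply/integrableP; split.
  by apply/measurable_EFinP; exact: measurable_rnorm.
by under eq_integral => x _ do rewrite /= ger0_norm ?rnorm_ge0//.
Qed.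

(** The approximants satisfy [|f - s_n| <= |f|], so dominated convergence applies and their
    integrals form a Cauchy sequence. Completeness is a hypothesis on sequences so that the lemma
    serves both [Z] and [R[i]^o]. *)
Lemma bochner_exists f :
  (forall u : nat -> Z, (forall e : R, 0 < e ->
     exists N, forall n, (N <= n)%N -> rnorm (u N - u n) <= e) -> cvgn u) ->
  borel_map f -> (inorm f < +oo)%E -> exists v, bint f v.
Proof.
move=> complete bf fi; have [s_ [ss sf sfle]] := borel_simple_approx qP q0 bf.
have s0 : inorm (fun x => f x - s_ n x)%R @[n --> \oo] --> 0%E.
  apply: (@inorm_dominated (fun n x => f x - s_ n x) (fun x => rnorm (f x))) => //.
  - by move=> n; apply: (borelB qP q0) => //; exact: simple_borel.
  - exact: integrable_rnorm.
  - apply: filterE => x; rewrite -(subrr (f x)); apply: cvgB => //; exact: cvg_cst.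
have cv : cvgn (fun n => simple_integral mu (s_ n)).
  apply: complete => e e0; have e2 : 0 < e / 2 by rewrite divr_gt0.
  have /ecvg0P := s0 => /(_ (fun n => inorm_ge0 _) _ e2)[N _ Ns].
  exists N => n Nn; rewrite -lee_fin.
  have -> : simple_integral mu (s_ N) - simple_integral mu (s_ n) =
      simple_integral mu (fun x => -1 *: s_ n x + s_ N x).
    by rewrite simple_integralD// scaleN1r addrC.
  apply: le_trans (simple_integral_norm _ (simple_funD _ (ss n) (ss N))) _.
  apply: (@le_trans _ _ (inorm (fun x => f x - s_ n x)%R + inorm (fun x => f x - s_ N x)%R)%E).
    have -> : inorm (fun x => -1 *: s_ n x + s_ N x)%R =
        inorm (fun x => -1 *: (f x - s_ N x) + (f x - s_ n x))%R.
      apply: eq_integral => x _; rewrite !scaleN1r opprB addrC addrA subrK.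
      by rewrite rnormB addrC; congr (rnorm _)%:E; rewrite opprB addrC.
    apply: le_trans (inorm_lin _ _ _) _.
    + by apply: (borelB qP q0) => //; exact: simple_borel.
    + by apply: (borelB qP q0) => //; exact: simple_borel.
    rewrite (_ : rnorm (-1 : R[i]^o) = 1) ?mul1e 1?addeC//.
    by rewrite rnormN (_ : 1 = 1%:C)// rnorm_complex normr1.
  rewrite [in leRHS](splitr e) EFinD; apply: leeD; first exact: Ns.
  exact: (Ns N (leqnn N)).
exists (lim (simple_integral mu (s_ n) @[n --> \oo])).
by exists s_; split => //; apply: filterE.
Qed.

Lemma bochner_integral_ae f g v : borel_map g -> (\forall x \ae mu, f x = g x) ->
  bint g v -> bochner_integral mu f = v.
Proof.
move=> bg fg gv.
have gf : \forall x \ae mu, g x = f x by move: fg; apply: filterS => x ->.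
have fv : bint f v by apply: bochner_ae_eq gv.
have : bint f (bochner_integral mu f) by apply: (xgetI 0 fv).
by move=> /(bochner_ae_eq fg) /(bochner_unique bg)/(_ gv).
Qed.

Lemma bochner_dominated (f_ : nat -> X -> Z) f (G : X -> R) (v_ : nat -> Z) v :
  (forall n, borel_map (f_ n)) -> borel_map f -> mu.-integrable setT (EFin \o G) ->
  (forall n x, rnorm (f_ n x - f x) <= G x) -> (\forall x \ae mu, f_ n x @[n --> \oo] --> f x) ->
  (forall n, bint (f_ n) (v_ n)) -> bint f v -> v_ n @[n --> \oo] --> v.
Proof.
move=> bf_ bf iG fG fcvg fv_ fv; apply/rcvgP => e e0.
have /ecvg0P : inorm (fun x => f_ n x - f x)%R @[n --> \oo] --> 0%E.
  apply: (@inorm_dominated (fun n x => f_ n x - f x) G) => //.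
    by move=> n; exact: (borelB qP q0).
  move: fcvg; apply: filterS => x h; rewrite -(subrr (f x)); apply: cvgB => //; exact: cvg_cst.
have e2 : 0 < e / 2 by rewrite divr_gt0.
move=> /(_ (fun n => inorm_ge0 _) _ e2); apply: filterS => n h.
rewrite rnormB; apply: le_lt_trans (_ : e / 2 < e); last by lra.
rewrite -lee_fin; apply: le_trans h.
by apply: bochner_norm (bochnerB (bf_ n) bf (fv_ n) fv); exact: (borelB qP q0).
Qed.

Lemma bochner_linear {W : normedModType R[i]} (A : {linear Z -> W}) f v :
  continuous A -> borel_map f -> bint f v ->
  is_bochner_integral mu (fun x => A (f x)) (A v).
Proof.
move=> cA bf [s_ [ss sf s0 sv]]; have [K K0 AK] := rnorm_bounded cA.
exists (fun n x => A (s_ n x)); split.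
- move=> n; have [J [h [g [mh ->]]]] := simple_funP (ss n).
  exact: (simple_finite_map (A \o g) mh).
- by move: sf; apply: filterS => x h; apply: continuous_cvg => //; exact: cA.
- apply/ecvg0P => [n|e e0]; first by apply: integral_ge0 => x _; rewrite lee_fin rnorm_ge0.
  have e1 : 0 < e / K by rewrite divr_gt0.
  have /ecvg0P := s0 => /(_ (fun n => inorm_ge0 _) _ e1); apply: filterS => n h.
  apply: (@le_trans _ _ (\int[mu]_x (K%:E * (rnorm (f x - s_ n x))%:E))%E).
    apply: le_integral_ge0 => x; first by rewrite lee_fin rnorm_ge0.
    by rewrite -linearB -EFinM lee_fin.
  rewrite ge0_integralZl_EFin ?(ltW K0)//; last first.
  + apply/measurable_EFinP; apply: measurable_rnorm; apply: (borelB qP q0) => //.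
    exact: simple_borel.
  + by move=> x _; rewrite lee_fin rnorm_ge0.
  apply: (@le_trans _ _ (K%:E * (e / K)%:E)%E).
    by rewrite lee_pmul2l// lte_fin.
  by rewrite -EFinM lee_fin mulrC divfK// gt_eqF.
- have AE n : simple_integral mu (fun x => A (s_ n x)) = A (simple_integral mu (s_ n)).
    have [J [h [g [mh ->]]]] := simple_funP (ss n).
    rewrite (_ : (fun x => _) = (A \o g) \o h)// !simple_integralE// /finite_integral.
    by rewrite linear_sum; apply: eq_bigr => j _; rewrite linearZ.
  under eq_fun do rewrite AE.
  by apply: continuous_cvg => //; exact: cA.
Qed.

End Bochner.

(** * Complex scalars and powers on the circle *)

Section ComplexScalars.
Context {R : realType}.
Implicit Types (z w : R[i]).

Lemma rnorm_ReIm z : rnorm (z : R[i]^o) <= `|complex.Re z| + `|complex.Im z|.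
Proof.
case: z => a b; rewrite (_ : a +i* b = a%:C + 'i%C * b%:C); last by simpc.
apply: le_trans (rnormD _ _) _; rewrite rnorm_complex.
have -> : rnorm ('i%C * b%:C : R[i]^o) = `|b|.
  rewrite (rnormZ ('i%C) (b%:C : R[i]^o)) rnorm_complex.
  by rewrite /rnorm normc_def/= expr0n/= add0r expr1n sqrtr1 mul1r.
by simpc.
Qed.

Lemma complex_complete (u : nat -> R[i]^o) :
  (forall e : R, 0 < e -> exists N, forall n, (N <= n)%N -> rnorm (u N - u n) <= e) -> cvgn u.
Proof.
move=> uc.
have part (p : R[i] -> R) : (forall z w, `|p z - p w| <= rnorm (z - w : R[i]^o)) ->
    cvgn (p \o u).
  move=> pl; apply: cauchy_cvg; apply: cauchy_exP => e e0.
  have [|N Nu] := uc (e / 2); first by rewrite divr_gt0.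
  exists (p (u N)); exists N => // n /= Nn; rewrite -ball_normE/=.
  by apply: le_lt_trans (pl _ _) _; apply: le_lt_trans (Nu n Nn) _; lra.
have /cvg_ex[a /= /cvgrPdist_lt ua] : cvgn (@complex.Re R \o u).
  by apply: part => z w; rewrite -raddfB; exact: normr_Re.
have /cvg_ex[b /= /cvgrPdist_lt ub] : cvgn (@complex.Im R \o u).
  by apply: part => z w; rewrite -raddfB; exact: normr_Im.
apply/cvg_ex; exists (a +i* b); apply/rcvgP => e e0.
have e2 : 0 < e / 2 by rewrite divr_gt0.
move: (ua _ e2) (ub _ e2); apply: filterS2 => n h1 h2.
apply: le_lt_trans (rnorm_ReIm _) _; rewrite [ltRHS]splitr.
by apply: ltrD; rewrite raddfB; [exact: h1|exact: h2].
Qed.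

Lemma complex_dense : exists q : nat -> R[i]^o, q 0%N = 0 /\ dense_sequence q.
Proof.
exists (fun n => if n is m.+1 then (if unpickle m is Some (a, b)
  then (ratr (a : rat) +i* ratr (b : rat)) else 0) else 0); split => // z e e0.
have near_rat (x : R) : exists a : rat, `|x - ratr a| < e / 2.
  have [|a] := @rat_in_itvoo R x (x + e / 2); first by rewrite ltrDl divr_gt0.
  rewrite in_itv/= => /andP[xa ax]; exists a.
  by rewrite ltr0_norm ?subr_lt0// opprB ltrBlDl.
have [a za] := near_rat (complex.Re z); have [b zb] := near_rat (complex.Im z).
exists (pickle (a, b)).+1; rewrite pickleK; apply: le_lt_trans (rnorm_ReIm _) _.
rewrite [ltRHS]splitr; case: z za zb => x y /= xa yb; exact: ltrD.
Qed.

Lemma lipschitz_borel (f : R[i] -> R[i]) :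
  (forall z w, rnorm (f z - f w : R[i]^o) <= rnorm (z - w : R[i]^o)) ->
  borel_map (f : Cborel R -> R[i]^o).
Proof.
move=> fl U oU; apply: sub_gen_smallest.
apply/openP_rnorm => z /= Uz; have [e e0 eU] := (openP_rnorm U).1 oU _ Uz.
by exists e => // y zy; apply: eU; apply: le_lt_trans (fl z y) zy.
Qed.

Lemma borel_mul {d} {X : measurableType d} (f g : X -> R[i]^o) : borel_map f -> borel_map g ->
  borel_map (fun x => f x * g x : R[i]^o).
Proof.
move=> bf bg; have [q [q0 qP]] := complex_dense.
exact: (borel_scale qP q0 bf bg).
Qed.

Lemma borel_exp {d} {X : measurableType d} (f : X -> R[i]^o) n : borel_map f ->
  borel_map (fun x => f x ^+ n : R[i]^o).
Proof.
move=> bf; elim: n => [|n ih].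
  by rewrite (_ : (fun x => _) = fun=> (1 : R[i]^o))//; exact: borel_map_cst.
rewrite (_ : (fun x => _) = fun x => f x * f x ^+ n : R[i]^o).
  exact: borel_mul.
by apply/funext => x; rewrite exprS.
Qed.

Lemma measurable_circle : measurable (circle : set (Cborel R)).
Proof.
rewrite -[circle]setCK; apply: measurableC; apply: sub_gen_smallest.
apply/(@openP_rnorm R R[i]^o) => z /= zC.
have r1 : rnorm (z : R[i]^o) - 1 != 0.
  rewrite subr_eq0; apply/eqP => h; apply: zC.
  by rewrite /circle /= (rnormE (z : R[i]^o)) h.
exists `|rnorm (z : R[i]^o) - 1|; first by rewrite normr_gt0.
move=> y zy yC; move: zy; apply/negP; rewrite -leNgt.
have <- : rnorm (y : R[i]^o) = 1 by rewrite /rnorm (yC : `|y| = 1).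
rewrite ler_norml; have := rnormB_le (z : R[i]^o) y; have := rnormB_le (y : R[i]^o) z.
by rewrite (rnormB (y : R[i]^o) z) => h1 h2; apply/andP; split; lra.
Qed.

(** Extension by 0 off the circle makes all powers bounded Borel maps on the plane; almost
    everywhere nothing changes. *)
Definition cpow (m : int) (l : Cborel R) : R[i]^o := if l \in circle then (l : R[i]) ^ m else 0.

Lemma circle_neq0 (l : R[i]) : circle l -> l != 0.
Proof. by move=> cl; rewrite -normr_eq0 (cl : `|l| = 1) oner_eq0. Qed.

Lemma circle_conj (l : R[i]) : circle l -> l^-1 = l^*%C.
Proof. by move=> cl; rewrite invc_norm (cl : `|l| = 1) expr1n invr1 mul1r. Qed.

Lemma borel_id : borel_map (id : Cborel R -> R[i]^o).
Proof. exact: (@lipschitz_borel id). Qed.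

Lemma borel_conj : borel_map ((fun z => z^*%C) : Cborel R -> R[i]^o).
Proof. by apply: lipschitz_borel => z w; rewrite -rmorphB /rnorm normcJ. Qed.

(** On the circle the inverse is the conjugate, which is Lipschitz on the whole plane. *)
Lemma borel_cpow m : borel_map (cpow m).
Proof.
pose f (l : Cborel R) : R[i]^o := if m is Posz k then l ^+ k else (l : R[i])^*%C ^+ `|m|%N.
have bf : borel_map f.
  by rewrite /f; case: (m) => k; apply: borel_exp; [exact: borel_id|exact: borel_conj].
rewrite (_ : cpow m = fun l => if l \in circle then f l else 0).
  by apply: borel_map_if => //; [exact: measurable_circle|exact: borel_map_cst].
apply/funext => l; rewrite /cpow; case: ifPn => // /set_mem cl.
rewrite /f; case: (m) => k; first by rewrite -exprnP.
by rewrite NegzE -exprnN -exprVn circle_conj.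
Qed.

Lemma cpowM m n l : cpow m l * cpow n l = cpow (m + n) l.
Proof.
rewrite /cpow; case: ifPn => [/set_mem cl|_]; last by rewrite mul0r.
by rewrite expfzDr// circle_neq0.
Qed.

Lemma cpow_le1 m l : rnorm (cpow m l) <= 1.
Proof.
rewrite /cpow; case: ifPn => [/set_mem cl|_]; last by rewrite rnorm0.
have h : `|(l : R[i]) ^ m| = 1.
  case: m => k; first by rewrite -exprnP normrX (cl : `|l| = 1) expr1n.
  by rewrite NegzE -exprnN normfV normrX (cl : `|l| = 1) expr1n invr1.
by rewrite /rnorm h.
Qed.

#[global] Instance ae_filter_circle :
  Filter (nbhs (almost_everywhere (@circle_measure R))).
Proof. exact: ae_filter_ringOfSetsType. Qed.

Lemma ae_circle : \forall l \ae (@circle_measure R), circle l.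
Proof.
exists (~` circle); split => //; first by apply: measurableC; exact: measurable_circle.
rewrite /circle_measure /= /distribution /pushforward.
rewrite (_ : _ @^-1` _ = set0) ?measure0//.
apply/seteqP; split=> t //=; apply; rewrite /circle/= normc_def/=.
by rewrite cos2Dsin2 sqrtr1.
Qed.

End ComplexScalars.

(** * Bochner integrals of scalar functions *)

Section ScalarBochner.
Context {R : realType} {d : measure_display} {X : measurableType d} (mu : probability X R).

Lemma integral_finite_map (J : finType) (h : X -> J) (g : J -> R) : finite_map h ->
  mu.-integrable setT (fun x => (g (h x))%:E) /\
  (\int[mu]_x (g (h x))%:E = (\sum_j fine (mu (h @^-1` [set j])) * g j)%:E)%E.
Proof.
move=> mh; have gE x : (g (h x))%:E = (\sum_j (g j)%:E * (\1_(h @^-1` [set j]) x)%:E)%E.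
  rewrite (bigD1 (h x))//= indicE mem_set//= mule1 big1 ?adde0// => j jh.
  by rewrite indicE memNset ?mule0//= => hx; rewrite hx eqxx in jh.
have ii j : mu.-integrable setT (fun x => ((g j)%:E * (\1_(h @^-1` [set j]) x)%:E)%E).
  by apply: integrableZl => //; apply: integrable_indic => //; exact: mh.
split; first by under [X in _.-integrable _ X]eq_fun do rewrite gE; exact: integrable_sum.
under eq_integral do rewrite gE.
rewrite integral_sum// -sumEFin; apply: eq_bigr => j _.
rewrite integralZl//; last by apply: integrable_indic => //; exact: mh.
rewrite (integral_indic mu measurableT (mh j)) setIT.
by rewrite EFinM (prob_fine mu (mh j)) muleC.
Qed.

(** The bridge to Lebesgue integrals, which the fundamental theorem of calculus can evaluate. *)
Lemma bochner_Re (f : X -> R[i]^o) (v : R[i]^o) : borel_map f ->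
  (\int[mu]_x (rnorm (f x))%:E < +oo)%E -> is_bochner_integral mu f v ->
  (\int[mu]_x (complex.Re (f x))%:E = (complex.Re v)%:E)%E.
Proof.
move=> bf fi [s_ [ss sf s0 sv]].
have [q [q0 qP]] := @complex_dense R.
have mRe (g : X -> R[i]^o) : borel_map g -> measurable_fun setT (fun x => complex.Re (g x)).
  move=> bg; apply: real_measurability => r.
  have -> : [set t | r < complex.Re (g t)] = g @^-1` [set z | r < complex.Re z] by [].
  apply: bg; apply/openP_rnorm => z /= rz; exists (complex.Re z - r); first by rewrite subr_gt0.
  move=> y zy; have := le_lt_trans (normr_Re (z - y)) zy; rewrite raddfB/=.
  by move=> /(le_lt_trans (ler_norm _)); lra.
have iRe : mu.-integrable setT (fun x => (complex.Re (f x))%:E).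
  apply/integrableP; split; first by apply/measurable_EFinP; exact: mRe.
  apply: le_lt_trans fi; apply: le_integral_ge0 => x; first exact: abse_ge0.
  by rewrite lee_fin normr_Re.
have fin := integrable_fin_num measurableT iRe.
set I := (\int[mu]_x _)%E in fin *; rewrite -(fineK fin); congr EFin.
apply/eqP; rewrite -subr_eq0 -normr_le0; apply/ler_addgt0Pr => e e0; rewrite add0r.
have e2 : 0 < e / 2 by rewrite divr_gt0.
have /ecvg0P := s0 => /(_ (fun n => inorm_ge0 _ _) _ e2)[N _ Ns].
have [N' _ Nv] := (rcvgP _ _).1 sv _ e2.
pose n := maxn N N'.
have h1 := Ns n (leq_maxl _ _); have h2 := Nv n (leq_maxr _ _).
have [J [h [g [mh sE]]]] := simple_funP (ss n).
have [ig gE] := integral_finite_map (fun j => complex.Re (g j)) mh.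
have sintE : complex.Re (simple_integral mu (s_ n)) =
    \sum_j fine (mu (h @^-1` [set j])) * complex.Re (g j).
  rewrite sE simple_integralE// /finite_integral raddf_sum; apply: eq_bigr => j _.
  by case: (g j) => a b /=; rewrite mul0r subr0.
have h3 : `|fine I - complex.Re (simple_integral mu (s_ n))| <= e / 2.
  rewrite -lee_fin; apply: le_trans h1.
  have -> : (`|fine I - complex.Re (simple_integral mu (s_ n))|%:E =
      `|I - (complex.Re (simple_integral mu (s_ n)))%:E|)%E.
    by rewrite -{2}(fineK fin).
  rewrite sintE -gE /I -integralB_EFin//.
  apply: le_trans (le_abse_integral _ _ _) _ => //.
    apply/measurable_EFinP; apply: measurable_funB; first exact: mRe.
    by have := measurable_int _ ig => /measurable_EFinP.
  apply: le_integral_ge0 => x; first exact: abse_ge0.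
  rewrite sE /= lee_fin; apply: le_trans (normr_Re _).
  by rewrite raddfB.
have h4 : `|complex.Re v - complex.Re (simple_integral mu (s_ n))| <= e / 2.
  by rewrite -raddfB; apply: le_trans (normr_Re _) (ltW h2).
rewrite [leRHS]splitr.
rewrite (_ : fine I - complex.Re v = (fine I - complex.Re (simple_integral mu (s_ n))) -
  (complex.Re v - complex.Re (simple_integral mu (s_ n)))); last by ring.
by apply: le_trans (ler_normB _ _) _; exact: lerD.
Qed.

Lemma bochner_cst {Z : normedModType R[i]} (z : Z) : is_bochner_integral mu (fun=> z) z.
Proof.
have mh : finite_map (fun _ : X => tt).
  by move=> []; rewrite (_ : _ @^-1` _ = setT)//; apply/seteqP; split.
exists (fun n x => z); split.
- by move=> n; exact: (simple_finite_map (fun=> z) mh).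
- by apply: filterE => x; exact: cvg_cst.
- rewrite (_ : (fun n => _) = fun=> 0%E); first exact: cvg_cst.
  by apply/funext => n; under eq_integral do rewrite subrr rnorm0; rewrite integral0.
- rewrite (_ : (fun n => _) = fun=> z); first exact: cvg_cst.
  apply/funext => n; rewrite -[X in simple_integral _ X]/((fun=> z) \o (fun _ : X => tt)).
  rewrite simple_integralE// /finite_integral.
  rewrite (eq_bigl (pred1 tt)); last by case.
  rewrite big_pred1_eq (_ : _ @^-1` _ = setT); last by apply/seteqP; split.
  by rewrite probability_setT scale1r.
Qed.

End ScalarBochner.

(** * Orthogonality of the powers on the circle *)

Lemma bounded_inorm {R : realType} {Z : normedModType R[i]} {d} {X : measurableType d}
    (mu : probability X R) (f : X -> Z) (M : R) : (forall x, rnorm (f x) <= M) ->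
  (\int[mu]_x (rnorm (f x))%:E < +oo)%E.
Proof.
move=> fM; apply: (@le_lt_trans _ _ (\int[mu]_x (cst M%:E) x)%E).
  by apply: le_integral_ge0 => x; rewrite lee_fin ?rnorm_ge0.
have mu1 : mu setT = 1%E by exact: probability_setT.
have -> : (\int[mu]_x (cst M%:E) x = M%:E * mu setT)%E by exact: integral_cst.
by rewrite mu1 mule1 ltry.
Qed.

Section CircleOrthogonality.
Context {R : realType}.
Notation mu := (@circle_measure R).
Notation U01 := (uniform01 R).

Lemma de_moivre (t : R) (k : nat) :
  (cos t +i* sin t) ^+ k = cos (k%:R * t) +i* sin (k%:R * t) :> R[i].
Proof.
elim: k => [|k ih]; first by rewrite expr0 mul0r cos0 sin0.
rewrite exprS ih -natr1 mulrDl mul1r addrC cosD sinD; simpc.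
by congr (_ +i* _); rewrite addrC.
Qed.

Lemma circle_param_circle (t : R) : circle (circle_param t : R[i]).
Proof. by rewrite /circle/= normc_def/= cos2Dsin2 sqrtr1. Qed.

Lemma cpow_param (m : int) (t : R) : cpow m (circle_param t) =
  cos (2 * pi * m%:~R * t) +i* sin (2 * pi * m%:~R * t).
Proof.
have cl := circle_param_circle t; rewrite /cpow mem_set//.
case: m => k.
  rewrite -exprnP /circle_param de_moivre; congr (cos _ +i* sin _); rewrite -pmulrn; ring.
rewrite NegzE -exprnN -exprVn circle_conj// /circle_param /= -sinN -cosN de_moivre.
by rewrite mulrNz -pmulrn; congr (cos _ +i* sin _); ring.
Qed.

Lemma integral_uniform_derive (f F : R -> R) : (forall t, 0 <= f t) -> continuous f ->
  (forall t : R, is_derive t 1 F (f t)) -> (\int[U01]_t (f t)%:E = (F 1 - F 0)%:E)%E.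
Proof.
move=> f0 cf dF.
have mf : measurable_fun setT (fun t : measurableTypeR R => (f t)%:E).
  by apply: measurableT_comp => //; exact: continuous_measurable_fun.
have fe0 t : (0 <= (f t)%:E)%E by rewrite lee_fin.
rewrite /uniform01 (integral_uniform _ mf fe0).
rewrite subr0 invr1 mul1e (@continuous_FTC2 _ f F 0 1)// ?ltr01//.
- exact: continuous_subspaceT.
- have cF t : {for t, continuous F}.
    by apply: differentiable_continuous; apply/derivable1_diffP; exact: ex_derive.
  split; first by move=> t _; exact: ex_derive.
  + by apply: cvg_at_right_filter; exact: cF.
  + by apply: cvg_at_left_filter; exact: cF.
- by move=> t _; rewrite derive1E derive_val.
Qed.

Lemma integral_circle_ge0 (f : Cborel R -> R) : measurable_fun setT f -> (forall l, 0 <= f l) ->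
  (\int[mu]_l (f l)%:E = \int[U01]_t (f (circle_param t))%:E)%E.
Proof.
move=> mf f0; rewrite /circle_measure /distribution /=.
rewrite ge0_integral_pushforward//; first by apply/measurable_EFinP.
by move=> l _; rewrite lee_fin.
Qed.

(** The integral [v] exists by boundedness. The real parts of [v] and of [- 'i%C * v] are integrals
    over [[0, 1]] of a cosine and of a sine with explicit primitives. *)
Lemma bochner_cpow (m : int) : m != 0 -> is_bochner_integral mu (cpow m) (0 : R[i]^o).
Proof.
move=> m0; have [q [q0 qP]] := @complex_dense R.
pose w : R := 2 * pi * m%:~R.
have w0 : w != 0 by rewrite /w !mulf_neq0// ?intr_eq0// gt_eqF// pi_gt0.
have [cosw sinw] : cos w = 1 /\ sin w = 0.
  have : cpow m (circle_param (1 : R)) = 1.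
    have -> : circle_param (1 : R) = 1 :> R[i].
      by rewrite /circle_param mulr1 mulrC mulr_natr cos2pi sin2pi.
    rewrite /cpow exp1rz mem_set//.
    by have := @circle_param_circle 1; rewrite /circle_param mulr1 mulrC mulr_natr cos2pi sin2pi.
  by rewrite cpow_param mulr1 -/w => -[-> ->].
have fin := @bounded_inorm R R[i]^o _ _ mu.
have fc : (\int[mu]_l (rnorm (cpow m l))%:E < +oo)%E by apply: (fin _ 1) => l; exact: cpow_le1.
have [v cv] := @bochner_exists R R[i]^o _ _ mu q qP q0 _ (@complex_complete R) (borel_cpow m) fc.
have b1 : borel_map (fun _ : Cborel R => (1 : R[i]^o)) by exact: borel_map_cst.
(* The added 1 makes the integrand nonnegative, as the change of variables to [[0, 1]] requires; it
   accounts for the whole of [F 1 - F 0 = 1]. *)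
have part (al : R[i]) (f F : R -> R) : rnorm (al : R[i]^o) <= 1 -> F 1 - F 0 = 1 ->
    (forall t, complex.Re (al *: cpow m (circle_param t) + 1) = f t) -> continuous f ->
    (forall t : R, is_derive t 1 F (f t)) -> complex.Re (al * v) = 0.
  move=> al1 F10 fE cf dF.
  have bf := borel_lin qP q0 al (borel_cpow m) b1.
  have fb := bochner_lin qP q0 al (borel_cpow m) b1 cv (bochner_cst mu (1 : R[i]^o)).
  have le1 l : rnorm (al *: cpow m l) <= 1.
    by rewrite rnormZ mulr_ile1 ?rnorm_ge0// cpow_le1.
  have ff : (\int[mu]_l (rnorm (al *: cpow m l + 1))%:E < +oo)%E.
    apply: (fin _ (1 + rnorm (1 : R[i]^o))) => l.
    by apply: le_trans (rnormD _ _) _; rewrite lerD2r.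
  have := bochner_Re bf ff fb.
  have ge0 l : 0 <= complex.Re (al *: cpow m l + 1).
    rewrite raddfD /=; have := le_trans (normr_Re _) (le1 l).
    by rewrite ler_norml => /andP[]; lra.
  rewrite integral_circle_ge0//; last first.
    apply: real_measurability => r.
    apply: (bf [set z | r < complex.Re z]); apply/openP_rnorm => z /= rz.
    exists (complex.Re z - r); first by rewrite subr_gt0.
    move=> y zy; have := le_lt_trans (normr_Re (z - y)) zy; rewrite raddfB/=.
    by move=> /(le_lt_trans (ler_norm _)); lra.
  under eq_integral do rewrite fE.
  rewrite (@integral_uniform_derive f F)//; last by move=> t; rewrite -fE.
  by rewrite F10 => -[]; rewrite raddfD /= => /esym/eqP; rewrite -subr_eq0 addrK => /eqP.
have dw (t : R) : is_derive t 1 (fun s : R => w * s) w.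
  by apply: is_derive_eq; rewrite /GRing.scale/= mulr1.
have cw (g : R -> R) : continuous g -> continuous (fun t => g (w * t)).
  move=> cg t; apply: (@continuous_comp _ _ _ (fun t => w * t) g); last exact: cg.
  by apply: cvgM; [exact: cvg_cst | exact: cvg_id].
have Rev : complex.Re v = 0.
  rewrite -[v]mul1r.
  apply: (part 1 (fun t => cos (w * t) + 1) (fun t => t + w^-1 * sin (w * t))).
  - by rewrite (_ : 1 = 1%:C)// rnorm_complex normr1.
  - by rewrite mulr1 mulr0 sinw sin0 !mulr0 !addr0 subr0.
  - by move=> t; rewrite scale1r cpow_param -/w raddfD.
  - by move=> t; apply: cvgD; [apply: cw; exact: continuous_cos | exact: cvg_cst].
  - move=> t; have ds := is_derive1_comp (is_derive_sin (w * t)) (dw t).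
    by apply: is_derive_eq; rewrite /GRing.scale/= addrC; congr (_ + _); field.
have Imv : complex.Re (- 'i%C * v) = 0.
  apply: (part _ (fun t => sin (w * t) + 1) (fun t => t - w^-1 * cos (w * t))).
  - by rewrite rnormN /rnorm normc_def/= expr0n/= add0r expr1n sqrtr1.
  - by rewrite mulr1 mulr0 cosw cos0; lra.
  - move=> t; rewrite cpow_param -/w raddfD; congr (_ + _).
    by rewrite /GRing.scale/=; simpc.
  - by move=> t; apply: cvgD; [apply: cw; exact: continuous_sin | exact: cvg_cst].
  - move=> t; have ds := is_derive1_comp (is_derive_cos (w * t)) (dw t).
    by apply: is_derive_eq; rewrite /GRing.scale/= addrC; congr (_ + _); field.
suff -> : (0 : R[i]^o) = v by [].
apply/esym; move: Rev Imv; case: (v) => x y /= -> ; simpc => ->.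
by [].
Qed.

End CircleOrthogonality.

(** * Density of the span of the Fourier coefficients *)

Section Density.
Context {R : realType} {Z : completeNormedModType R[i]}.
Context (q : nat -> Z).
Hypothesis qP : dense_sequence q.
Hypothesis q0 : q 0%N = 0.
Notation mu := (@circle_measure R).
Notation inorm f := (\int[mu]_x (rnorm (f x))%:E)%E.
Context (E : Cborel R -> Z) (c : int -> Z).
Hypotheses (bE : borel_map E) (iE : (inorm E < +oo)%E).
Hypothesis cE : forall n, is_bochner_integral mu (fun l => cpow (- n) l *: E l) (c n).
Hypothesis uc : unconditionally_cauchy c.

Lemma closed_span_lin (a : R[i]) z w : closed_span c z -> closed_span c w ->
  closed_span c (a *: z + w).
Proof.
move=> Wz Ww e e0; pose K := rnorm (a : R[i]^o) + 1.
have K0 : 0 < K by rewrite ltr_wpDl// rnorm_ge0.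
have [|b [N [bN zb]]] := Wz (e / 2 / K); first by rewrite !divr_gt0.
have [|b' [N' [bN' wb]]] := Ww (e / 2); first by rewrite divr_gt0.
exists (fun n => a * b n + b' n), (maxn N N'); split.
  by move=> n; rewrite gtn_max => /andP[h1 h2]; rewrite bN// bN'// mulr0 addr0.
have [M bM] := finite_bounded bN; have [M' bM'] := finite_bounded bN'.
have abM : bounded_by (rnorm (a : R[i]^o) * M) (fun n => a * b n).
  by move=> n; rewrite (rnormZ a (b n : R[i]^o)) ler_wpM2l ?rnorm_ge0.
rewrite (bilateral_sumD uc abM bM') (bilateral_sumZ uc a bM) opprD addrACA -scalerBr.
apply: le_lt_trans (rnormD _ _) _; rewrite [ltRHS]splitr; apply: ler_ltD => //.
rewrite rnormZ; apply: (@le_trans _ _ (rnorm (a : R[i]^o) * (e / 2 / K))).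
  by rewrite ler_wpM2l ?rnorm_ge0// ltW.
by rewrite mulrA ler_pdivrMr// mulrC ler_pM2l ?divr_gt0// lerDl.
Qed.

Lemma closed_span_cvg (u : nat -> Z) z : (forall n, closed_span c (u n)) ->
  u n @[n --> \oo] --> z -> closed_span c z.
Proof.
move=> Wu /rcvgP uz e e0; have e2 : 0 < e / 2 by rewrite divr_gt0.
have [N _ Nu] := uz _ e2; have [b [m [bm ub]]] := Wu N _ e2.
exists b, m; split => //; apply: le_lt_trans (rnorm_triangle _ (u N) _) _.
by rewrite [ltRHS]splitr ltrD// Nu/=.
Qed.

Lemma closed_span_c n : closed_span c (c n).
Proof.
move=> e e0; exists (fun k => if k == n then 1 else 0), `|n|%N; split.
  by move=> k; case: eqP => // ->; rewrite ltnn.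
rewrite (@bilateral_sum_fin _ _ _ [:: n])//; last by move=> k; rewrite inE => /negbTE ->.
by rewrite big_seq1 eqxx scale1r subrr rnorm0.
Qed.

Lemma closed_span0 : closed_span c 0.
Proof.
have := closed_span_lin (-1) (closed_span_c 0) (closed_span_c 0).
by rewrite scaleN1r addNr.
Qed.

Let bscale (phi : Cborel R -> R[i]^o) : borel_map phi -> borel_map (fun l => phi l *: E l).
Proof. by move=> bphi; exact: (borel_scale qP q0). Qed.

Lemma bochner_multiplier (phi : Cborel R -> R[i]^o) (M : R) : borel_map phi ->
  (forall l, rnorm (phi l) <= M) -> exists v, is_bochner_integral mu (fun l => phi l *: E l) v.
Proof.
move=> bphi phiM; apply: (bochner_exists qP q0 (@rcauchy_cvg _ Z)); first exact: bscale.
have M0 : 0 <= M by apply: le_trans (phiM 0); exact: rnorm_ge0.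
apply: (@le_lt_trans _ _ (\int[mu]_l (M%:E * (rnorm (E l))%:E))%E).
  apply: le_integral_ge0 => l; first by rewrite lee_fin rnorm_ge0.
  by rewrite -EFinM lee_fin rnormZ ler_wpM2r// rnorm_ge0.
rewrite ge0_integralZl_EFin//; last 2 first.
- by move=> x _; rewrite lee_fin rnorm_ge0.
- by apply/measurable_EFinP; exact: measurable_rnorm.
by rewrite lte_mul_pinfty// ?lee_fin// ge0_fin_numE// inorm_ge0.
Qed.

Definition bounded_fun (phi : Cborel R -> R[i]^o) := exists M : R, forall l, rnorm (phi l) <= M.

(** Quantifying over [n] makes the class stable under multiplication by the [cpow k]; the case
    [n = 0] is the one wanted in the end. *)
Definition good (phi : Cborel R -> R[i]^o) := [/\ borel_map phi, bounded_fun phi &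
  forall n v, is_bochner_integral mu (fun l => (cpow n l * phi l) *: E l) v -> closed_span c v].

Let borel_cpow_mul n (phi : Cborel R -> R[i]^o) : borel_map phi ->
  borel_map (fun l => cpow n l * phi l : R[i]^o).
Proof. by move=> bphi; apply: borel_mul => //; exact: borel_cpow. Qed.

Let cpow_mul_le n (phi : Cborel R -> R[i]^o) (M : R) l : rnorm (phi l) <= M ->
  rnorm (cpow n l * phi l : R[i]^o) <= M.
Proof.
move=> phiM; rewrite (rnormZ (cpow n l) (phi l)).
apply: le_trans phiM; rewrite ler_piMl ?rnorm_ge0// cpow_le1//.
Qed.

Lemma good1 : good (fun=> 1).
Proof.
split; [exact: borel_map_cst|by exists (rnorm (1 : R[i]^o))|].
move=> n v h; suff -> : v = c (- n) by exact: closed_span_c.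
apply: (bochner_unique qP q0 _ h).
  by apply: bscale; apply: borel_cpow_mul; exact: borel_map_cst.
have := cE (- n); rewrite opprK; congr (is_bochner_integral _ _ _).
by apply/funext => l; rewrite mulr1.
Qed.

Lemma good_lin (a : R[i]) phi psi : good phi -> good psi ->
  good (fun l => a * phi l + psi l).
Proof.
move=> [b1 [M1 h1] W1] [b2 [M2 h2] W2]; have [qc [qc0 qcP]] := @complex_dense R.
split; first exact: (borel_lin qcP qc0 a b1 b2).
  exists (rnorm (a : R[i]^o) * M1 + M2) => l; apply: le_trans (rnormD _ _) _.
  by rewrite lerD// (rnormZ a (phi l)) ler_wpM2l ?rnorm_ge0.
move=> n v h.
have [v1 hv1] := bochner_multiplier (borel_cpow_mul n b1) (fun l => cpow_mul_le n (h1 l)).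
have [v2 hv2] := bochner_multiplier (borel_cpow_mul n b2) (fun l => cpow_mul_le n (h2 l)).
suff -> : v = a *: v1 + v2.
  by apply: closed_span_lin; [exact: (W1 n)|exact: (W2 n)].
apply: (bochner_unique qP q0 _ h).
  by apply: bscale; apply: borel_cpow_mul; exact: (borel_lin qcP qc0 a b1 b2).
have := bochner_lin qP q0 a (bscale (borel_cpow_mul n b1)) (bscale (borel_cpow_mul n b2)) hv1 hv2.
congr (is_bochner_integral _ _ _); apply/funext => l.
by rewrite mulrDr scalerDl scalerA mulrCA.
Qed.

Lemma good_cpow k phi : good phi -> good (fun l => cpow k l * phi l).
Proof.
move=> [b1 [M1 h1] W1]; split; first exact: borel_cpow_mul.
  by exists M1 => l; exact: cpow_mul_le.
move=> n v h; apply: (W1 (n + k)); move: h; congr (is_bochner_integral _ _ _).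
by apply/funext => l; rewrite mulrA cpowM.
Qed.

Lemma good_cvg (phi_ : nat -> Cborel R -> R[i]^o) phi (M : R) : (forall k, good (phi_ k)) ->
  (forall k l, rnorm (phi_ k l) <= M) -> (forall l, phi_ k l @[k --> \oo] --> phi l) -> good phi.
Proof.
move=> gphi phiM cphi.
have b_ k : borel_map (phi_ k) by have [] := gphi k.
have bphi : borel_map phi by exact: borel_map_cvg b_ cphi.
have phM l : rnorm (phi l) <= M.
  by apply: (cvgr_to_le (cvg_rnorm (cphi l))); exact: nearW.
split => //; first by exists M.
move=> n v h.
have /choice[v_ hv_] : forall k, exists v, is_bochner_integral mu (fun l => (cpow n l * phi_ k l) *: E l) v.
  by move=> k; exact: (bochner_multiplier (borel_cpow_mul n (b_ k)) (fun l => cpow_mul_le n (phiM k l))).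
apply: (@closed_span_cvg v_); first by move=> k; have [_ _] := gphi k; apply; exact: hv_.
have M0 : 0 <= M by apply: le_trans (phM 0); exact: rnorm_ge0.
apply: (bochner_dominated qP q0 (G := fun l => (M + M) * rnorm (E l)) _ _ _ _ _ hv_ h).
- by move=> k; apply: bscale; exact: borel_cpow_mul.
- by apply: bscale; exact: borel_cpow_mul.
- rewrite (_ : EFin \o _ = (fun l => (M + M)%:E * (rnorm (E l))%:E)%E)//.
  by apply: integrableZl => //; exact: integrable_rnorm.
- move=> k l; rewrite -scalerBl rnormZ ler_wpM2r ?rnorm_ge0//.
  by apply: le_trans (rnormD _ _) _; rewrite rnormN lerD// cpow_mul_le.
- apply: filterE => l; rewrite mulrC -scalerA.
  rewrite (_ : (fun k => _) = fun k => phi_ k l *: (cpow n l *: E l)); last first.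
    by apply/funext => k; rewrite scalerA mulrC.
  by apply: cvgZr_tmp; exact: cphi.
Qed.

(** Defined by their action on all good functions, multipliers are closed under products at once. *)
Definition multiplier (psi : Cborel R -> R) :=
  forall phi, good phi -> good (fun l => (psi l)%:C * phi l).

Lemma multiplier_lin (a : R) psi psi' : multiplier psi -> multiplier psi' ->
  multiplier (fun l => a * psi l + psi' l).
Proof.
move=> m1 m2 phi gphi; have := good_lin a%:C (m1 _ gphi) (m2 _ gphi).
by congr good; apply/funext => l; rewrite rmorphD rmorphM /= mulrDl mulrA.
Qed.

Lemma multiplierM psi psi' : multiplier psi -> multiplier psi' ->
  multiplier (fun l => psi l * psi' l).
Proof.
move=> m1 m2 phi gphi; have := m1 _ (m2 _ gphi).
by congr good; apply/funext => l; rewrite rmorphM /= mulrA.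
Qed.

Lemma multiplier1 : multiplier (fun=> 1).
Proof.
by move=> phi; congr good; apply/funext => l; rewrite mul1r.
Qed.

Lemma multiplierB psi psi' : multiplier psi -> multiplier psi' ->
  multiplier (fun l => psi l - psi' l).
Proof.
move=> m1 m2; have := multiplier_lin (-1) m2 m1.
by congr multiplier; apply/funext => l; rewrite mulN1r addrC.
Qed.

Lemma multiplierZ (a : R) psi : multiplier psi -> multiplier (fun l => a * psi l).
Proof.
move=> m1; have := multiplier_lin a m1 (multiplierB m1 m1).
by congr multiplier; apply/funext => l; rewrite subrr addr0.
Qed.

Lemma multiplierX psi n : multiplier psi -> multiplier (fun l => psi l ^+ n).
Proof.
move=> m; elim: n => [|n ih].
  by have := multiplier1; congr multiplier; apply/funext => l; rewrite expr0.
by have := multiplierM m ih; congr multiplier; apply/funext => l; rewrite exprS.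
Qed.

Lemma multiplier_cvg (psi_ : nat -> Cborel R -> R) psi : (forall k, multiplier (psi_ k)) ->
  (forall k l, `|psi_ k l| <= 1) -> (forall l, psi_ k l @[k --> \oo] --> psi l) ->
  multiplier psi.
Proof.
move=> m_ psi1 cpsi phi gphi; have [_ [M phM] _] := gphi.
apply: (@good_cvg (fun k l => (psi_ k l)%:C * phi l) _ M) => [k|k l|l]; first exact: m_.
  rewrite (rnormZ ((psi_ k l)%:C) (phi l)) rnorm_complex.
  by apply: le_trans (phM l); rewrite ler_piMl// rnorm_ge0.
apply/rcvgP => e e0; have := cpsi l => /cvgrPdist_lt/(_ (e / (rnorm (phi l) + 1))).
have K0 : 0 < rnorm (phi l) + 1 by rewrite ltr_wpDl// rnorm_ge0.
rewrite divr_gt0// => /(_ isT); apply: filterS => k h.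
rewrite -mulrBl -rmorphB (rnormZ ((psi l - psi_ k l)%:C) (phi l)) rnorm_complex.
apply: (@le_lt_trans _ _ (`|psi l - psi_ k l| * (rnorm (phi l) + 1))).
  by rewrite ler_wpM2l// lerDl.
by rewrite -ltr_pdivlMr.
Qed.

(* The polynomials in [t] defined by [p' = p + (t^2 - p^2)/2] increase to [|t|]
   on [-1, 1]. *)
Lemma abs_approx (p : nat -> R) (t : R) : `|t| <= 1 -> p 0%N = 0 ->
  (forall k, p k.+1 = p k + (t ^+ 2 - p k ^+ 2) / 2) ->
  (forall k, 0 <= p k <= `|t|) /\ p k @[k --> \oo] --> `|t|.
Proof.
move=> t1 p0 pS; set s := `|t| in t1 *.
have s0 : 0 <= s by exact: normr_ge0.
have t2 : t ^+ 2 = s ^+ 2 by rewrite /s real_normK ?num_real.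
have pk k : 0 <= p k <= s /\ s - p k <= s * (1 - s / 2) ^+ k.
  elim: k => [|k [/andP[pk0 pks] ih]]; first by rewrite p0 lexx s0 subr0 expr0 mulr1.
  have e1 : p k.+1 = p k + (s - p k) * ((s + p k) / 2) by rewrite pS t2; field.
  have e2 : s - p k.+1 = (s - p k) * (1 - (s + p k) / 2) by rewrite e1; ring.
  have h1 : 0 <= (s - p k) * ((s + p k) / 2).
    by rewrite mulr_ge0 ?subr_ge0// divr_ge0// addr_ge0.
  have h2 : 0 <= (s - p k) * (1 - (s + p k) / 2).
    by rewrite mulr_ge0 ?subr_ge0//; lra.
  split; first by apply/andP; split; lra.
  rewrite e2 exprS mulrCA; apply: (@le_trans _ _ ((1 - s / 2) * (s - p k))).
    by rewrite mulrC ler_wpM2r ?subr_ge0//; lra.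
  by rewrite ler_wpM2l//; lra.
split; first by move=> k; have [] := pk k.
have [s_eq0|s_neq0] := eqVneq s 0.
  rewrite (_ : p = fun=> s); first exact: cvg_cst.
  apply/funext => k; have [/andP[a b] _] := pk k; apply/eqP; rewrite eq_le b /=.
  by rewrite s_eq0.
have s_gt0 : 0 < s by rewrite lt_def s_neq0.
have : geometric s (1 - s / 2) k @[k --> \oo] --> 0.
  by apply: cvg_geometric; rewrite ger0_norm; lra.
move=> /cvgrPdist_lt g; apply/cvgrPdist_lt => e /g; apply: filterS => k.
have [/andP[a b] h] := pk k; rewrite /geometric /= sub0r normrN => he.
rewrite ger0_norm ?subr_ge0//; apply: le_lt_trans h _.
by apply: le_lt_trans he; exact: ler_norm.
Qed.

(** Polynomials in [psi] tend to its absolute value, which yields the positive part [h] of [psi];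
    then [1 - (1 - h) ^+ k] tends to the indicator of [h > 0]. The approximants stay in [[0, 1]], as
    bounded convergence requires. *)
Lemma multiplier_pos psi : multiplier psi -> (forall l, `|psi l| <= 1) ->
  multiplier (fun l => \1_[set l | 0 < psi l] l).
Proof.
move=> mpsi psi1.
pose p l := fix p k : R := if k is k'.+1 then p k' + (psi l ^+ 2 - p k' ^+ 2) / 2 else 0.
have pP l := @abs_approx (p l) (psi l) (psi1 l) erefl (fun=> erefl).
have mp k : multiplier (fun l => p l k).
  elim: k => [|k ih].
    by have := multiplierB mpsi mpsi; congr multiplier; apply/funext => l; rewrite subrr.
  have := multiplier_lin (2^-1) (multiplierB (multiplierX 2 mpsi) (multiplierX 2 ih)) ih.
  by congr multiplier; apply/funext => l /=; rewrite addrC mulrC.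
have mabs : multiplier (fun l => `|psi l|).
  apply: (multiplier_cvg mp); last by move=> l; have [] := pP l.
  move=> k l; have [/(_ k)/andP[h1 h2] _] := pP l.
  by rewrite ger0_norm//; apply: le_trans h2 (psi1 l).
pose h l := 2^-1 * (psi l + `|psi l|).
have h01 l : 0 <= h l <= 1.
  have := psi1 l; have := ler_norm (psi l); have := ler_norm (- psi l).
  by rewrite normrN /h => ? ? ?; apply/andP; split; lra.
have mh : multiplier h.
  apply: multiplierZ; have := multiplier_lin 1 mpsi mabs.
  by congr multiplier; apply/funext => l; rewrite mul1r.
apply: (@multiplier_cvg (fun k l => 1 - (1 - h l) ^+ k)).
- move=> k; apply: multiplierB; first exact: multiplier1.
  exact: (multiplierX k (multiplierB multiplier1 mh)).
- move=> k l; have /andP[h0 h1] := h01 l.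
  have k0 : 0 <= (1 - h l) ^+ k by rewrite exprn_ge0// subr_ge0.
  have k1 : (1 - h l) ^+ k <= 1 by rewrite exprn_ile1//; lra.
  by rewrite ger0_norm; lra.
- move=> l; have /andP[h0 h1] := h01 l; rewrite indicE.
  have [p0|p0] := ltP 0 (psi l).
    rewrite mem_set//=; rewrite -[X in _ --> X]subr0; apply: cvgB; first exact: cvg_cst.
    have : geometric 1 (1 - h l) k @[k --> \oo] --> 0.
      apply: cvg_geometric; rewrite ger0_norm; first by rewrite /h gtr0_norm//; lra.
      by rewrite subr_ge0.
    by rewrite (_ : geometric 1 _ = fun k => (1 - h l) ^+ k)//; apply/funext => k; rewrite /geometric/= mul1r.
  rewrite memNset /=; last by apply/negP; rewrite -leNgt.
  rewrite (_ : (fun k => _) = fun=> 0); first exact: cvg_cst.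
  by apply/funext => k; rewrite /h ler0_norm// subrr mulr0 subr0 expr1n subrr.
Qed.

(** On the circle [|w - l|^2 = |w|^2 + 1 - conj(w) l - w l^-1] is a trigonometric polynomial in [l].
    Division by [B] brings [r^2 - |w - l|^2] into [[-1, 1]], since [|w - l| <= 1 + |w|]. *)
Lemma multiplier_disc (w : R[i]) (r : R) : 0 < r ->
  multiplier (fun l => \1_(circle `&` [set l | rnorm (w - l : R[i]^o) < r]) l).
Proof.
move=> r0; case: w => u v.
pose nw := Num.sqrt (u ^+ 2 + v ^+ 2).
have nw0 : 0 <= nw by exact: sqrtr_ge0.
have nw2 : nw ^+ 2 = u ^+ 2 + v ^+ 2 by rewrite sqr_sqrtr// addr_ge0 ?sqr_ge0.
pose B := r ^+ 2 + (1 + nw) ^+ 2.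
have B0 : 0 < B by rewrite ltr_wpDr ?sqr_ge0// exprn_gt0.
pose D (l : R[i]) := (u - complex.Re l) ^+ 2 + (v - complex.Im l) ^+ 2.
have D0 l : 0 <= D l by rewrite addr_ge0 ?sqr_ge0.
have rD l : (rnorm ((u +i* v) - l : R[i]^o) < r) = (0 < r ^+ 2 - D l).
  case: l => x y; rewrite subr_gt0 /rnorm normc_def/= /D/=.
  by rewrite -[in RHS]ltr_sqrt ?exprn_gt0// sqrtr_sqr (ger0_norm (ltW r0)).
pose psi (l : Cborel R) := if l \in circle then (r ^+ 2 - D l) / B else 0.
have circ2 x y : circle (x +i* y : R[i]) -> x ^+ 2 + y ^+ 2 = 1.
  rewrite /circle /= normc_def => -[h].
  by rewrite -[RHS](expr1n R 2) -h /= sqr_sqrtr// addr_ge0 ?sqr_ge0.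
have psi1 l : `|psi l| <= 1.
  rewrite /psi; case: ifPn => [/set_mem|_]; last by rewrite normr0.
  case: l => x y /circ2 xy1; rewrite normrM normfV (gtr0_norm B0) ler_pdivrMr// mul1r.
  have h : D (x +i* y) <= (1 + nw) ^+ 2.
    have h1 : (x * u + y * v) ^+ 2 <= nw ^+ 2.
      rewrite nw2 -[leRHS]mul1r -xy1 -subr_ge0.
      by rewrite [leRHS](_ : _ = (x * v - y * u) ^+ 2) ?sqr_ge0//; ring.
    have h2 : - nw <= x * u + y * v.
      have : `|x * u + y * v| <= nw by rewrite -(ger0_norm nw0) -ler_sqr ?nnegrE// !real_normK ?num_real.
      by rewrite ler_norml => /andP[].
    rewrite /D /= (_ : (u - x) ^+ 2 + (v - y) ^+ 2 =
      (u ^+ 2 + v ^+ 2) + (x ^+ 2 + y ^+ 2) - 2 * (x * u + y * v)); last by ring.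
    rewrite -nw2 xy1 (_ : (1 + nw) ^+ 2 = nw ^+ 2 + 1 + 2 * nw); last by ring.
    by lra.
  have r2 : 0 < r ^+ 2 by rewrite exprn_gt0.
  have := D0 (x +i* y); rewrite ler_norml /B => h'; have := sqr_ge0 (1 + nw) => h''.
  by apply/andP; split; lra.
have mpsi : multiplier psi.
  move=> phi gphi.
  have gz : good (fun l => -1 * phi l + phi l) by exact: good_lin.
  have := good_lin ((r ^+ 2 - 1 - nw ^+ 2) / B)%:C (good_cpow 0 gphi)
    (good_lin (B^-1%:C * (u -i* v)) (good_cpow 1 gphi)
      (good_lin (B^-1%:C * (u +i* v)) (good_cpow (-1) gphi) gz)).
  congr good; apply/funext => l; rewrite mulN1r addNr addr0 !mulrA -!mulrDl; congr (_ * _).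
  rewrite /psi /cpow; case: ifPn => [/set_mem|_]; last by rewrite !mulr0 !addr0.
  move=> cl; rewrite expr0z mulr1 expr1z exprN1 circle_conj//; move: cl.
  case: l => x y cl; have xy1 := circ2 _ _ cl.
  rewrite /= /D /=; simpc; rewrite nw2; congr (_ +i* _); last by ring.
  by rewrite -xy1; ring.
have := multiplier_pos mpsi psi1; congr multiplier; apply/funext => l.
rewrite !indicE; congr (nat_of_bool _)%:R; apply/idP/idP; rewrite !inE /psi /=.
  case: ifPn => [/set_mem cl|]; last by rewrite ltxx.
  by rewrite pmulr_lgt0 ?invr_gt0// -rD.
by move=> [cl]; rewrite mem_set// rD pmulr_lgt0 ?invr_gt0.
Qed.

Definition multiplier_set (B : set (Cborel R)) := multiplier (fun l => \1_B l).

Lemma multiplier_setT : multiplier_set setT.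
Proof.
by have := multiplier1; congr multiplier; apply/funext => l; rewrite indicT.
Qed.

Lemma multiplier_setD A B : multiplier_set A -> multiplier_set B -> multiplier_set (A `\` B).
Proof.
move=> mA mB; have := multiplierB mA (multiplierM mA mB).
congr multiplier; apply/funext => l; rewrite !indicE in_setD.
by case: (l \in A); case: (l \in B); rewrite ?mulr0 ?mulr1 ?subrr ?subr0.
Qed.

Lemma multiplier_setU A B : multiplier_set A -> multiplier_set B -> multiplier_set (A `|` B).
Proof.
move=> mA mB; have := multiplier_lin 1 mA (multiplier_setD mB mA).
congr multiplier; apply/funext => l; rewrite !indicE in_setD in_setU.
by case: (l \in A); case: (l \in B); rewrite ?mulr0 ?mulr1 ?addr0 ?add0r.
Qed.

Lemma multiplier_set0 : multiplier_set set0.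
Proof. by have := multiplier_setD multiplier_setT multiplier_setT; rewrite setDT. Qed.

Lemma multiplier_bigcup (B : nat -> set (Cborel R)) :
  (forall k, multiplier_set (B k)) -> multiplier_set (\bigcup_k B k).
Proof.
move=> mB; pose U k := \big[setU/set0]_(i < k) B i.
have mU k : multiplier_set (U k).
  rewrite /U; elim: k => [|k ih]; first by rewrite big_ord0; exact: multiplier_set0.
  by rewrite big_ord_recr; exact: multiplier_setU.
apply: (multiplier_cvg mU) => [k l|l].
  by rewrite indicE; case: (l \in U k); rewrite ?normr1 ?normr0.
have [[k _ Bk]|nB] := pselect ((\bigcup_k B k) l).
  rewrite [X in _ --> X]indicE mem_set; last by exists k.
  apply: cvg_near_cst; exists k.+1 => // m /= km.
  by rewrite indicE mem_set// /U -bigcup_mkord; exists k.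
rewrite [X in _ --> X]indicE memNset//.
rewrite (_ : (fun k => _) = fun=> 0%:R); first exact: cvg_cst.
apply/funext => k; rewrite indicE memNset// /U -bigcup_mkord => -[i _ Bi].
by apply: nB; exists i.
Qed.

(** The sets whose trace on the circle is a multiplier set form a sigma-algebra. It contains the
    open sets, which are countable unions of discs centred in a dense sequence. *)
Lemma multiplier_borel (B : set (Cborel R)) : measurable B -> multiplier_set (circle `&` B).
Proof.
have [qc [qc0 qcP]] := @complex_dense R.
have mopen (U : set R[i]^o) : open U -> multiplier_set (circle `&` U).
  move=> /openP_rnorm oU.
  pose ball i m : set (Cborel R) := [set l | rnorm (qc i - l : R[i]^o) < m.+1%:R^-1].
  pose D i m := if pselect (ball i m `<=` U) then circle `&` ball i m else set0.
  have mD i m : multiplier_set (D i m).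
    rewrite /D; case: (pselect (ball i m `<=` U)) => sub; last exact: multiplier_set0.
    by apply: multiplier_disc; rewrite invr_gt0.
  rewrite (_ : circle `&` U = \bigcup_i \bigcup_m D i m); last first.
    apply/seteqP; split=> [l [cl Ul]|l [i _ [m _]]]; last first.
      by rewrite /D; case: pselect => // sub [cl /sub].
    have [r r0 rU] := oU _ Ul.
    have [m _ /(_ m (leqnn m)) mr] := near_infty_natSinv_lt (PosNum (divr_gt0 r0 (@ltr0Sn R 1))).
    have [|i li] := qcP l m.+1%:R^-1; first by rewrite invr_gt0.
    exists i => //; exists m => //; rewrite /D; case: (pselect (ball i m `<=` U)) => [sub|].
      by split => //; rewrite /ball /= rnormB.
    case=> y /= iy; apply: rU; apply: le_lt_trans (rnorm_triangle _ (qc i) _) _.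
    by move: mr li iy; rewrite /ball /=; move: (m.+1%:R^-1) => s; lra.
  by apply: multiplier_bigcup => i; apply: multiplier_bigcup => m; exact: mD.
have sA : sigma_algebra setT [set B : set (Cborel R) | multiplier_set (circle `&` B)].
  have mC : multiplier_set circle by rewrite -[circle]setIT; apply: mopen; exact: openT.
  split; first by rewrite /= setI0; exact: multiplier_set0.
  - move=> A mA /=; rewrite (_ : circle `&` _ = circle `\` (circle `&` A)).
      exact: multiplier_setD.
    by rewrite setTD setDIr setDv set0U setDE.
  - by move=> A mA /=; rewrite setI_bigcupr; apply: multiplier_bigcup.
by move=> mB; exact: (smallest_sub sA mopen mB).
Qed.

Lemma borel_indicator (B : set (Cborel R)) : measurable B ->
  borel_map (fun l => (\1_B l)%:C : R[i]^o).
Proof.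
move=> mB; rewrite (_ : (fun l => _) = fun l => if l \in B then (1 : R[i]^o) else 0).
  by apply: borel_map_if => //; exact: borel_map_cst.
by apply/funext => l; rewrite indicE; case: (l \in B).
Qed.

Lemma indicator_le1 (B : set (Cborel R)) l : rnorm ((\1_B l)%:C : R[i]^o) <= 1.
Proof. by rewrite rnorm_complex indicE; case: (l \in B); rewrite ?normr1 ?normr0. Qed.

Lemma closed_span_integral (B : set (Cborel R)) v : measurable B ->
  is_bochner_integral mu (fun l => (\1_(circle `&` B) l)%:C *: E l) v -> closed_span c v.
Proof.
move=> mB; have [_ _ /(_ 0 v) h] := multiplier_borel mB good1; move=> Bv; apply: h.
move: Bv; congr (is_bochner_integral _ _ _); apply/funext => l; congr (_ *: _).
rewrite /cpow indicE in_setI; case: (l \in circle) => /=; last by rewrite !mul0r.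
by rewrite expr0z mul1r mulr1.
Qed.

Lemma bochner_indicator (B : set (Cborel R)) (z : Z) : measurable B ->
  is_bochner_integral mu (fun l => (\1_B l)%:C *: z) ((fine (mu B))%:C *: z).
Proof.
move=> mB; have mh := finite_map_indicator mB.
have fE : (fun l => (\1_B l)%:C *: z) = (fun b : bool => if b then z else 0) \o (fun l => l \in B).
  by apply/funext => l; rewrite indicE /=; case: (l \in B); rewrite ?scale1r ?scale0r.
exists (fun=> (fun l => (\1_B l)%:C *: z)); split.
- by move=> n; rewrite fE; exact: simple_finite_map.
- by apply: filterE => l; exact: cvg_cst.
- rewrite (_ : (fun n => _) = fun=> 0%E); first exact: cvg_cst.
  by apply/funext => n; under eq_integral do rewrite subrr rnorm0; rewrite integral0.
- rewrite (_ : (fun n => _) = fun=> ((fine (mu B))%:C *: z)); first exact: cvg_cst.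
  apply/funext => n; rewrite fE simple_integralE// /finite_integral.
  rewrite (bigD1 true)//= big1; last by case=> // _; rewrite scaler0.
  rewrite addr0; congr ((fine (mu _))%:C *: _).
  by apply/seteqP; split=> l /=; [exact: set_mem|exact: mem_set].
Qed.

(** Otherwise the mean of [E] over this set would be a point of the closed span at distance at most
    [r] from [z]. *)
Lemma ball_off_span (z : Z) (r : R) : 0 < r ->
  (forall w, closed_span c w -> 2 * r <= rnorm (z - w)) -> mu [set l | rnorm (z - E l) < r] = 0%E.
Proof.
move=> r0 zW; set B := [set l | _].
have mB : measurable B by exact: (bE (open_rball z r)).
pose M : set (Cborel R) := circle `&` B.
have mM : measurable M by exact: (measurableI _ _ (@measurable_circle R) mB).
have MB : mu B = mu M.
  apply: ae_measure_eq => //; move: (@ae_circle R); apply: filterS => l cl.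
  by split=> [|[]].
rewrite MB; apply/eqP; rewrite eq_le measure_ge0 andbT leNgt; apply/negP => M0.
have PM := prob_fine mu mM.
set m := fine (mu M) in PM; have m0 : 0 < m by rewrite -lte_fin PM.
have bM := borel_indicator mM.
have [v Mv] := bochner_multiplier bM (fun l => indicator_le1 M l).
have Wv : closed_span c v by exact: closed_span_integral Mv.
have bz : borel_map (fun l => (\1_M l)%:C *: z).
  exact: (borel_scale qP q0 bM (borel_map_cst z)).
have Mvz := bochnerB qP q0 (bscale bM) bz Mv (bochner_indicator z mM).
have := bochner_norm qP q0 (borelB qP q0 (bscale bM) bz) Mvz.
have : (\int[mu]_l (rnorm ((\1_M l)%:C *: E l - (\1_M l)%:C *: z))%:E <=
    \int[mu]_l (r%:E * (\1_M l)%:E))%E.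
  apply: le_integral_ge0 => l; first by rewrite lee_fin rnorm_ge0.
  rewrite -scalerBr rnormZ rnorm_complex -EFinM lee_fin indicE.
  have [[cl Bl]|nM] := pselect (M l); last by rewrite memNset// normr0 mul0r mulr0.
  by rewrite mem_set//= normr1 mul1r mulr1 rnormB ltW.
rewrite ge0_integralZl_EFin ?(ltW r0)//; last by apply/measurable_EFinP; exact: measurable_indic.
rewrite (integral_indic mu measurableT mM) setIT -/M => h1 h2.
have : rnorm (v - m%:C *: z) <= r * m.
  by rewrite -lee_fin EFinM; apply: le_trans h2 _; apply: le_trans h1 _; rewrite PM.
have := zW (m^-1%:C *: v + 0) (closed_span_lin _ Wv closed_span0); rewrite addr0.
have -> : z - m^-1%:C *: v = (- m^-1)%:C *: (v - m%:C *: z).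
  rewrite scalerBr scalerA -rmorphM mulNr mulVf ?gt_eqF// rmorphN rmorph1 scaleN1r opprK.
  by rewrite rmorphN scaleNr addrC.
rewrite rnormZ rnorm_complex normrN normfV (gtr0_norm m0) => h3 h4.
have : m^-1 * rnorm (v - m%:C *: z) <= r.
  by rewrite mulrC ler_pdivrMr.
by lra.
Qed.

Lemma ae_closed_span : \forall l \ae mu, closed_span c (E l).
Proof.
pose ball i m := [set l | rnorm (q i - E l) < m.+1%:R^-1].
have mball i m : measurable (ball i m) by exact: (bE (open_rball (q i) m.+1%:R^-1)).
pose far i m := forall w, closed_span c w -> 2 * m.+1%:R^-1 <= rnorm (q i - w).
pose N := \bigcup_i \bigcup_m (if pselect (far i m) then ball i m else set0).
have mN' i m : measurable (if pselect (far i m) then ball i m else set0).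
  by case: (pselect (far i m)) => h /=; [exact: mball|exact: measurable0].
have : mu.-negligible N.
  apply: negligible_bigcup => i; apply: negligible_bigcup => m.
  exists (if pselect (far i m) then ball i m else set0); split => //.
  case: (pselect (far i m)) => [fim|h]; last exact: measure0.
  by apply: ball_off_span => //; rewrite invr_gt0.
apply: negligibleS => l /= /existsNP[e /not_implyP[e0 /forallNP hb]].
have dist w : closed_span c w -> e <= rnorm (E l - w).
  move=> Ww; apply/ler_addgt0Pr => e' e'0; have [b [n [bn wb]]] := Ww e' e'0.
  have /forallNP/(_ n) := hb b => /not_andP[//|/negP]; rewrite -leNgt => h.
  by apply: le_trans h _; apply: le_trans (rnorm_triangle _ w _) _; rewrite lerD2l ltW.
(* With [1/(m+1) < e / 3], a centre within [1/(m+1)] of [E l] is still at distance at least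
   [2/(m+1)] from the span. *)
have [m _ /(_ m (leqnn m)) mr] := near_infty_natSinv_lt (PosNum (divr_gt0 e0 (@ltr0Sn R 2))).
have [|i li] := qP (E l) (_ : 0 < m.+1%:R^-1); first by rewrite invr_gt0.
exists i => //; exists m => //; case: (pselect (far i m)) => [h|nf]; first by rewrite /ball /= rnormB.
exfalso; apply: nf => w Ww; have := rnorm_triangle (E l) (q i) w; have := dist w Ww.
by move: mr li => /=; move: (m.+1%:R^-1) => s; lra.
Qed.

End Density.

(** * Fourier coefficients of the eigenvectorfield *)

Lemma borel_version {R : realType} {Z : normedModType R[i]} {d} {X : measurableType d}
    (mu : probability X R) (f : X -> Z) : strongly_measurable mu f ->
  exists2 g, borel_map g & \forall x \ae mu, f x = g x.
Proof.
move=> [s_ [ss [N [mN N0 NP]]]].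
exists (fun x => if x \in N then 0 else f x); last first.
  exists N; split => // x /= h; apply: contrapT => xN; apply: h; by rewrite memNset.
apply: (@borel_map_cvg _ _ _ _ (fun n x => if x \in N then 0 else s_ n x)).
  by move=> n; apply: borel_map_if => //; [exact: borel_map_cst|exact: simple_borel (ss n)].
move=> x; case: ifPn => [_|/negP xN]; first exact: cvg_cst.
by apply: contrapT => h; apply: xN; rewrite inE; exact: NP.
Qed.

Lemma separable_sequence {R : realType} {Z : normedModType R[i]} : separable Z ->
  exists q : nat -> Z, q 0%N = 0 /\ dense_sequence q.
Proof.
move=> [D /countable_injP[g ginj] dD].
exists (fun n => if n is m.+1 then xget 0 [set z | D z /\ g z = m] else 0); split => // z e e0.
have [w [zw Dw]] : [set y | rnorm (z - y) < e] `&` D !=set0.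
  by apply: dD; [exists z; rewrite /= subrr rnorm0|exact: open_rball].
exists (g w).+1; set y := xget _ _.
have [Dy gy] : D y /\ g y = g w.
  by apply: (xgetPex 0 (P := [set z | D z /\ g z = g w])); exists w.
by rewrite (ginj y w (mem_set Dy) (mem_set Dw) gy).
Qed.

Lemma int_minimum (P : pred int) (B n0 : int) : (forall n, P n -> B <= n) -> P n0 ->
  exists2 a, P a & forall n, P n -> a <= n.
Proof.
move=> PB Pn0; have ex : exists k, P (B + Posz k).
  by exists `|n0 - B|%N; rewrite gez0_abs ?subr_ge0 ?PB// (addrC B) subrK.
exists (B + Posz (ex_minn ex)); first by case: ex_minnP.
move=> n Pn; case: ex_minnP => k _ /(_ `|n - B|%N).
have Bn := PB _ Pn; rewrite gez0_abs ?subr_ge0// (addrC B) subrK => /(_ Pn).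
by move: Bn; clear; lia.
Qed.

Lemma unconditionally_convergent_shift {R : realType} {Z : normedModType R[i]}
    (c : int -> Z) (s : int) :
  unconditionally_convergent c -> unconditionally_convergent (fun n => c (n + s)).
Proof.
move=> uc u bu; apply: (uc (fun k => u k + s)).
by apply: (bij_comp (f := fun n => n + s)) bu; exact: Bijective (addrK s) (subrK s).
Qed.

Lemma closed_span_shift {R : realType} {Z : completeNormedModType R[i]} (c : int -> Z)
    (s : int) z : unconditionally_cauchy c -> unconditionally_cauchy (fun n => c (n + s)) ->
  closed_span c z -> closed_span (fun n => c (n + s)) z.
Proof.
move=> uc ucs cz e /cz[b [N [bN zb]]].
exists (fun n => b (n + s)), (N + `|s|)%N; split.
  by move=> n Nn; apply: bN; move: Nn; clear; lia.
rewrite (@bilateral_sum_fin _ _ _ (map (fun n => n - s) (window N))).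
- rewrite big_map; move: zb; rewrite (@bilateral_sum_fin _ _ _ (window N)) ?uniq_window//.
    rewrite [X in _ -> rnorm (_ - X) < _](eq_bigr (fun n => b n *: c n))// => n _.
    by rewrite /= subrK.
  by move=> n; rewrite mem_window -ltnNge; exact: bN.
- by rewrite map_inj_uniq ?uniq_window//; exact: addIr.
- move=> n nw; apply: bN; rewrite ltnNge; apply: contra nw => nN.
  by apply/mapP; exists (n + s); rewrite ?mem_window// addrK.
Qed.

Section FourierCoefficients.
Context {R : realType} {Z : completeNormedModType R[i]}.
Context (A : {linear Z -> Z}) (E : R[i] -> Z) (q : nat -> Z).
Hypothesis qP : dense_sequence q.
Hypothesis q0 : q 0%N = 0.
Hypothesis cA : continuous A.
Hypothesis AE : L2_eigenvectorfield A E.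
Notation mu := (@circle_measure R).
Notation inorm f := (\int[mu]_x (rnorm (f x))%:E)%E.
Notation c := (fourier_coef E).

(** On a probability space [x <= 1 + x ^ 2] leads from square integrability to integrability. *)
Lemma eigenvectorfield_borel : exists E' : Cborel R -> Z,
  [/\ borel_map E', \forall l \ae mu, E l = E' l & (inorm E' < +oo)%E].
Proof.
have [sE E2 _] := AE; have [E' bE' EE'] := borel_version sE.
exists E'; split => //.
have m2 : measurable_fun setT (fun l : Cborel R => (rnorm (E' l) ^+ 2)%:E).
  apply/measurable_EFinP; apply: measurable_funX; exact: measurable_rnorm.
apply: (@le_lt_trans _ _ (\int[mu]_l (1%:E + (rnorm (E' l) ^+ 2)%:E))%E).
  apply: le_integral_ge0 => l; first by rewrite lee_fin rnorm_ge0.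
  by rewrite -EFinD lee_fin; have := sqr_ge0 (rnorm (E' l) - 1); nra.
rewrite ge0_integralD//; last by move=> l _; rewrite lee_fin sqr_ge0.
rewrite integral_cst// mul1e [X in (X + _)%E](_ : _ = 1%E); last exact: probability_setT.
rewrite lte_add_pinfty ?ltry//; apply: le_lt_trans E2.
have sq0 (f : Cborel R -> Z) l : (0 <= (rnorm (f l) ^+ 2)%:E)%E by rewrite lee_fin sqr_ge0.
rewrite le_eqVlt; apply/orP; left; apply/eqP; apply: ae_eq_integral_ge0 => //.
by move: EE'; apply: filterS => l ->.
Qed.

Context (E' : Cborel R -> Z).
Hypotheses (bE' : borel_map E') (EE' : \forall l \ae mu, E l = E' l).
Hypothesis iE' : (inorm E' < +oo)%E.

Let bcE n : borel_map (fun l => cpow n l *: E' l).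
Proof. by apply: (borel_scale qP q0) => //; exact: borel_cpow. Qed.

Lemma fourier_coefP n : is_bochner_integral mu (fun l => cpow (- n) l *: E' l) (c n).
Proof.
have hi : (inorm (fun l => cpow (- n) l *: E' l) < +oo)%E.
  apply: le_lt_trans iE'; apply: le_integral_ge0 => l; first by rewrite lee_fin rnorm_ge0.
  by rewrite lee_fin rnormZ ler_piMl ?rnorm_ge0 ?cpow_le1.
have [v hv] := bochner_exists qP q0 (@rcauchy_cvg _ Z) (bcE (- n)) hi.
suff -> : c n = v by [].
apply: (bochner_integral_ae qP q0 (bcE (- n)) _ hv).
move: (@ae_circle R) EE'; apply: filterS2 => l cl ->; by rewrite /cpow mem_set.
Qed.

(** [A] passes under the integral and multiplies the integrand by [l], which lowers the index by
    one. *)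
Lemma fourier_coef_eigen n : A (c n) = c (n - 1).
Proof.
have [_ _ Al] := AE.
have h := bochner_linear qP q0 cA (bcE (- n)) (fourier_coefP n).
apply: (bochner_unique qP q0 (bcE (- (n - 1))) _ (fourier_coefP (n - 1))).
apply: bochner_ae_eq h; have : \forall l \ae mu, E l = E' l /\ A (E l) = (l : R[i]) *: E l by exact: filterI EE' Al.
move: (@ae_circle R); apply: filterS2 => l cl [<- AEl]; rewrite linearZ_LR AEl scalerA; congr (_ *: _).
have := cpowM (- n) 1 l; rewrite [cpow 1 l]/cpow mem_set// expr1z => ->.
by rewrite opprB addrC.
Qed.

(** [z0 (c n)] is the [n]-th Fourier coefficient of [p]; by orthogonality it vanishes unless [n] is
    an exponent of [p]. *)
Lemma fourier_coef_functional (z0 : {linear Z -> R[i]^o}) (p : R[i] -> R[i]) :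
  continuous z0 -> trigonometric_polynomial p -> (\forall l \ae mu, z0 (E l) = p l) ->
  exists F : seq int, forall n, z0 (c n) != 0 -> n \in F.
Proof.
move=> cz [s sP] zE; exists (map fst s) => n; apply: contraNT => ns; apply/eqP.
have [qc [qc0 qcP]] := @complex_dense R.
pose f (s : seq (int * R[i])) l := \sum_(k <- s) k.2 * cpow (k.1 - n) l.
have [bf hf] : borel_map (f s : _ -> R[i]^o) /\ is_bochner_integral mu (f s : _ -> R[i]^o) 0.
  elim: s ns {sP} => [_|k s ih].
    rewrite (_ : f [::] = fun=> 0); last by apply/funext => l; rewrite /f big_nil.
    by split; [exact: borel_map_cst|exact: bochner_cst].
  rewrite inE negb_or => /andP[nk /ih[b1 h1]].
  rewrite (_ : f _ = fun l => k.2 * cpow (k.1 - n) l + f s l); last first.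
    by apply/funext => l; rewrite /f big_cons.
  split; first exact: (borel_lin qcP qc0 k.2 (borel_cpow _) b1).
  have := bochner_lin qcP qc0 k.2 (borel_cpow _) b1 (bochner_cpow _) h1.
  by rewrite scaler0 addr0; apply; rewrite subr_eq0 eq_sym.
apply: (bochner_unique qcP qc0 bf _ hf).
apply: bochner_ae_eq (bochner_linear qP q0 cz (bcE (- n)) (fourier_coefP n)).
have : \forall l \ae mu, E l = E' l /\ z0 (E l) = p l by exact: filterI EE' zE.
move: (@ae_circle R); apply: filterS2 => l cl [<- zEl].
rewrite linearZ_LR zEl sP// /f scaler_sumr; apply: eq_bigr => k _.
rewrite -[LHS]/(cpow (- n) l * (k.2 * (l : R[i]) ^ k.1)) mulrCA; congr (_ * _).
by have := cpowM (- n) k.1 l; rewrite [cpow k.1 l]/cpow mem_set// => ->; rewrite addrC.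
Qed.

Hypothesis uc : unconditionally_cauchy c.

(** The values of [E] lie in the closed span of the [c n] outside a null set; the hypothesis on sets
    of full measure is applied to its complement in the circle. *)
Lemma fourier_coef_span :
  (forall B : set (Cborel R), measurable B -> B `<=` circle ->
     mu B = 1%E -> closure (linear_span (E @` B)) = setT) ->
  forall z, closed_span c z.
Proof.
move=> full z.
have [N [mN N0 NP]] := filterI EE' (ae_closed_span qP q0 bE' iE' fourier_coefP uc).
pose B : set (Cborel R) := circle `\` N.
have mB : measurable B by apply: measurableD => //; exact: measurable_circle.
have B1 : mu B = 1%E.
  apply: ae_prob1 => //.
  have Nn : \forall l \ae mu, ~ N l by exists N; split => // l /= /contrapT.
  by move: (@ae_circle R) Nn; apply: filterS2.
have BW l : B l -> closed_span c (E l).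
  move=> [_ nN]; have [EE Wl] : E l = E' l /\ closed_span c (E' l).
    by apply: contrapT => h; apply: nN; exact: NP.
  by rewrite EE.
have : closure (linear_span (E @` B)) z by rewrite full// => l [].
move=> /closureP_rnorm cl.
have W w : linear_span (E @` B) w -> closed_span c w.
  move=> [s [sB ->]]; elim: s sB => [_|k s ih sB]; first by rewrite big_nil; exact: closed_span0.
  rewrite big_cons; apply: closed_span_lin => //.
    by have [l Bl <-] := sB k (mem_head _ _); exact: BW.
  by apply: ih => k' k's; apply: sB; rewrite inE k's orbT.
move=> e e0; have e2 : 0 < e / 2 by rewrite divr_gt0.
have [w Ww zw] := cl _ e2; have [b [m [bm wb]]] := W w Ww _ e2.
exists b, m; split => //; apply: le_lt_trans (rnorm_triangle _ w _) _.
by rewrite [ltRHS]splitr ltrD.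
Qed.

End FourierCoefficients.

(** * Choice of the shift of indices *)

Lemma closed_span_functional {R : realType} {Z : completeNormedModType R[i]}
    (c : int -> Z) (z0 : {linear Z -> R[i]^o}) : unconditionally_cauchy c ->
  continuous z0 -> (exists z, z0 z != 0) -> (forall z, closed_span c z) ->
  exists n, z0 (c n) != 0.
Proof.
move=> uc cz [z zz] W; apply: contrapT => /forallNP zc.
have zc0 n : z0 (c n) = 0 by apply/eqP; apply: contrapT => /negP; exact: zc.
have [K K0 hK] := rnorm_bounded cz.
have pz : 0 < rnorm (z0 z).
  by rewrite lt_def rnorm_ge0 andbT; apply: contra zz => /eqP/rnorm_eq0 ->.
have [b [N [bN zb]]] := W z _ (divr_gt0 pz K0).
have [M bM] := finite_bounded bN.
have := hK (z - bilateral_sum c b).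
rewrite linearB (bilateral_sum_functional (F := [::]) uc cz _ _ bM)// big_nil subr0.
by apply/negP; rewrite -ltNge mulrC -ltr_pdivlMr.
Qed.

Theorem theorem1p7 (R : realType) (Z : completeNormedModType R[i])
    (A : {linear Z -> Z}) (E : R[i] -> Z) :
  separable Z -> infinite_dimensional Z ->
  bounded_near A (nbhs (0 : Z)) ->
  L2_eigenvectorfield A E ->
  (forall B : set (Cborel R), measurable B -> B `<=` circle ->
     circle_measure B = 1%E -> closure (linear_span (E @` B)) = setT) ->
  (exists z0 : {linear Z -> R[i]^o},
     [/\ continuous z0, exists z, z0 z != 0 &
         exists2 p : R[i] -> R[i], trigonometric_polynomial p &
           \forall l \ae (@circle_measure R), z0 (E l) = p l]) ->
  unconditionally_convergent (fourier_coef E) ->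
  universal_invertible_ergodic A /\
  (forall r : int, fourier_coef E (- r) = 0 ->
     (forall n : int, r <= n -> fourier_coef E (- n) = 0) /\
     universal_ergodic A).
Proof.
move=> sepZ _ /linear_bounded_continuous cA AE full [z0 [cz z0n0 [p tp zE]]] ucE.
have [q [q0 qP]] := separable_sequence sepZ.
have [E' [bE' EE' iE']] := eigenvectorfield_borel AE.
pose c := fourier_coef E.
have Ac n : A (c n) = c (n - 1) := fourier_coef_eigen qP q0 cA AE bE' EE' iE' n.
have ucs s : unconditionally_cauchy (fun n => c (n + s)).
  by apply: unconditionally_convergent_cauchy; exact: unconditionally_convergent_shift.
have uc : unconditionally_cauchy c := unconditionally_convergent_cauchy ucE.
have Acs s n : A (c (n + s)) = c (n - 1 + s) by rewrite Ac addrAC.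
have W z : closed_span c z := fourier_coef_span qP q0 bE' EE' iE' uc full z.
have Ws s z : closed_span (fun n => c (n + s)) z := closed_span_shift uc (ucs s) (W z).
have [n0 zn0] := closed_span_functional uc cz z0n0 W.
have [F zF] := fourier_coef_functional qP q0 bE' EE' iE' cz tp zE.
have [M FM] : exists M : nat, forall n, z0 (c n) != 0 -> - Posz M <= n <= Posz M.
  exists (\max_(n <- F) `|n|)%N => n /zF nF.
  have := @leq_bigmax_seq _ F xpredT (fun n : int => `|n|%N) n nF isT.
  by move: (\max_(_ <- _) _)%N => m; clear; lia.
have [a za amin] : exists2 a, z0 (c a) != 0 & forall n, z0 (c n) != 0 -> a <= n.
  by apply: (@int_minimum (fun n => z0 (c n) != 0) (- Posz M) n0) => // n /FM/andP[].
pose dg := `|Posz M - a|%N.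
have sz n : z0 (c n) != 0 -> a <= n <= a + Posz dg.
  move=> zn; rewrite amin//=; have /andP[_] := FM n zn; rewrite /dg; clear; lia.
split.
  (* Shifted by [a], the lowest coefficient seen by [z0] has index 0, so the letter at time 0 is
     within reach of [z0]. *)
  have suppa n : z0 (c (n + a)) != 0 -> Posz 0 <= n <= Posz (0 + dg).
    by move=> /sz; clear; lia.
  have z0a : z0 (c (Posz 0 + a)) != 0 by rewrite add0r.
  exact: (universal_invertible_model (ucs a) cA cz (Acs a) suppa z0a (Ws a) qP erefl).
move=> r cr0.
have cr n : r <= n -> c (- n) = 0.
  move=> rn; have -> : n = r + Posz `|n - r| by rewrite gez0_abs ?subr_ge0// (addrC r) subrK.
  elim: `|n - r|%N => [|k ih]; first by rewrite addr0.
  rewrite -addn1 PoszD addrA (_ : - _ = - (r + Posz k) - 1); last by rewrite opprD.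
  by rewrite -Ac ih linear0.
split=> //.
(* The shift is by the least [s] with [c s != 0]. It exists because [c] vanishes from [- r]
   downwards and [c n0] is nonzero; the letters at the first [a - s] times then escape [z0]. *)
have [s sn smin] : exists2 s, c s != 0 & forall n, c n != 0 -> s <= n.
  apply: (@int_minimum (fun n => c n != 0) (- r) n0); last first.
    by apply: contra zn0 => /eqP ->; rewrite linear0.
  move=> n; apply: contraNT; rewrite -ltNge => nr; rewrite -[n]opprK cr//.
  by move: nr; clear; lia.
have sa : s <= a by apply: smin; apply: contra za => /eqP ->; rewrite linear0.
have aE : Posz `|a - s| = a - s by rewrite gez0_abs ?subr_ge0.
have suppa n : z0 (c (n + s)) != 0 -> Posz `|a - s| <= n <= Posz (`|a - s| + dg).
  by move=> /sz; rewrite PoszD aE; clear; lia.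
have z0a : z0 (c (Posz `|a - s| + s)) != 0 by rewrite aE subrK.
have neg n : n < 0 -> c (n + s) = 0.
  by move=> n0'; apply/eqP; apply: contraTT n0' => /smin; clear; lia.
have c0 : c (0 + s) != 0 by rewrite add0r.
exact: (universal_ergodic_model (ucs s) cA cz (Acs s) suppa z0a (Ws s) qP neg c0).
Qed.
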